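(* Let $\mathsf{M},\theta>0$, put $M_N=\lfloor\mathsf{M}N\rfloor$, and let $\mathbb{P}^{\theta,M_N}_{\beta,N}$ be the measure defined in the context. Let $V(x)=x\log x+(\mathsf{M}+\theta-x)\log(\mathsf{M}+\theta-x)$ on $[0,\mathsf{M}+\theta]$ (with $0\log0=0$). For any $t\in[\theta,\mathsf{M}+\theta]$, $$\lim_{N\to\infty}\frac1{N^2}\log\mathbb{P}^{\theta,M_N}_{\beta,N}(\ell_1\le tN)=F_V^{\theta,\mathsf{M}+\theta}-F_V^{\theta,t}.$$ Furthermore: - If $\mathsf{M}\in(0,\theta)$, then $F_V^{\theta,t}>F_V^{\theta,\mathsf{M}+\theta}$ for $t\in[\theta,\mathsf{M}+\theta)$. - If $\mathsf{M}\ge\theta$, then $F_V^{\theta,t}>F_V^{\theta,\mathsf{M}+\theta}$ for $t\in[\theta,(\mathsf{M}+\theta)/2+\sqrt{\mathsf{M}\theta})$ and $F_V^{\theta,t}=F_V^{\theta,\mathsf{M}+\theta}$ for $t\in[(\mathsf{M}+\theta)/2+\sqrt{\mathsf{M}\theta},\mathsf{M}+\theta]$.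
   Context: $\mathbb{W}^{\theta,M}_N$ is the set of $(\ell_1,\dots,\ell_N)$ with $\ell_i=\lambda_i+(N-i)\theta$, where $M\ge\lambda_1\ge\cdots\ge\lambda_N\ge0$ are integers. The probability measure $\mathbb{P}^{\theta,M}_{\beta,N}$ on $\mathbb{W}^{\theta,M}_N$ is $$\mathbb{P}^{\theta,M}_{\beta,N}(\vec\ell)=\frac1{Z}\prod_{1\le i<j\le N}\frac{\Gamma(\ell_i-\ell_j+\theta)\Gamma(\ell_i-\ell_j+1)}{\Gamma(\ell_i-\ell_j)\Gamma(\ell_i-\ell_j+1-\theta)}\prod_{i=1}^N\frac1{\Gamma(\ell_i+1)\,\Gamma(M+N\theta-\ell_i+1-\theta)},$$ with $Z$ the normalization constant. (The subscript $\beta$ is just a label.) For $s\in[\theta,\mathsf{M}+\theta]$ let $\mathcal{A}^\theta_s$ be the set of $\phi\in L^1([0,s])$ with $0\le\phi\le\theta^{-1}$ a.e. and $\int_0^s\phi=1$, and $$F_V^{\theta,s}=\inf_{\phi\in\mathcal{A}^\theta_s}\left[-\theta\int_0^s\int_0^s\log|x-y|\phi(x)\phi(y)\,dx\,dy+\int_0^sV(x)\phi(x)\,dx\right],$$ which is a finite real number. *)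

(* Defs.v *)
From mathcomp Require Export all_boot all_order all_algebra.
From mathcomp Require Export all_classical all_reals all_analysis.

Set Implicit Arguments.
Unset Strict Implicit.
Unset Printing Implicit Defensive.

Import Order.TTheory GRing.Theory Num.Theory.
Import numFieldNormedType.Exports.

Local Open Scope classical_set_scope.
Local Open Scope ring_scope.

(* Euler's integral; it represents Gamma for x > 0 only, and all the arguments
   at which it is evaluated below are positive. *)
Definition Gamma (R : realType) (x : R) : R :=
  \int[lebesgue_measure]_(u in `]0, +oo[) (u `^ (x - 1) * expR (- u)).

(* Integers M >= lambda_1 >= ... >= lambda_N >= 0, with lambda_(i+1) stored at
   index i : 'I_N; the same shift of indices is used for ell. *)
Definition boxed_partition (N M : nat) (lam : {ffun 'I_N -> 'I_M.+1}) : bool :=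
  [forall i : 'I_N, forall j : 'I_N, (i <= j)%N ==> (lam j <= lam i)%N].

Definition ell (R : realType) (theta : R) (N M : nat)
    (lam : {ffun 'I_N -> 'I_M.+1}) : 'I_N -> R :=
  fun i => (lam i)%:R + (N - i.+1)%:R * theta.

Definition pair_interaction (R : realType) (theta d : R) : R :=
  (Gamma (d + theta) * Gamma (d + 1)) / (Gamma d * Gamma (d + 1 - theta)).

Definition site_weight (R : realType) (theta : R) (N M : nat) (x : R) : R :=
  (Gamma (x + 1) * Gamma (M%:R + N%:R * theta - x + 1 - theta))^-1.

Definition weight (R : realType) (theta : R) (N M : nat) (l : 'I_N -> R) : R :=
  (\prod_(i < N) \prod_(j < N | (i < j)%N) pair_interaction theta (l i - l j)) *
  \prod_(i < N) site_weight theta N M (l i).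

Definition partition_function (R : realType) (theta : R) (N M : nat) : R :=
  \sum_(lam : {ffun 'I_N -> 'I_M.+1} | boxed_partition lam)
    weight theta M (ell theta lam).

(* The probability of an event A about (ell_1, ..., ell_N). The sum runs over
   lambda, which ell determines. *)
Definition Prob (R : realType) (theta : R) (N M : nat)
    (A : pred ('I_N -> R)) : R :=
  \sum_(lam : {ffun 'I_N -> 'I_M.+1} |
          boxed_partition lam && A (ell theta lam))
    weight theta M (ell theta lam) / partition_function theta N M.

Definition admissible (R : realType) (theta s : R) : set (R -> R) :=
  [set phi : R -> R |
    [/\ lebesgue_measure.-integrable `[0, s] (EFin \o phi),
        {ae lebesgue_measure, forall x : R,
           x \in `[0, s] -> 0 <= phi x <= theta^-1} &
        \int[lebesgue_measure]_(x in `[0, s]) phi x = 1 ] ].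

Definition energy (R : realType) (theta s : R) (V phi : R -> R) : R :=
  - theta * \int[lebesgue_measure]_(x in `[0, s])
              \int[lebesgue_measure]_(y in `[0, s])
                (ln `|x - y| * phi x * phi y)
  + \int[lebesgue_measure]_(x in `[0, s]) (V x * phi x).

Definition F (R : realType) (theta s : R) (V : R -> R) : R :=
  inf [set energy theta s V phi | phi in admissible theta s].

(* Since ln 0 = 0 here, the convention 0 log 0 = 0 is built in. *)
Definition potential (R : realType) (M theta : R) : R -> R :=
  fun x => x * ln x + (M + theta - x) * ln (M + theta - x).

(* Main.v *)
From HB Require Import structures.
Require Import Defs.
From mathcomp Require Import all_boot all_order all_algebra.
From mathcomp Require Import all_classical all_reals all_analysis.
From mathcomp Require Import measurable_realfun ring lra.

Set Implicit Arguments.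
Unset Strict Implicit.
Unset Printing Implicit Defensive.

Import Order.TTheory GRing.Theory Num.Theory.
Import numFieldNormedType.Exports.

Local Open Scope classical_set_scope.
Local Open Scope ring_scope.


Section integration_tools.
Context {R : realType}.
Local Notation mu := (@lebesgue_measure R).
Implicit Types (f g F : R -> R) (a b c : R).

Lemma tonelli (f : R -> R -> R) :
  measurable_fun setT (fun z : R * R => f z.1 z.2) ->
  (forall x y, 0 <= f x y) ->
  (\int[mu]_x \int[mu]_y (f x y)%:E = \int[mu]_y \int[mu]_x (f x y)%:E)%E.
Proof.
move=> mf f0.
apply: (@fubini_tonelli _ _ _ _ _ mu mu (fun z => (f z.1 z.2)%:E)).
  exact/measurable_EFinP.
by move=> z; rewrite lee_fin.
Qed.

Lemma measurable_partial_integral (f : R -> R -> R) :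
  measurable_fun setT (fun z : R * R => f z.1 z.2) ->
  (forall x y, 0 <= f x y) ->
  measurable_fun setT (fun x => \int[mu]_y (f x y)%:E)%E.
Proof.
move=> mf f0.
apply: (@measurable_fun_fubini_tonelli_F _ _ _ _ _ mu (fun z => (f z.1 z.2)%:E)).
  exact/measurable_EFinP.
by move=> z; rewrite lee_fin.
Qed.

Lemma itv_exhaustion a b : a < b -> exists q : nat -> R,
  [/\ forall n, 0 < q n, forall n, a + q n < b - q n,
      (forall m n, (m <= n)%N -> q n <= q m), q n @[n --> \oo] --> (0 : R) &
      \bigcup_n `[a + q n, b - q n]%classic = `]a, b[%classic].
Proof.
move=> ab; pose d := (b - a) / 2.
have d0 : 0 < d by rewrite /d; lra.
have bd : b = a + 2 * d by rewrite /d; lra.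
clearbody d.
pose q n := d / n.+2%:R.
have q0 n : 0 < q n by rewrite divr_gt0.
have qd n : q n < d by rewrite ltr_pdivrMr// ltr_pMr// ltr1n.
have qE n : q n = d / n.+2%:R by [].
clearbody q.
exists q; split => //.
- by move=> n; have := qd n; lra.
- by move=> m n mn; rewrite !qE ler_pM2l// lef_pV2 ?posrE// ler_nat.
- have h2 : n.+2%:R^-1 @[n --> \oo] --> (0 : R).
    have := @cvg_harmonic R; rewrite -(cvg_shiftn 1).
    by apply: cvg_trans; apply: near_eq_cvg; near=> n; rewrite /= addn1.
  have -> : q = (fun n => d * n.+2%:R^-1) by apply/funext => n; exact: qE.
  by rewrite -[X in _ --> X](mulr0 d); apply: cvgM => //; exact: cvg_cst.
- apply/seteqP; split => [x [n _]|x].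
    rewrite /= !in_itv/= => /andP[h1 h2]; have h3 := q0 n; have h4 := qd n.
    by apply/andP; split; lra.
  rewrite /= in_itv/= => /andP[ax xb].
  pose e := Num.min (x - a) (b - x).
  have e0 : 0 < e by rewrite lt_min !subr_gt0 ax xb.
  exists (Num.truncn (d / e)) => //; rewrite /= in_itv/=.
  have : q (Num.truncn (d / e)) <= e.
    rewrite qE ler_pdivrMr// mulrC -ler_pdivrMr//.
    apply: (le_trans (ltW (truncnS_gt _))).
    by rewrite ler_nat.
  by rewrite /e le_min => /andP[h1 h2]; apply/andP; split; lra.
Unshelve. all: by end_near. Qed.

Lemma exhaustion_cvg_integral a b (q : nat -> R) (f : R -> \bar R) :
  (forall m n, (m <= n)%N -> q n <= q m) ->
  \bigcup_n `[a + q n, b - q n]%classic = `]a, b[%classic ->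
  measurable_fun `]a, b[ f -> (forall x, x \in `]a, b[ -> 0 <= f x)%E ->
  (\int[mu]_(x in `[(a + q n)%R, (b - q n)%R]) f x)%E @[n --> \oo] -->
  (\int[mu]_(x in `]a, b[) f x)%E.
Proof.
move=> qd bigD mf f0.
have sub n : `[a + q n, b - q n]%classic `<=` `]a, b[%classic.
  by rewrite -bigD => x xn; exists n.
rewrite -bigD; apply: ge0_nondecreasing_set_cvg_integral.
- move=> m n mn; apply/subsetPset => x; rewrite /= !in_itv/=.
  by have := qd _ _ mn => h /andP[h1 h2]; apply/andP; split; lra.
- by move=> i; exact: measurable_itv.
- by move=> i; apply: measurable_funS mf.
- by move=> i x /sub; exact: f0.
Qed.

Lemma integral_itv_FTC f F a b : a < b ->
  {in `]a, b[, forall x, 0 <= f x} ->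
  {in `]a, b[, continuous f} ->
  {in `]a, b[, forall x : R, is_derive x 1 F (f x)} ->
  {within `[a, b], continuous F} ->
  (\int[mu]_(x in `]a, b[) (f x)%:E = (F b - F a)%:E)%E.
Proof.
move=> ab f0 cf dF cF.
have [q [q0 qab qd qc bigD]] := itv_exhaustion ab.
have Dab n x : x \in `[a + q n, b - q n] -> x \in `]a, b[.
  move=> xn; suff : `]a, b[%classic x by [].
  by rewrite -bigD; exists n.
have mf : measurable_fun `]a, b[ f.
  by apply: open_continuous_measurable_fun => // x; rewrite inE/= => /cf.
have cF' x : x \in `]a, b[ -> {for x, continuous F}.
  move=> /dF d1; apply: differentiable_continuous.
  by apply/derivable1_diffP; case: d1.
have step n : (\int[mu]_(x in `[(a + q n)%R, (b - q n)%R]) (f x)%:E =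
    (F (b - q n) - F (a + q n))%:E)%E.
  rewrite (@continuous_FTC2 _ f F) ?EFinB//.
  - by apply: continuous_in_subspaceT => x; rewrite inE/= => /Dab; exact: cf.
  - split.
    + move=> x xD; have : x \in `[a + q n, b - q n] by apply: subset_itv_oo_cc.
      by move=> /Dab /dF[].
    + apply: cvg_at_right_filter; apply: cF'; apply: (Dab n).
      by rewrite in_itv/= lexx ltW.
    + apply: cvg_at_left_filter; apply: cF'; apply: (Dab n).
      by rewrite in_itv/= lexx andbT ltW.
  - move=> x xD; have : x \in `[a + q n, b - q n] by apply: subset_itv_oo_cc.
    by move=> /Dab /dF H; rewrite derive1E derive_val.
have cvg1 := @exhaustion_cvg_integral a b q (EFin \o f) qd bigD
  ((measurable_EFinP _ _).2 mf) f0.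
have [_ cFa cFb] := (continuous_within_itvP F ab).1 cF.
have cvg2 : (F (b - q n) - F (a + q n))%:E @[n --> \oo] --> (F b - F a)%:E.
  apply: cvg_EFin; first by near=> n.
  apply: cvgB.
  + move/cvg_at_leftP : cFb; apply; split => [n|]; first by have := q0 n; lra.
    by rewrite -[X in _ --> X]subr0; apply: cvgB => //; exact: cvg_cst.
  + move/cvg_at_rightP : cFa; apply; split => [n|]; first by have := q0 n; lra.
    by rewrite -[X in _ --> X]addr0; apply: cvgD => //; exact: cvg_cst.
rewrite /= (funext step) in cvg1.
exact: (cvg_unique _ cvg1 cvg2).
Unshelve. all: by end_near. Qed.

Lemma monotone_cvg_integral (D : set R) (g : nat -> R -> R) f : measurable D ->
  (forall n, measurable_fun D (g n)) -> (forall n x, D x -> 0 <= g n x) ->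
  (forall x, D x -> {homo g^~ x : m n / (m <= n)%N >-> m <= n}) ->
  (forall x, D x -> g n x @[n --> \oo] --> f x) ->
  (\int[mu]_(x in D) (g n x)%:E)%E @[n --> \oo] --> (\int[mu]_(x in D) (f x)%:E)%E.
Proof.
move=> mD mg g0 ndg gf.
have -> : (\int[mu]_(x in D) (f x)%:E = \int[mu]_(x in D) limn (fun n => (g n x)%:E))%E.
  apply: eq_integral => x /set_mem Dx; apply/esym/cvg_lim => //.
  by apply: cvg_EFin; [near=> n|exact: gf].
apply: cvg_monotone_convergence => //.
- by move=> n; exact: ((measurable_EFinP _ _).2 (mg n)).
Unshelve. all: by end_near. Qed.

Lemma integral_off_point (D : set R) (x : R) (f g : R -> \bar R) : measurable D ->
  measurable_fun D f -> (forall y, D y -> y != x -> f y = g y) ->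
  (\int[mu]_(y in D) f y = \int[mu]_(y in D) g y)%E.
Proof.
move=> mD mf fg; have mT : measurable (D `\ x : set R) by exact: measurableD.
have mf' : measurable_fun (D `\ x) f by apply: measurable_funS mf => // y [].
have fg' : {in D `\ x, f =1 g}.
  by move=> y; rewrite inE/= => -[Dy /eqP]; exact: fg.
rewrite -(integral_setD1 mT mf') -(integral_setD1 mT); first exact: eq_integral.
exact: eq_measurable_fun mf'.
Qed.

Lemma lebesgue_measure_shift c (X : set R) : measurable X ->
  pushforward mu ((fun x => x + c) : R -> measurableTypeR R) X = mu X.
Proof.
move=> mX; apply/esym.
have mshift : measurable_fun setT ((fun x => x + c) : R -> measurableTypeR R).
  exact: measurable_funD.
pose phi : {mfun _ >-> _} := HB.pack ((fun x => x + c) : R -> measurableTypeR R) (isMeasurableFun.Build _ _ _ _ _ mshift).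
apply: (@lebesgue_measure_unique R (pushforward mu phi)) => //= _ [[a b]] _ <-.
rewrite /pushforward.
have -> : (fun x => x + c) @^-1` `](a, b).1, (a, b).2]%classic = `]a - c, b - c]%classic.
  by apply/seteqP; split => x /=; rewrite !in_itv/= ltrBlDr lerBrDr.
rewrite !lebesgue_measure_itv/= !lte_fin ltrD2r; case: ifP => // _.
by rewrite -!EFinD; congr EFin; lra.
Qed.

Lemma ge0_integral_shift (f : R -> \bar R) c (X : set R) : measurable X ->
  measurable_fun setT f -> (forall x, 0 <= f x)%E ->
  (\int[mu]_(x in X) f x = \int[mu]_(x in [set x : R | X (x + c)%R]) f (x + c)%R)%E.
Proof.
move=> mX mf f0.
have mshift : measurable_fun setT ((fun x => x + c) : R -> measurableTypeR R).
  exact: measurable_funD.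
have := @ge0_integral_pushforward _ _ (measurableTypeR R) (measurableTypeR R) R _ mshift mu X f mX (measurable_funS measurableT (@subsetT _ _) mf) (fun x _ => f0 x).
move=> /= <-; apply: eq_measure_integral => //= Y mY YX.
by rewrite lebesgue_measure_shift.
Qed.

Lemma ge0_integral_opp (f : R -> \bar R) (X : set R) : measurable X ->
  measurable_fun setT f -> (forall x, 0 <= f x)%E ->
  (\int[mu]_(x in X) f x = \int[mu]_(x in [set x : R | X (- x)%R]) f (- x)%R)%E.
Proof.
move=> mX mf f0.
have mopp : measurable_fun setT (-%R : R -> measurableTypeR R).
  exact: oppr_measurable.
have := @ge0_integral_pushforward _ _ (measurableTypeR R) (measurableTypeR R) R _ mopp mu X f mX (measurable_funS measurableT (@subsetT _ _) mf) (fun x _ => f0 x).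
move=> /= <-; apply: eq_measure_integral => //= Y mY YX.
by rewrite lebesgue_measureN.
Qed.

Lemma ge0_integral_gt0 (f : R -> \bar R) (X : set R) : measurable X ->
  measurable_fun X f -> (forall x, X x -> 0 < f x)%E -> (0 < mu X)%E ->
  (0 < \int[mu]_(x in X) f x)%E.
Proof.
move=> mX mf f0 muX.
rewrite lt_neqAle integral_ge0 ?andbT; last by move=> x /f0/ltW.
apply/eqP => I0.
have : (\int[mu]_(x in X) `|f x| = 0)%E.
  rewrite [RHS]I0; apply: eq_integral => x; rewrite inE => /f0/ltW/gee0_abs//.
move/(ae_eq_integral_abs mu mX mf).1 => [N [mN N0 sub]].
have : (mu X <= mu N)%E.
  apply: le_measure; rewrite ?inE// => x Xx; apply: sub => /= /(_ Xx) fx0.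
  by have := f0 _ Xx; rewrite fx0 ltxx.
by rewrite N0 leNgt muX.
Qed.

End integration_tools.


Section log_kernel.
Context {R : realType}.
Local Notation mu := (@lebesgue_measure R).
Implicit Types (f g h : R -> R) (a b c x y A : R).

Lemma measurable_invr : measurable_fun setT (@GRing.inv R).
Proof.
rewrite (_ : GRing.inv = fun x : R => x * ((x ^+ 2) `^ (- 1))).
  apply: measurable_funM; first exact: measurable_id.
  apply: (measurableT_comp (measurable_powR (R:=R) (- 1)) (@exprn_measurable R setT 2)).
apply/funext => x; rewrite powR_inv1 ?sqr_ge0//.
have [->|x0] := eqVneq x 0; first by rewrite mul0r invr0.
by rewrite expr2 invfM mulrA divff// mul1r.
Qed.

Lemma measurable_sqrtr : measurable_fun setT (@Num.sqrt R).
Proof.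
by apply: continuous_measurable_fun => x; exact: sqrt_continuous.
Qed.

Definition lk A x y : R := Num.max 0 (ln (A / `|x - y|)).

Definition nnm f := measurable_fun setT f /\ (forall x, 0 <= f x).

Definition pot A g x : \bar R := (\int[mu]_y (lk A x y * g y)%:E)%E.

Definition kform A f g : \bar R := (\int[mu]_x ((f x)%:E * pot A g x))%E.

Lemma lk_ge0 A x y : 0 <= lk A x y.
Proof. by rewrite /lk le_max lexx. Qed.

Lemma lk_sym A x y : lk A x y = lk A y x.
Proof. by rewrite /lk distrC. Qed.

Lemma measurable_lk A : measurable_fun setT (fun z : R * R => lk A z.1 z.2).
Proof.
apply: measurable_maxr => //.
apply: (measurableT_comp (@measurable_ln R)).
apply: measurable_funM => //.
apply: (measurableT_comp measurable_invr).
apply: (measurableT_comp (@normr_measurable R setT)).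
by apply: measurable_funB.
Qed.

Lemma measurable_lk2 A x : measurable_fun setT (lk A x).
Proof. exact: (measurable_fun_pair2 x (measurable_lk A)). Qed.

Lemma nnm0 : nnm (fun=> 0). Proof. by split. Qed.

Lemma nnmD f g : nnm f -> nnm g -> nnm (fun x => f x + g x).
Proof.
move=> [mf f0] [mg g0]; split; first exact: measurable_funD.
by move=> x; rewrite addr_ge0.
Qed.

Lemma nnmM f g : nnm f -> nnm g -> nnm (fun x => f x * g x).
Proof.
move=> [mf f0] [mg g0]; split; first exact: measurable_funM.
by move=> x; rewrite mulr_ge0.
Qed.

Lemma nnm_cst c : 0 <= c -> nnm (fun=> c).
Proof. by move=> c0; split. Qed.

Lemma nnm_indic (X : set R) : measurable X -> nnm (\1_X : R -> R).
Proof. by move=> mX; split => // x; rewrite indicE. Qed.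

Lemma nnm_lk A x : nnm (lk A x).
Proof. by split; [exact: measurable_lk2|move=> y; exact: lk_ge0]. Qed.

Lemma nnm_sum (I : Type) (s : seq I) (P : pred I) (F : I -> R -> R) :
  (forall i, nnm (F i)) -> nnm (fun x => \sum_(i <- s | P i) F i x).
Proof.
move=> F0; elim: s => [|i s [IHm IH0]].
  under eq_fun do rewrite big_nil; exact: nnm0.
under eq_fun do rewrite big_cons; case: (P i) => //.
exact: nnmD.
Qed.

Lemma pot_ge0 A g x : nnm g -> (0 <= pot A g x)%E.
Proof.
by move=> [_ g0]; apply: integral_ge0 => y _; rewrite lee_fin mulr_ge0// lk_ge0.
Qed.

Lemma measurable_pot A g : nnm g -> measurable_fun setT (pot A g).
Proof.
move=> [mg g0]; apply: (@measurable_partial_integral _ (fun x y => lk A x y * g y)).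
  by apply: measurable_funM; [exact: measurable_lk|exact: measurableT_comp].
by move=> x y; rewrite mulr_ge0// lk_ge0.
Qed.

Lemma nnm_integralE f : nnm f -> measurable_fun setT (EFin \o f) /\ forall x, (0 <= (f x)%:E)%E.
Proof. by move=> [mf f0]; split; [exact/measurable_EFinP|move=> x; rewrite lee_fin]. Qed.

Lemma ge0_integral_nnmD f g : nnm f -> nnm g ->
  (\int[mu]_x (f x + g x)%:E = \int[mu]_x (f x)%:E + \int[mu]_x (g x)%:E)%E.
Proof.
move=> /nnm_integralE[mf f0] /nnm_integralE[mg g0].
by rewrite -ge0_integralD.
Qed.

Lemma ge0_integral_nnmZ c f : 0 <= c -> nnm f ->
  (\int[mu]_x (c * f x)%:E = c%:E * \int[mu]_x (f x)%:E)%E.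
Proof. by move=> c0 /nnm_integralE[mf f0]; rewrite -ge0_integralZl_EFin. Qed.

Lemma le_integral_nnm f g : nnm f -> nnm g -> (forall x, f x <= g x) ->
  (\int[mu]_x (f x)%:E <= \int[mu]_x (g x)%:E)%E.
Proof.
move=> /nnm_integralE[mf f0] /nnm_integralE[mg g0] fg.
by apply: ge0_le_integral => // x _; rewrite lee_fin.
Qed.

Lemma potD A f g x : nnm f -> nnm g ->
  pot A (fun y => f y + g y) x = (pot A f x + pot A g x)%E.
Proof.
move=> nf ng; rewrite /pot.
under eq_integral do rewrite mulrDr.
by rewrite ge0_integral_nnmD//; apply: nnmM => //; exact: nnm_lk.
Qed.

Lemma potZ A c g x : 0 <= c -> nnm g -> pot A (fun y => c * g y) x = (c%:E * pot A g x)%E.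
Proof.
move=> c0 ng; rewrite /pot; under eq_integral do rewrite mulrCA.
by rewrite ge0_integral_nnmZ//; apply: nnmM => //; exact: nnm_lk.
Qed.

Lemma pot_le A f g x : nnm f -> nnm g -> (forall y, f y <= g y) ->
  (pot A f x <= pot A g x)%E.
Proof.
move=> nf ng fg; apply: le_integral_nnm.
- exact/nnmM/nf/nnm_lk.
- exact/nnmM/ng/nnm_lk.
- by move=> y; rewrite ler_wpM2l// lk_ge0.
Qed.

Lemma kform_ge0 A f g : nnm f -> nnm g -> (0 <= kform A f g)%E.
Proof.
move=> [mf f0] ng; apply: integral_ge0 => x _.
by rewrite mule_ge0 ?lee_fin// pot_ge0.
Qed.

Lemma measurable_kform_integrand A f g : nnm f -> nnm g ->
  measurable_fun setT (fun x => (f x)%:E * pot A g x)%E.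
Proof.
move=> [mf f0] ng; apply: emeasurable_funM; first exact/measurable_EFinP.
exact: measurable_pot.
Qed.

Lemma kform_integrand_ge0 A f g x : nnm f -> nnm g ->
  (0 <= (f x)%:E * pot A g x)%E.
Proof. by move=> [mf f0] ng; rewrite mule_ge0 ?lee_fin// pot_ge0. Qed.

Lemma kformE A f g : nnm f -> nnm g ->
  kform A f g = (\int[mu]_x \int[mu]_y (f x * (lk A x y * g y))%:E)%E.
Proof.
move=> [mf f0] ng; apply: eq_integral => x _.
by rewrite ge0_integral_nnmZ//; apply: nnmM => //; exact: nnm_lk.
Qed.

Lemma kform_sym A f g : nnm f -> nnm g -> kform A f g = kform A g f.
Proof.
move=> nf ng; rewrite !kformE// (@tonelli _ (fun x y => f x * (lk A x y * g y))).
- apply: eq_integral => y _; apply: eq_integral => x _.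
  by rewrite lk_sym; congr EFin; ring.
- case: nf ng => [mf f0] [mg g0].
  apply: measurable_funM; first exact: (measurableT_comp mf).
  by apply: measurable_funM; [exact: measurable_lk|exact: (measurableT_comp mg)].
- by case: nf ng => [mf f0] [mg g0] x y; rewrite !mulr_ge0// lk_ge0.
Qed.

Lemma kformDr A f g h : nnm f -> nnm g -> nnm h ->
  kform A f (fun y => g y + h y) = (kform A f g + kform A f h)%E.
Proof.
move=> nf ng nh; rewrite /kform -ge0_integralD//.
- apply: eq_integral => x _; rewrite potD// ge0_muleDr//; exact: pot_ge0.
- by move=> x _; exact: kform_integrand_ge0.
- exact: measurable_kform_integrand.
- by move=> x _; exact: kform_integrand_ge0.
- exact: measurable_kform_integrand.
Qed.

Lemma kformDl A f g h : nnm f -> nnm g -> nnm h ->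
  kform A (fun y => g y + h y) f = (kform A g f + kform A h f)%E.
Proof.
by move=> nf ng nh; rewrite kform_sym ?kformDr// ?(kform_sym _ nf)//; exact: nnmD.
Qed.

Lemma kformZr A c f g : 0 <= c -> nnm f -> nnm g ->
  kform A f (fun y => c * g y) = (c%:E * kform A f g)%E.
Proof.
move=> c0 nf ng; rewrite /kform -ge0_integralZl_EFin//.
- by apply: eq_integral => x _; rewrite potZ// muleCA.
- by move=> x _; exact: kform_integrand_ge0.
- exact: measurable_kform_integrand.
Qed.

Lemma kformZl A c f g : 0 <= c -> nnm f -> nnm g ->
  kform A (fun y => c * g y) f = (c%:E * kform A g f)%E.
Proof.
move=> c0 nf ng; rewrite kform_sym ?kformZr// ?(kform_sym _ nf)//.
by apply: nnmM => //; exact: nnm_cst.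
Qed.

Lemma kform_le_pot A f g c : nnm f -> nnm g -> 0 <= c ->
  (forall x, f x != 0 -> (pot A g x <= c%:E)%E) ->
  (kform A f g <= c%:E * \int[mu]_x (f x)%:E)%E.
Proof.
move=> nf ng c0 gc; have [mf f0] := nnm_integralE nf.
rewrite -ge0_integralZl_EFin//; apply: ge0_le_integral => //.
- by move=> x _; exact: kform_integrand_ge0.
- exact: measurable_kform_integrand.
- by apply: emeasurable_funM => //; exact: measurable_cst.
- move=> x _; rewrite (muleC c%:E); have [->|fx] := eqVneq (f x) 0.
    by rewrite !mul0e.
  by rewrite lee_wpmul2l// gc.
Qed.

Lemma kform_ge_pot A f g c : nnm f -> nnm g -> 0 <= c ->
  (forall x, f x != 0 -> (c%:E <= pot A g x)%E) ->
  (c%:E * \int[mu]_x (f x)%:E <= kform A f g)%E.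
Proof.
move=> nf ng c0 gc; have [mf f0] := nnm_integralE nf.
rewrite -ge0_integralZl_EFin//; apply: ge0_le_integral => //.
- by move=> x _; rewrite mule_ge0// lee_fin.
- by apply: emeasurable_funM => //; exact: measurable_cst.
- exact: measurable_kform_integrand.
- move=> x _; rewrite (muleC c%:E); have [->|fx] := eqVneq (f x) 0.
    by rewrite !mul0e.
  by rewrite lee_wpmul2l// gc.
Qed.

End log_kernel.


Section log_potentials.
Context {R : realType}.
Local Notation mu := (@lebesgue_measure R).
Implicit Types (f g h : R -> R) (a b c x y A : R).

Lemma xlnx_ge_sqrt x : 0 <= x -> - (x * ln x) <= 2 * Num.sqrt x.
Proof.
rewrite le_eqVlt => /predU1P[<-|x0]; first by rewrite mul0r oppr0 mulr_ge0.
have s0 : 0 < Num.sqrt x by rewrite sqrtr_gt0.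
rewrite -{1 2}(sqr_sqrtr (ltW x0)) lnXn// -mulrN -mulNrn -lnV ?posrE//.
have : ln (Num.sqrt x)^-1 < (Num.sqrt x)^-1 by apply: ln_sublinear; rewrite invr_gt0.
set s := Num.sqrt x in s0 *; move=> /ltW h.
have -> : 2 * s = s ^+ 2 * (s^-1 *+ 2) by rewrite mulr2n; field; lra.
by rewrite ler_wpM2l ?sqr_ge0// lerMn2r h.
Qed.

Lemma xlnx_cvg0 : x * ln x @[x --> (0:R)^'+] --> (0 : R).
Proof.
have h1 : (- (2 * Num.sqrt x)) @[x --> (0:R)^'+] --> (0 : R).
  rewrite -[X in _ --> X]oppr0; apply: cvgN.
  rewrite -[X in _ --> X](mulr0 2); apply: cvgM; first exact: cvg_cst.
  rewrite -[X in _ --> X](@sqrtr0 R).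
  by apply: cvg_at_right_filter; exact: sqrt_continuous.
apply: (squeeze_cvgr _ h1 (@cvg_cst _ _ _ _ _)).
near=> x.
have x0 : 0 < x by near: x; exact: nbhs_right_gt.
have x1 : x <= 1 by near: x; exact: nbhs_right_le.
by apply/andP; split; [rewrite lerNl xlnx_ge_sqrt ?ltW|rewrite mulr_ge0_le0 ?ln_le0 ?ltW].
Unshelve. all: by end_near. Qed.

Definition logarea A b : R := b * (ln A - ln b) + b.

Lemma integral_lk0 A b : 0 < A -> 0 <= b <= A ->
  (\int[mu]_(u in `]0%R, b[) (lk A 0 u)%:E = (logarea A b)%:E)%E.
Proof.
move=> A0 /andP[]; rewrite le_eqVlt => /predU1P[<- _|b0 bA].
  by rewrite set_itv_ge ?bnd_simp ?ltxx// integral_set0 /logarea mul0r addr0.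
transitivity (\int[mu]_(u in `]0%R, b[) (ln A - ln u)%:E)%E.
  apply: eq_integral => u; rewrite inE/= in_itv/= => /andP[u0 ub].
  rewrite /lk sub0r normrN gtr0_norm// ln_div ?posrE// max_r// subr_ge0.
  by rewrite ler_ln ?posrE//; lra.
rewrite (@integral_itv_FTC _ _ (logarea A))//.
- by rewrite {2}/logarea mul0r addr0 subr0.
- move=> u; rewrite in_itv/= => /andP[u0 ub].
  by rewrite subr_ge0 ler_ln ?posrE//; lra.
- move=> u; rewrite in_itv/= => /andP[u0 ub].
  by apply: cvgB; [exact: cvg_cst|exact: continuous_ln].
- move=> u; rewrite in_itv/= => /andP[u0 ub].
  have H := is_derive1_ln u0.
  apply: is_derive_eq.
  rewrite /GRing.scale/=; field; lra.
- apply/(continuous_within_itvP _ b0); split.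
  + move=> u; rewrite in_itv/= => /andP[u0 ub].
    apply: cvgD; last exact: cvg_id.
    apply: cvgM; first exact: cvg_id.
    by apply: cvgB; [exact: cvg_cst|exact: continuous_ln].
  + have -> : logarea A = fun u => u * ln A - u * ln u + u.
      by apply/funext => u; rewrite /logarea mulrBr.
    rewrite !mul0r subr0 addr0.
    have id0 : u @[u --> (0:R)^'+] --> (0 : R).
      by apply: cvg_at_right_filter; exact: cvg_id.
    rewrite -[X in _ --> X]addr0; apply: cvgD => //.
    rewrite -[X in _ --> X]subr0; apply: cvgB; last exact: xlnx_cvg0.
    by rewrite -[X in _ --> X](mul0r (ln A)); apply: cvgM => //; exact: cvg_cst.
  + apply: cvg_at_left_filter.
    apply: cvgD; last exact: cvg_id.
    apply: cvgM; first exact: cvg_id.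
    by apply: cvgB; [exact: cvg_cst|exact: continuous_ln].
Qed.

Lemma measurable_elk A x : measurable_fun setT (fun y : R => (lk A x y)%:E).
Proof. exact: ((measurable_EFinP _ _).2 (measurable_lk2 A x)). Qed.

Lemma integral_lk_right A x b : 0 < A -> 0 <= b <= A ->
  (\int[mu]_(y in `]x, (x + b)%R[) (lk A x y)%:E = (logarea A b)%:E)%E.
Proof.
move=> A0 bA; rewrite -integral_lk0// (@ge0_integral_shift _ _ x)//.
- have -> : [set u : R | (`]x, (x + b)%R[%classic : set R) (u + x)] = `]0, b[%classic.
    by apply/seteqP; split => u /=; rewrite !in_itv/= ?ltrDr => /andP[h1 h2];
      apply/andP; split; lra.
  by apply: eq_integral => u _; rewrite /lk opprD addrA addrAC subrr.
- exact: measurable_elk.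
- by move=> y; rewrite lee_fin lk_ge0.
Qed.

Lemma integral_lk_left A x b : 0 < A -> 0 <= b <= A ->
  (\int[mu]_(y in `](x - b)%R, x[) (lk A x y)%:E = (logarea A b)%:E)%E.
Proof.
move=> A0 bA; rewrite -(integral_lk_right (- x))//.
rewrite [RHS](@ge0_integral_opp _ (fun y => (lk A (- x) y)%:E))//.
- have -> : [set u : R | (`](- x)%R, (- x + b)%R[%classic : set R) (- u)] = `](x - b)%R, x[%classic.
    by apply/seteqP; split => u /=; rewrite !in_itv/= => /andP[h1 h2];
      apply/andP; split; lra.
  by apply: eq_integral => u _; rewrite /lk -opprD normrN.
- exact: measurable_elk.
- by move=> y; rewrite lee_fin lk_ge0.
Qed.

Lemma pot_itv A a b x : 0 < A -> a <= x <= b -> x - a <= A -> b - x <= A ->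
  pot A (\1_(`[a, b])) x = (logarea A (x - a) + logarea A (b - x))%:E.
Proof.
move=> A0 /andP[ax xb] xaA bxA.
have mlk := measurable_lk2 A x.
transitivity (\int[mu]_(y in `[a, b]) (lk A x y)%:E)%E.
  rewrite [RHS]integral_mkcond; apply: eq_integral => y _.
  by rewrite patchE indicE; case: ifP => _; rewrite ?mulr1 ?mulr0.
have -> : `[a, b]%classic = `[a, x]%classic `|` `]x, b]%classic :> set R.
  by rewrite -itv_bndbnd_setU// bnd_simp.
rewrite ge0_integral_setU//=; first last.
- by apply/disj_setPS => y; rewrite /= !in_itv/= => -[/andP[_ h] /andP[]]; lra.
- by move=> y _; rewrite lee_fin lk_ge0.
- (apply: measurable_funTS; exact: measurable_elk).
have mlkE (D : set R) : measurable_fun D (fun y : R => (lk A x y)%:E).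
  by apply: measurable_funTS; exact: measurable_elk.
rewrite (@integral_itv_bndoo _ a x _ true false) ?mlkE//.
rewrite (@integral_itv_bndoo _ x b _ false false) ?mlkE//.
rewrite EFinD; congr (_ + _)%E.
  have -> : a = x - (x - a) by lra.
  by rewrite integral_lk_left; [congr (logarea _ _)%:E; lra|by []|lra].
have {1}-> : b = x + (b - x) by lra.
by rewrite integral_lk_right//; lra.
Qed.

Lemma lk_eq0 A x y : A <= `|x - y| -> lk A x y = 0.
Proof.
move=> h; apply/max_idPl; have [->|d0] := eqVneq `|x - y| 0.
  by rewrite invr0 mulr0 ln0.
have {}d0 : 0 < `|x - y| by rewrite lt_def d0 /=.
by rewrite ln_le0// ler_pdivrMr// mul1r.
Qed.

Lemma pot1 A x : 0 < A -> pot A (fun=> 1) x = (2 * A)%:E.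
Proof.
move=> A0; transitivity (pot A (\1_(`[(x - A), (x + A)])) x).
  apply: eq_integral => y _; congr EFin.
  rewrite indicE; case: (boolP (y \in _)) => [//|yn]; rewrite mulr0 mulr1 lk_eq0//.
  apply: contraNle yn => h; rewrite inE/= in_itv/=.
  by move: h; rewrite ltr_distl => /andP[h1 h2]; apply/andP; split; lra.
rewrite pot_itv; [|lra|apply/andP; split; lra|lra|lra].
congr EFin; rewrite /logarea.
have -> : x - (x - A) = A by lra.
have -> : x + A - x = A by lra.
by rewrite subrr mulr0 add0r; lra.
Qed.

Lemma pot_bounded A g b x : 0 < A -> nnm g -> (forall y, g y <= b) ->
  (pot A g x <= (2 * A * b)%:E)%E.
Proof.
move=> A0 ng gb.
have b0 : 0 <= b by apply: le_trans (gb 0); case: ng.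
apply: (@le_trans _ _ (pot A (fun=> b * 1) x)).
  by apply: pot_le => //; [by under eq_fun do rewrite mulr1; apply: (@nnm_cst R b)|move=> y; rewrite mulr1].
rewrite (@potZ _ _ b (fun=> 1))//.
by rewrite pot1// -EFinM mulrC.
Qed.

Lemma pot_bounded_mass A g b T x : 0 < A -> 0 <= T -> nnm g -> (forall y, g y <= b) ->
  (pot A g x <= T%:E * \int[mu]_y (g y)%:E + (2 * A * expR (- T) * b)%:E)%E.
Proof.
move=> A0 T0 ng gb.
have B0 : 0 < A * expR (- T) by rewrite mulr_gt0// expR_gt0.
apply: (@le_trans _ _ (T%:E * \int[mu]_y (g y)%:E + pot (A * expR (- T)) g x)%E); last first.
  by rewrite leeD2l//; have := pot_bounded x B0 ng gb; rewrite mulrA.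
rewrite -ge0_integral_nnmZ// -ge0_integral_nnmD; first last.
- exact/nnmM/ng/nnm_lk.
- exact/nnmM/ng/nnm_cst.
apply: le_integral_nnm.
- exact/nnmM/ng/nnm_lk.
- apply: nnmD; first exact/nnmM/ng/nnm_cst.
  exact/nnmM/ng/nnm_lk.
move=> y; rewrite -mulrDl ler_wpM2r//; first by case: ng.
rewrite /lk; have [->|d0] := eqVneq `|x - y| 0.
  by rewrite invr0 !mulr0 ln0// maxxx addr0.
have {}d0 : 0 < `|x - y| by rewrite lt_def d0 /=.
rewrite mulrAC (lnM (x := A / `|x - y|)) ?posrE ?divr_gt0 ?expR_gt0// expRK.
by rewrite ge_max addr_ge0 ?le_max ?lexx//= -lerBlDl le_max lexx orbT.
Qed.

End log_potentials.


Section positive_definiteness.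
Context {R : realType}.
Local Notation mu := (@lebesgue_measure R).
Implicit Types (f g h : R -> R) (a b c r x y A : R).

Lemma ereal_AMGM (a b : \bar R) : (0 <= a -> 0 <= b -> a * b + a * b <= a * a + b * b)%E.
Proof.
move: a b => [a| |] [b| |]// a0 b0; rewrite ?leey//.
by rewrite -!EFinM -!EFinD lee_fin; have := sqr_ge0 (a - b); nra.
Qed.

Section feature.
Context d (P : measurableType d) (nu : {sigma_finite_measure set P -> \bar R}).
Variable e : R -> P -> R.
Hypothesis me : measurable_fun setT (fun z : R * P => e z.1 z.2).
Hypothesis e0 : forall x p, 0 <= e x p.

Let me1 x : measurable_fun setT (e x).
Proof. exact: (measurable_fun_pair2 x me). Qed.

Definition feat f p : \bar R := (\int[mu]_x (f x * e x p)%:E)%E.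

Let mfe f : nnm f -> measurable_fun setT (fun z : R * P => (f z.1 * e z.1 z.2)%:E).
Proof.
move=> [mf _]; apply: ((measurable_EFinP _ _).2 _).
by apply: measurable_funM => //; exact: (measurableT_comp mf).
Qed.

Let feat_ge0 f p : nnm f -> (0 <= feat f p)%E.
Proof. by move=> [_ f0]; apply: integral_ge0 => x _; rewrite lee_fin mulr_ge0. Qed.

Let mfeat f : nnm f -> measurable_fun setT (feat f).
Proof.
move=> nf.
apply: (@measurable_fun_fubini_tonelli_G _ _ _ _ _ mu (fun z => (f z.1 * e z.1 z.2)%:E)).
  exact: mfe.
by move=> z; rewrite lee_fin mulr_ge0//; case: nf.
Qed.

Definition feature_form f g :=
  (\int[mu]_x \int[mu]_y ((f x * g y)%:E * \int[nu]_p (e x p * e y p)%:E))%E.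

Let feature_formE f g : nnm f -> nnm g ->
  feature_form f g = (\int[nu]_p (feat f p * feat g p))%E.
Proof.
move=> nf ng; have [mf f0] := nf; have [mg g0] := ng.
transitivity (\int[mu]_x \int[nu]_p ((f x * e x p)%:E * feat g p))%E.
  apply: eq_integral => x _.
  transitivity (\int[mu]_y \int[nu]_p ((f x * e x p) * (g y * e y p))%:E)%E.
    apply: eq_integral => y _; rewrite -ge0_integralZl_EFin ?mulr_ge0//.
    - by apply: eq_integral => p _; rewrite -EFinM; congr EFin; ring.
    - by move=> p _; rewrite lee_fin mulr_ge0.
    - by apply: ((measurable_EFinP _ _).2 _); exact: measurable_funM.
  rewrite (@fubini_tonelli _ _ _ _ _ mu nu (fun z => ((f x * e x z.2) * (g z.1 * e z.1 z.2))%:E)); first last.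
  - by move=> z; rewrite lee_fin !mulr_ge0.
  - apply: ((measurable_EFinP _ _).2 _).
    apply: measurable_funM; last exact: ((measurable_EFinP _ _).1 (mfe ng)).
    apply: measurable_funM => //; exact: (measurableT_comp (me1 x)).
  apply: eq_integral => p _.
  rewrite /feat -ge0_integralZl_EFin ?mulr_ge0//.
  - by move=> y _; rewrite lee_fin mulr_ge0.
  - exact: (measurable_fun_pair1 p (mfe ng)).
rewrite (@fubini_tonelli _ _ _ _ _ mu nu (fun z => (f z.1 * e z.1 z.2)%:E * feat g z.2)%E); first last.
- by move=> z; rewrite mule_ge0 ?feat_ge0// lee_fin mulr_ge0.
- apply: emeasurable_funM; first exact: mfe.
  exact: (measurableT_comp (mfeat ng)).
apply: eq_integral => p _; rewrite /= ge0_integralZr//.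
- exact: (measurable_fun_pair1 p (mfe nf)).
- by move=> y _; rewrite lee_fin mulr_ge0.
- exact: feat_ge0.
Qed.

Lemma feature_form_posdef f g : nnm f -> nnm g ->
  (feature_form f g + feature_form f g <= feature_form f f + feature_form g g)%E.
Proof.
move=> nf ng.
rewrite (feature_formE nf ng) (feature_formE nf nf) (feature_formE ng ng).
have mm u v : nnm u -> nnm v -> measurable_fun setT (fun p => feat u p * feat v p)%E.
  by move=> na nb; apply: emeasurable_funM; exact: mfeat.
have ge u v p : nnm u -> nnm v -> (0 <= feat u p * feat v p)%E.
  by move=> na nb; rewrite mule_ge0// feat_ge0.
have add u v w z : nnm u -> nnm v -> nnm w -> nnm z ->
    (\int[nu]_p (feat u p * feat v p) + \int[nu]_p (feat w p * feat z p) =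
     \int[nu]_p (feat u p * feat v p + feat w p * feat z p))%E.
  move=> nu_ nv nw nz; apply/esym/ge0_integralD => //.
  - by move=> p _; exact: ge.
  - exact: mm.
  - by move=> p _; exact: ge.
  - exact: mm.
rewrite [leLHS](add f g f g nf ng nf ng) [leRHS](add f f g g nf nf ng ng).
apply: ge0_le_integral => //.
- by move=> p _; rewrite adde_ge0// ge.
- by apply: emeasurable_funD; exact: mm.
- by apply: emeasurable_funD; exact: mm.
- by move=> p _; apply: ereal_AMGM; exact: feat_ge0.
Qed.

End feature.


Lemma integral_tent c r x y : 0 <= c -> 0 <= r ->
  (\int[mu]_z (if [&& z <= x, z <= y, x <= z + r & y <= z + r] then c else 0)%:E
   = (c * Num.max 0 (r - `|x - y|))%:E)%E.
Proof.
move=> c0 r0; wlog xy : x y / x <= y.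
  move=> H; have [/H//|/ltW/H h] := leP x y.
  rewrite distrC -h; apply: eq_integral => z _.
  by do !case: (_ <= _).
transitivity (\int[mu]_(z in `[(y - r)%R, x]) (cst c%:E z))%E.
  rewrite [RHS]integral_mkcond; apply: eq_integral => z _.
  rewrite patchE; congr (if _ then _ else _)%:E || idtac.
  have -> : (z \in `[(y - r), x]%classic) = [&& z <= x, z <= y, x <= z + r & y <= z + r].
    apply/idP/idP; rewrite inE/= in_itv/=.
      by move=> /andP[h1 h2]; apply/and4P; split; lra.
    by move=> /and4P[h1 h2 h3 h4]; apply/andP; split; lra.
  by case: ifP.
rewrite integral_cst//=.
rewrite lebesgue_measure_itv/= lte_fin distrC ger0_norm ?subr_ge0//.
case: ifPn => h.
  by rewrite -EFinD -EFinM max_r; [congr (_ * _)%:E; lra|lra].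
by rewrite max_l; [rewrite mule0 mulr0|move: h; rewrite -leNgt; lra].
Qed.

Definition scale_feature A x (p : R * R) : R :=
  if [&& 0 < p.1, p.1 < A, p.2 <= x & x <= p.2 + p.1] then p.1^-1 else 0.

Definition window_feature A x z : R :=
  if (z <= x) && (x <= z + A) then (Num.sqrt A)^-1 else 0.

Lemma measurable_scale_feature A :
  measurable_fun setT (fun z : R * (R * R) => scale_feature A z.1 z.2).
Proof.
apply: measurable_fun_ifT => //.
  apply: measurable_and; first by apply: measurable_fun_ltr => //; exact: measurableT_comp.
  apply: measurable_and; first by apply: measurable_fun_ltr => //; exact: measurableT_comp.
  apply: measurable_and; first by apply: measurable_fun_ler => //; exact: measurableT_comp.
  apply: measurable_fun_ler => //; apply: measurable_funD; exact: measurableT_comp.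
by apply: (measurableT_comp measurable_invr); exact: measurableT_comp.
Qed.

Lemma measurable_window_feature A :
  measurable_fun setT (fun z : R * R => window_feature A z.1 z.2).
Proof.
apply: measurable_fun_ifT => //.
apply: measurable_and; first exact: measurable_fun_ler.
by apply: measurable_fun_ler => //; exact: measurable_funD.
Qed.

Lemma window_feature_integral A x y : 0 < A ->
  (\int[mu]_z (window_feature A x z * window_feature A y z)%:E =
   (A^-1 * Num.max 0 (A - `|x - y|))%:E)%E.
Proof.
move=> A0; rewrite -integral_tent ?invr_ge0 ?(ltW A0)//.
apply: eq_integral => z _; congr EFin; rewrite /window_feature.
have -> : A^-1 = (Num.sqrt A)^-1 * (Num.sqrt A)^-1.
  by rewrite -invfM -expr2 sqr_sqrtr// ltW.
by do !case: (_ <= _); rewrite /= ?mulr0 ?mul0r.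
Qed.

Lemma scale_feature_integral A x y : 0 < A -> x != y ->
  (\int[(mu \x mu)%E]_p (scale_feature A x p * scale_feature A y p)%:E =
   (if `|x - y| < A then ln (A / `|x - y|) - 1 + `|x - y| / A else 0)%:E)%E.
Proof.
move=> A0 xy; set d := `|x - y|.
have d0 : 0 < d by rewrite normr_gt0 subr_eq0.
have m1 u : measurable_fun setT (scale_feature A u).
  exact: (measurable_fun_pair2 u (measurable_scale_feature A)).
have s0 u p : 0 <= scale_feature A u p.
  by rewrite /scale_feature; case: ifP => // /and4P[h _ _ _]; rewrite invr_ge0 ltW.
rewrite fubini_tonelli1; first last.
- by move=> p; rewrite lee_fin mulr_ge0.
- exact: ((measurable_EFinP _ _).2 (measurable_funM (m1 x) (m1 y))).
have [dA|dA] := ltP d A; last first.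
  rewrite integral0_eq// => r _; rewrite /fubini_F integral0_eq// => z _ /=.
  congr EFin; rewrite /scale_feature/=; case: ifP; last by rewrite mul0r.
  case: ifP; last by rewrite mulr0.
  move=> /and4P[h1 h2 h3 h4] /and4P[_ _ h5 h6].
  suff : d < A by lra.
  apply: le_lt_trans h2; rewrite /d ler_norml; apply/andP; split; lra.
transitivity (\int[mu]_(r in `]d, A[) (r^-1 - d * r^-2)%:E)%E.
  rewrite [RHS]integral_mkcond; apply: eq_integral => r _.
  rewrite patchE /fubini_F.
  have [/andP[r0 rA]|nr] := boolP ((0 < r) && (r < A)).
    transitivity ((r^-2 * Num.max 0 (r - d))%:E : \bar R).
      rewrite -integral_tent ?(ltW r0) ?invr_ge0 ?exprn_ge0 ?(ltW r0)//.
      apply: eq_integral => z _; congr EFin; rewrite /scale_feature/= r0 rA/=.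
      by do !case: (_ <= _); rewrite /= ?mulr0 ?mul0r// -invfM expr2.
    have [dr|dr] := ltP d r.
      rewrite mem_set/= ?in_itv/= ?dr ?rA// max_r; last lra.
      by congr EFin; field; lra.
    rewrite memNset/= ?in_itv/= ?ltNge ?dr// max_l; last lra.
    by rewrite mulr0.
  rewrite memNset/=; last first.
    apply: contraNnot nr; rewrite in_itv/= => /andP[h1 h2].
    by apply/andP; split; lra.
  rewrite integral0_eq// => z _; congr EFin; rewrite /scale_feature/=.
  case: ifP; last by rewrite mul0r.
  by move=> /and4P[h1 h2 _ _]; move: nr; rewrite h1 h2.
rewrite (@integral_itv_FTC _ _ (fun r => ln r + d * r^-1))//.
- congr EFin; rewrite divff ?gt_eqF// ln_div ?posrE//; ring.
- move=> r; rewrite in_itv/= => /andP[dr rA]; have r0 : 0 < r by lra.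
  have -> : r^-1 - d * r^-2 = r^-2 * (r - d) by field; lra.
  by rewrite mulr_ge0 ?invr_ge0 ?exprn_ge0//; lra.
- move=> r; rewrite in_itv/= => /andP[dr rA]; have r0 : 0 < r by lra.
  apply: cvgB; first by apply: cvgV; [rewrite gt_eqF|exact: cvg_id].
  apply: cvgM; first exact: cvg_cst.
  apply: cvgV; first by rewrite gt_eqF// exprn_gt0.
  exact: exprn_continuous.
- move=> r; rewrite in_itv/= => /andP[dr rA]; have r0 : 0 < r by lra.
  have H := is_derive1_ln r0.
  have H2 : is_derive r (1:R) (fun r : R => r^-1) (- r ^- 2).
    by apply: is_derive_eq; [apply: is_deriveV; rewrite gt_eqF|rewrite /GRing.scale/= mulr1].
  apply: is_derive_eq.
  by rewrite /GRing.scale/= mulrN.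
- apply: continuous_in_subspaceT => r; rewrite inE/= in_itv/= => /andP[dr rA].
  have r0 : 0 < r by lra.
  apply: cvgD; first exact: continuous_ln.
  apply: cvgM; first exact: cvg_cst.
  by apply: cvgV; [rewrite gt_eqF|exact: cvg_id].
Qed.

Lemma leeD_split (a b c p q p' q' p'' q'' : \bar R) : (
  a = p + q -> b = p' + q' -> c = p'' + q'' ->
  p + p <= p' + p'' -> q + q <= q' + q'' -> a + a <= b + c)%E.
Proof.
move=> -> -> -> h1 h2; rewrite (addeACA p) (addeACA p'); exact: leeD.
Qed.

Lemma sigma_finite_plane : sigma_finite setT (mu \x mu)%E.
Proof.
have /sigma_finiteP[F [TF ndF Foo]] := sigma_finiteT mu.
exists (fun n => F n `*` F n).
  apply/seteqP; split => // -[x y] _.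
  have [[n _ Fnx] [k _ Fky]] : (\bigcup_i F i) x /\ (\bigcup_i F i) y by rewrite -TF.
  exists (maxn n k) => //; split => /=.
    by move: x Fnx; exact/subsetPset/ndF/leq_maxl.
  by move: y Fky; exact/subsetPset/ndF/leq_maxr.
move=> k; have [mF Fk] := Foo k; split; first exact: measurableX.
by rewrite product_measure1E// lte_mul_pinfty// ge0_fin_numE.
Qed.

Lemma kform_posdef A f g : 0 < A -> nnm f -> nnm g ->
  (kform A f g + kform A f g <= kform A f f + kform A g g)%E.
Proof.
move=> A0 nf ng.
have me1 := measurable_scale_feature A.
have e10 x p : 0 <= scale_feature A x p.
  by rewrite /scale_feature; case: ifP => // /and4P[h _ _ _]; rewrite invr_ge0 ltW.
have me2 := measurable_window_feature A.
have e20 x p : 0 <= window_feature A x p.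
  by rewrite /window_feature; case: ifP => // _; rewrite invr_ge0 sqrtr_ge0.
pose nu_ : measure (measurableTypeR R * measurableTypeR R)%type R := (mu \x mu)%E.
pose nu : {sigma_finite_measure set (measurableTypeR R * measurableTypeR R)%type -> \bar R} :=
  HB.pack (Measure.sort nu_) (Measure_isSigmaFinite.Build _ _ _ nu_ sigma_finite_plane).
pose Q1 := feature_form nu (scale_feature A).
pose Q2 := feature_form mu (window_feature A).
suff H u v : nnm u -> nnm v -> kform A u v = (Q1 u v + Q2 u v)%E.
  have h1 := feature_form_posdef nu me1 e10 nf ng.
  have h2 := feature_form_posdef mu me2 e20 nf ng.
  exact: (leeD_split (H f g nf ng) (H f f nf nf) (H g g ng ng) h1 h2).
move=> {nf ng} nu_u nv; have [mu_ u0] := nu_u; have [mv_ v0] := nv.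
pose k2 x y := A^-1 * Num.max 0 (A - `|x - y|).
pose k1 x y := if x == y then 0 else lk A x y - k2 x y.
have pt x y : x != y -> lk A x y - k2 x y =
    if `|x - y| < A then ln (A / `|x - y|) - 1 + `|x - y| / A else 0.
  move=> xy; have d0 : 0 < `|x - y| by rewrite normr_gt0 subr_eq0.
  rewrite /k2; have [dA|dA] := ltP `|x - y| A; last first.
    by rewrite lk_eq0// max_l; [rewrite mulr0 subr0|lra].
  rewrite /lk !max_r ?subr_ge0 ?(ltW dA)//; first by field; lra.
  by apply: ln_ge0; rewrite ler_pdivlMr// mul1r ltW.
have k2E x y : (\int[mu]_p (window_feature A x p * window_feature A y p)%:E)%E = (k2 x y)%:E.
  exact: window_feature_integral.
have k1E x y : x != y ->
    (\int[nu]_p (scale_feature A x p * scale_feature A y p)%:E)%E = (k1 x y)%:E.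
  by move=> xy; rewrite [LHS]scale_feature_integral// /k1 (negbTE xy) pt.
have k20 x y : 0 <= k2 x y by rewrite mulr_ge0 ?invr_ge0 ?(ltW A0)// le_max lexx.
have k10 x y : 0 <= k1 x y.
  have [<-|xy] := eqVneq x y; first by rewrite /k1 eqxx.
  rewrite -lee_fin -k1E//; apply: integral_ge0 => p _.
  by rewrite lee_fin mulr_ge0.
have mk2 : measurable_fun setT (fun z : R * R => k2 z.1 z.2).
  apply: measurable_funM => //; apply: measurable_maxr => //.
  apply: measurable_funB => //.
  apply: (measurableT_comp (@normr_measurable R setT)).
  by apply: measurable_funB.
have mk1 : measurable_fun setT (fun z : R * R => k1 z.1 z.2).
  apply: measurable_fun_ifT => //; first by apply: measurable_fun_eqr.
  by apply: measurable_funB => //; exact: measurable_lk.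
have muv (k : R -> R -> R) : measurable_fun setT (fun z : R * R => k z.1 z.2) ->
    measurable_fun setT (fun z : R * R => (u z.1 * (k z.1 z.2 * v z.2))).
  move=> mk; apply: measurable_funM; first exact: (measurableT_comp mu_).
  by apply: measurable_funM => //; exact: (measurableT_comp mv_).
have uv0 (k : R -> R -> R) : (forall x y, 0 <= k x y) ->
    forall x y, 0 <= u x * (k x y * v y) by move=> k0 x y; rewrite !mulr_ge0.
have muv2 (k : R -> R -> R) x : measurable_fun setT (fun z : R * R => k z.1 z.2) ->
    measurable_fun setT (fun y => (u x * (k x y * v y))%:E).
  by move=> /muv mk; apply: ((measurable_EFinP _ _).2 (measurable_fun_pair2 x mk)).
have off (k : R -> R -> R) x (I : R -> \bar R) :
    measurable_fun setT (fun z : R * R => k z.1 z.2) ->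
    (forall y, x != y -> I y = (k x y)%:E) ->
    (\int[mu]_y ((u x * v y)%:E * I y) = \int[mu]_y (u x * (k x y * v y))%:E)%E.
  move=> mk kI; apply/esym/(@integral_off_point _ setT x) => //; first exact: muv2.
  by move=> y _ xy; rewrite kI 1?eq_sym// -EFinM; congr EFin; ring.
have Q1E : Q1 u v = (\int[mu]_x \int[mu]_y (u x * (k1 x y * v y))%:E)%E.
  by apply: eq_integral => x _; apply: off => // y xy; exact: k1E.
have Q2E : Q2 u v = (\int[mu]_x \int[mu]_y (u x * (k2 x y * v y))%:E)%E.
  by apply: eq_integral => x _; apply: off => // y xy; exact: k2E.
rewrite kformE// Q1E Q2E -ge0_integralD//; first last.
- exact: (measurable_partial_integral (muv _ mk2) (uv0 _ k20)).
- by move=> x _; apply: integral_ge0 => y _; rewrite lee_fin uv0.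
- exact: (measurable_partial_integral (muv _ mk1) (uv0 _ k10)).
- by move=> x _; apply: integral_ge0 => y _; rewrite lee_fin uv0.
apply: eq_integral => x _; rewrite -ge0_integralD//; first last.
- exact: muv2.
- by move=> y _; rewrite lee_fin uv0.
- exact: muv2.
- by move=> y _; rewrite lee_fin uv0.
apply: (@integral_off_point _ setT x) => //; first exact: muv2 (measurable_lk A).
move=> y _ xy; rewrite -EFinD; congr EFin; rewrite /k1 eq_sym (negbTE xy); ring.
Qed.

End positive_definiteness.


Section arcsine_law.
Context {R : realType}.
Local Notation mu := (@lebesgue_measure R).
Implicit Types (f g h : R -> R) (a b c r x y A rho q : R).

Lemma cos_lt a b : 0 <= a -> a < b -> b <= pi -> cos b < cos a.
Proof. by move=> a0 ab bpi; rewrite ltr_cos// in_itv/=; apply/andP; split; lra. Qed.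

Lemma cos_le a b : 0 <= a -> a <= b -> b <= pi -> cos b <= cos a.
Proof.
by move=> a0; rewrite le_eqVlt => /predU1P[-> //|ab bpi]; rewrite ltW// cos_lt.
Qed.

Definition arcsine q y : R := (pi * Num.sqrt (q - y ^+ 2))^-1.

Lemma arcsine_ge0 q y : 0 <= arcsine q y.
Proof. by rewrite invr_ge0 mulr_ge0 ?pi_ge0 ?sqrtr_ge0. Qed.

Lemma measurable_arcsine2 : measurable_fun setT (fun z : R * R => arcsine z.1 z.2).
Proof.
apply: (measurableT_comp measurable_invr); apply: measurable_funM => //.
apply: (measurableT_comp measurable_sqrtr); apply: measurable_funB => //.
exact: (measurableT_comp (@exprn_measurable R setT 2)).
Qed.

Lemma nnm_arcsine q : nnm (arcsine q).
Proof.
split; last exact: arcsine_ge0.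
exact: (measurable_fun_pair2 q measurable_arcsine2).
Qed.

Lemma arcsine_eq0 q y : q <= y ^+ 2 -> arcsine q y = 0.
Proof. by move=> h; rewrite /arcsine ler0_sqrtr ?mulr0 ?invr0//; lra. Qed.

Lemma arcsine_out rho y : rho <= `|y| -> 0 <= rho -> arcsine (rho ^+ 2) y = 0.
Proof. by move=> h r0; rewrite arcsine_eq0// -(real_normK (num_real y)) lerXn2r ?nnegrE. Qed.

Lemma arcsine_cos rho t : 0 < rho -> 0 < t < pi ->
  arcsine (rho ^+ 2) (rho * cos t) = (pi * (rho * sin t))^-1.
Proof.
move=> r0 tpi; rewrite /arcsine exprMn -{1}(mulr1 (rho ^+ 2)) -mulrBr -sin2cos2.
by rewrite -exprMn sqrtr_sqr ger0_norm// mulr_ge0 ?(ltW r0)// ltW// sin_gt0_pi.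
Qed.

Lemma arcsine_subst_segment f rho a b : 0 < rho -> 0 < a -> a < b -> b < pi ->
  continuous f ->
  (\int[mu]_(y in `[(rho * cos b)%R, (rho * cos a)%R]) (f y * arcsine (rho ^+ 2) y)%:E =
   \int[mu]_(t in `[a, b]) (f (rho * cos t) / pi)%:E)%E.
Proof.
move=> r0 a0 ab bpi cf.
have d1 (t : R) : is_derive t (1:R) (fun t => rho * cos t) (- (rho * sin t)).
  by apply: is_derive_eq; rewrite /GRing.scale/= mulrN.
have dE : derive1 (fun t : R => rho * cos t) = (fun t => - (rho * sin t)).
  by apply/funext => t; rewrite derive1E derive_val.
have cd (t : R) : {for t, continuous (fun t : R => - (rho * sin t))}.
  by apply: cvgN; apply: cvgM; [exact: cvg_cst|exact: continuous_sin].
have cF (t : R) : {for t, continuous (fun t => rho * cos t)}.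
  by apply: cvgM; [exact: cvg_cst|exact: continuous_cos].
rewrite (@integration_by_substitution_decreasing _ (fun t => rho * cos t)
  (fun y => f y * arcsine (rho ^+ 2) y) a b (ltW ab)).
- apply: eq_integral => t; rewrite inE/= in_itv/= => /andP[h1 h2].
  congr EFin; rewrite dE /= !fctE arcsine_cos//; last by apply/andP; split; lra.
  have s0 : 0 < sin t by apply: sin_gt0_pi; apply/andP; split; lra.
  have p0 : 0 < pi :> R by exact: pi_gt0.
  field; lra.
- move=> x y; rewrite !in_itv/= => /andP[x1 x2] /andP[y1 y2] xy.
  by rewrite ltr_pM2l//; apply: cos_lt; lra.
- by move=> t _; rewrite dE; exact: cd.
- by rewrite dE; apply/cvg_ex; eexists; apply: cvg_at_right_filter; exact: cd.
- by rewrite dE; apply/cvg_ex; eexists; apply: cvg_at_left_filter; exact: cd.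
- split; first by move=> x _; case: (d1 x).
  + by apply: cvg_at_right_filter; exact: cF.
  + by apply: cvg_at_left_filter; exact: cF.
- apply: continuous_in_subspaceT => y; rewrite inE/= in_itv/= => /andP[y1 y2].
  apply: cvgM; first exact: cf.
  have y2r : y ^+ 2 < rho ^+ 2.
    rewrite -(real_normK (num_real y)) ltrXn2r// ltr_norml.
    have : cos a < 1 by rewrite -[X in _ < X]cos0; apply: cos_lt; lra.
    have : -1 < cos b by rewrite -cospi; apply: cos_lt; lra.
    by move=> h1 h2; apply/andP; split; nra.
  apply: cvgV.
    by rewrite mulf_neq0 ?gt_eqF ?pi_gt0// sqrtr_gt0 subr_gt0.
  apply: cvgM; first exact: cvg_cst.
  apply: (@continuous_comp _ _ _ (fun y => rho ^+ 2 - y ^+ 2) Num.sqrt).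
    by apply: cvgB; [exact: cvg_cst|exact: exprn_continuous].
  exact: sqrt_continuous.
Qed.

Lemma arcsine_subst_cont f rho : 0 < rho -> continuous f -> (forall y, 0 <= f y) ->
  (\int[mu]_y (f y * arcsine (rho ^+ 2) y)%:E =
   \int[mu]_(t in `]0%R, pi[) (f (rho * cos t) / pi)%:E)%E.
Proof.
move=> r0 cf f0.
have [q [q0 qab qd qc bigD]] := @itv_exhaustion R 0 pi (pi_gt0 R).
have mf : measurable_fun setT f by exact: continuous_measurable_fun.
have [mas as0] := nnm_arcsine (rho ^+ 2).
have mfa : measurable_fun setT (fun y : R => (f y * arcsine (rho ^+ 2) y)%:E).
  by apply: ((measurable_EFinP _ _).2 _); exact: measurable_funM.
have mfc : measurable_fun setT (fun t : R => (f (rho * cos t) / pi)%:E).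
  apply: ((measurable_EFinP _ _).2 _); apply: measurable_funM => //.
  apply: (measurableT_comp mf); apply: measurable_funM => //.
  by apply: continuous_measurable_fun; exact: continuous_cos.
pose E n : set R := [set` `[rho * cos (pi - q n), rho * cos (0 + q n)]].
have bigE : \bigcup_n E n = `]- rho, rho[%classic.
  apply/seteqP; split => [y [n _]|y]; rewrite /E /= !in_itv/=.
    have : cos (0 + q n) < 1.
      by rewrite -[X in _ < X]cos0; have := q0 n; have := qab n => h1 h2; apply: cos_lt; lra.
    have : -1 < cos (pi - q n).
      by rewrite -cospi; have := q0 n; have := qab n => h1 h2; apply: cos_lt; lra.
    by move=> h1 h2 /andP[h3 h4]; apply/andP; split; nra.
  move=> /andP[y1 y2].
  have y12 : -1 < y / rho < 1 by rewrite ltr_pdivlMr// ltr_pdivrMr// mulN1r mul1r y1.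
  have [y11 y22] := andP y12.
  have aI : acos (y / rho) \in `]0, pi[.
    by rewrite in_itv/= acos_gt0 ?acos_ltpi ?y22 ?y11 ?ltW.
  have : (`]0, pi[%classic : set R) (acos (y / rho)) by [].
  rewrite -bigD => -[n _]; rewrite /= in_itv/= => /andP[h1 h2]; exists n => //.
  have yE : y = rho * cos (acos (y / rho)).
    by rewrite acosK ?in_itv/= ?ltW//; field; lra.
  rewrite /E/= in_itv/= {1 2}yE !ler_pM2l//.
  have := q0 n => h3.
  by apply/andP; split; apply: cos_le; lra.
have c1 : (\int[mu]_(y in E n) (f y * arcsine (rho ^+ 2) y)%:E)%E @[n --> \oo] -->
    (\int[mu]_y (f y * arcsine (rho ^+ 2) y)%:E)%E.
  have -> : (\int[mu]_y (f y * arcsine (rho ^+ 2) y)%:E = \int[mu]_(y in \bigcup_n E n) (f y * arcsine (rho ^+ 2) y)%:E)%E.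
    rewrite [RHS]integral_mkcond; apply: eq_integral => y _; rewrite patchE.
    case: ifPn => //; rewrite bigE notin_setE/= in_itv/= => /negP h.
    rewrite arcsine_out ?mulr0 ?(ltW r0)//.
    by rewrite leNgt ltr_norml.
  apply: ge0_nondecreasing_set_cvg_integral.
  - move=> m n mn; apply/subsetPset => y; rewrite /E/= !in_itv/= => /andP[h1 h2].
    have q1 := q0 m; have q2 := q0 n; have q3 := qab m; have q4 := qab n; have q5 := qd _ _ mn.
    apply/andP; split.
    + by apply: le_trans h1; rewrite ler_pM2l//; apply: cos_le; lra.
    + by apply: (le_trans h2); rewrite ler_pM2l//; apply: cos_le; lra.
  - by move=> i; exact: measurable_itv.
  - by move=> i; exact: measurable_funTS.
  - by move=> i y _; rewrite lee_fin mulr_ge0.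
have c2 := @exhaustion_cvg_integral R 0 pi q _ qd bigD (measurable_funTS mfc).
apply: (cvg_unique _ c1) => //.
have -> : (fun n => \int[mu]_(y in E n) (f y * arcsine (rho ^+ 2) y)%:E)%E =
   (fun n => \int[mu]_(t in `[(0 + q n)%R, (pi - q n)%R]) (f (rho * cos t) / pi)%:E)%E.
  apply/funext => n; have := q0 n; have := qab n => h1 h2.
  apply: arcsine_subst_segment => //; lra.
by apply: c2 => t _; rewrite lee_fin divr_ge0 ?pi_ge0.
Qed.

Lemma arcsine_mass rho : 0 < rho -> (\int[mu]_y (arcsine (rho ^+ 2) y)%:E = 1)%E.
Proof.
move=> r0; transitivity (\int[mu]_y (1 * arcsine (rho ^+ 2) y)%:E)%E.
  by under [RHS]eq_integral do rewrite mul1r.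
rewrite (@arcsine_subst_cont (fun=> 1))//; last by move=> x; exact: cvg_cst.
rewrite (@integral_cst _ _ _ mu `]0%R, pi[%classic (measurable_itv _) (1 / pi)%:E)/=.
rewrite lebesgue_measure_itv/= lte_fin pi_gt0 -EFinD -EFinM subr0 mul1r mulVf//.
by rewrite gt_eqF// pi_gt0.
Qed.

End arcsine_law.


Section arcsine_potential.
Context {R : realType}.
Local Notation mu := (@lebesgue_measure R).
Implicit Types (f g h : R -> R) (a b c r x y A rho q : R).

(* approximation of lk A x from below by continuous functions *)
Let lkn A x (n : nat) y : R :=
  Num.min 1 (n%:R * `|x - y|) *
  Num.max 0 (ln (A / Num.max `|x - y| (A / n.+1%:R))).

Let lkn_ge0 A x n y : 0 <= lkn A x n y.
Proof. by rewrite mulr_ge0// ?le_max ?lexx// le_min ler01 mulr_ge0. Qed.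

Let lkn_cont A x n : 0 < A -> continuous (lkn A x n).
Proof.
move=> A0 y.
have cd : {for y, continuous (fun y : R => `|x - y|)}.
  apply: cvg_norm; apply: cvgB; [exact: cvg_cst|exact: cvg_id].
have m0 : 0 < Num.max `|x - y| (A / n.+1%:R) by rewrite lt_max divr_gt0 ?orbT.
apply: cvgM.
  apply: (@continuous_min _ _ (fun=> 1) (fun y => n%:R * `|x - y|) y).
    exact: cvg_cst.
  by apply: cvgM => //; exact: cvg_cst.
apply: (@continuous_max _ _ (fun=> 0) (fun y => ln (A / Num.max `|x - y| (A / n.+1%:R))) y).
  exact: cvg_cst.
apply: (@continuous_comp _ _ _ (fun y => A / Num.max `|x - y| (A / n.+1%:R)) (@ln R)).
  apply: cvgM; first exact: cvg_cst.
  apply: cvgV; first by rewrite gt_eqF.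
  apply: (@continuous_max _ _ (fun y => `|x - y|) (fun=> A / n.+1%:R) y) => //.
  exact: cvg_cst.
by apply: continuous_ln; rewrite divr_gt0.
Qed.

Let lkn_nd A x y : 0 < A -> {homo (lkn A x)^~ y : m n / (m <= n)%N >-> m <= n}.
Proof.
move=> A0 m n mn.
have m0 k : 0 < Num.max `|x - y| (A / k.+1%:R) by rewrite lt_max divr_gt0 ?orbT.
apply: ler_pM.
- by rewrite le_min ler01 mulr_ge0.
- by rewrite le_max lexx.
- by rewrite le_min ge_min lexx/= ge_min ler_wpM2r ?ler_nat ?orbT.
- rewrite ge_max le_max lexx/= le_max ler_ln ?posrE ?divr_gt0//.
  rewrite ler_pM2l// lef_pV2 ?posrE// ge_max !le_max lexx/=.
  by rewrite ler_pM2l// lef_pV2 ?posrE// ler_nat ltnS mn !orbT.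
Qed.

Let lkn_lim A x y : 0 < A -> lkn A x n y @[n --> \oo] --> lk A x y.
Proof.
move=> A0; have [->|xy] := eqVneq x y.
  have -> : (fun n => lkn A y n y) = (fun=> lk A y y).
    apply/funext => n; rewrite /lkn /lk subrr normr0 mulr0 invr0 mulr0 (ln0 (lexx 0)) maxxx.
    by rewrite min_r ?ler01// mul0r.
  exact: cvg_cst.
have d0 : 0 < `|x - y| by rewrite normr_gt0 subr_eq0.
apply: cvg_near_cst; near=> n.
have n1 : 1 <= n%:R * `|x - y|.
  rewrite -ler_pdivrMr// mul1r; near: n; exact: nbhs_infty_ger.
have n2 : A / n.+1%:R <= `|x - y|.
  rewrite ler_pdivrMr// mulrC -ler_pdivrMr//.
  apply: (@le_trans _ _ n%:R); last by rewrite ler_nat.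
  near: n; exact: nbhs_infty_ger.
by rewrite /lkn min_l// mul1r (max_l n2).
Unshelve. all: by end_near. Qed.

Lemma pot_arcsine_angle A rho x : 0 < A -> 0 < rho ->
  (pot A (arcsine (rho ^+ 2)) x =
   \int[mu]_(t in `]0%R, pi[) (lk A x (rho * cos t) / pi)%:E)%E.
Proof.
move=> A0 r0; have [ma a0] := nnm_arcsine (rho ^+ 2).
have mlkn n : measurable_fun setT (lkn A x n).
  exact: continuous_measurable_fun (lkn_cont A0).
have mrc : measurable_fun setT (fun t : R => rho * cos t).
  by apply: measurable_funM => //; apply: continuous_measurable_fun; exact: continuous_cos.
have c1 : (\int[mu]_y (lkn A x n y * arcsine (rho ^+ 2) y)%:E)%E @[n --> \oo] -->
    pot A (arcsine (rho ^+ 2)) x.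
  apply: (@monotone_cvg_integral _ setT (fun n y => lkn A x n y * arcsine (rho ^+ 2) y)) => //.
  - by move=> n; exact: measurable_funM.
  - by move=> n y _; rewrite mulr_ge0.
  - by move=> y _ m n mn; rewrite ler_wpM2r// lkn_nd.
  - by move=> y _; apply: cvgM; [exact: lkn_lim|exact: cvg_cst].
have c2 : (\int[mu]_(t in `]0%R, pi[) (lkn A x n (rho * cos t) / pi)%:E)%E @[n --> \oo] -->
   (\int[mu]_(t in `]0%R, pi[) (lk A x (rho * cos t) / pi)%:E)%E.
  apply: (@monotone_cvg_integral _ _ (fun n t => lkn A x n (rho * cos t) / pi)) => //.
  - move=> n; apply: measurable_funTS; apply: measurable_funM => //.
    exact: (measurableT_comp (mlkn n)).
  - by move=> n y _; rewrite divr_ge0 ?pi_ge0.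
  - by move=> y _ m n mn; rewrite ler_wpM2r ?invr_ge0 ?pi_ge0// lkn_nd.
  - by move=> y _; apply: cvgM; [exact: lkn_lim|exact: cvg_cst].
apply: (cvg_unique _ c1) => //.
rewrite (_ : (fun n => _) = (fun n => \int[mu]_(t in `]0%R, pi[) (lkn A x n (rho * cos t) / pi)%:E)%E) //.
apply/funext => n; apply: arcsine_subst_cont => //; exact: lkn_cont.
Qed.

(* the 2pi-periodic kernel - ln |sin (u/2)| *)
Let g0 (u : R) : R := - ln `|sin (u / 2)|.

Let g0_ge0 u : 0 <= g0 u.
Proof. by rewrite oppr_ge0 ln_le0// sin_max. Qed.

Let mg0 : measurable_fun setT (fun u : R => (g0 u)%:E).
Proof.
apply: ((measurable_EFinP _ _).2 _); apply: measurable_funN.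
apply: (measurableT_comp (@measurable_ln R)).
apply: (measurableT_comp (@normr_measurable R setT)).
apply: (@measurableT_comp _ _ _ _ _ _ (@sin R)).
  by apply: continuous_measurable_fun; exact: continuous_sin.
exact: mulrr_measurable.
Qed.

Let g0_even u : g0 (- u) = g0 u.
Proof. by rewrite /g0 mulNr sinN normrN. Qed.

Let g0_per u : g0 (u + 2 * pi) = g0 u.
Proof.
rewrite /g0; have -> : (u + 2 * pi) / 2 = u / 2 + pi by field.
by have := @sinDpi R (u / 2); rewrite /= => ->; rewrite normrN.
Qed.

Let G a b := (\int[mu]_(u in `]a, b[) (g0 u)%:E)%E.

Let G_shift a b c : G (a + c) (b + c) = (\int[mu]_(u in `]a, b[) (g0 (u + c)%R)%:E)%E.
Proof.
rewrite /G (@ge0_integral_shift _ (fun u => (g0 u)%:E) c)//.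
congr (integral _ _ _); apply/seteqP; split => u /=; rewrite !in_itv/= => /andP[h1 h2];
  apply/andP; split; lra.
Qed.

Let G_opp a b : G (- b) (- a) = G a b.
Proof.
rewrite /G (@ge0_integral_opp _ (fun u => (g0 u)%:E))//.
have -> : [set x : R | (`](- b)%R, (- a)%R[%classic : set R) (- x)] = `]a, b[%classic.
  by apply/seteqP; split => u /=; rewrite !in_itv/= => /andP[h1 h2];
    apply/andP; split; lra.
by apply: eq_integral => u _; rewrite g0_even.
Qed.

Let G_per a b : G (a + 2 * pi) (b + 2 * pi) = G a b.
Proof. by rewrite G_shift; apply: eq_integral => u _; rewrite g0_per. Qed.

Let G_chasles a b c : a <= b -> b <= c -> G a c = (G a b + G b c)%E.
Proof.
move=> ab bc; rewrite /G.
have mg (D : set R) : measurable_fun D (fun u : R => (g0 u)%:E).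
  exact: measurable_funTS.
rewrite -(@integral_itv_bndoo _ a b _ false false)// -(@integral_itv_bndoo _ b c _ false false)//.
rewrite -(@integral_itv_bndoo _ a c _ false false)//.
rewrite -ge0_integral_setU//=.
- congr (integral _ _ _); rewrite -itv_bndbnd_setU// bnd_simp//.
- exact: mg.
- by move=> y _; rewrite lee_fin.
- by apply/disj_setPS => y; rewrite /= !in_itv/= => -[/andP[_ h] /andP[]]; lra.
Qed.

Let G_fold al : 0 <= al <= pi -> (G (- al) (pi - al) + G al (pi + al) = G 0 (2 * pi))%E.
Proof.
move=> /andP[al0 alpi].
have -> : G (- al) (pi - al) = G (pi + al) (al + 2 * pi).
  rewrite -G_opp -G_per; congr G; lra.
rewrite addeC -G_chasles; [|lra|lra].
rewrite (@G_chasles al (2 * pi) (al + 2 * pi)); [|lra|lra].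
have -> : G (2 * pi) (al + 2 * pi) = G 0 al.
  by rewrite -[RHS]G_per add0r.
by rewrite addeC -G_chasles//; lra.
Qed.

Lemma lk_cos A rho al t : 0 < rho -> 2 * rho <= A -> 0 <= al <= pi -> 0 < t < pi ->
  t != al -> lk A (rho * cos al) (rho * cos t) =
  ln (A / (2 * rho)) + g0 (t - al) + g0 (t + al).
Proof.
move=> r0 rA /andP[al0 alpi] /andP[t0 tpi] tal.
have s1 : 0 < sin ((t + al) / 2) by apply: sin_gt0_pi; apply/andP; split; lra.
have s2 : 0 < `|sin ((t - al) / 2)|.
  have [h|h] := ltP al t.
    by rewrite normr_gt0 gt_eqF//; apply: sin_gt0_pi; apply/andP; split; lra.
  have {}h : t < al by rewrite lt_neqAle tal.
  rewrite -normrN -sinN normr_gt0 gt_eqF//; apply: sin_gt0_pi; apply/andP; split; lra.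
have cE : rho * cos al - rho * cos t = 2 * rho * (sin ((t + al) / 2) * sin ((t - al) / 2)).
  have -> : cos al = cos ((t + al) / 2 - (t - al) / 2) by congr cos; field.
  have -> : cos t = cos ((t + al) / 2 + (t - al) / 2) by congr cos; field.
  by rewrite cosB cosD; ring.
rewrite /lk cE !normrM !(ger0_norm (ltW r0)) (ger0_norm (ltW s1)) (@ger0_norm _ 2)//.
rewrite /g0 (ger0_norm (ltW s1)).
have h1 : sin ((t + al) / 2) <= 1 by exact: sin_le1.
have h2 : `|sin ((t - al) / 2)| <= 1 by exact: sin_max.
set s := sin _ in s1 h1 *; set u := `|_| in s2 h2 *.
have A0 : 0 < A by lra.
have p0 : 0 < 2 * rho * (s * u) by rewrite !mulr_gt0.
rewrite max_r.
  rewrite !ln_div ?posrE ?mulr_gt0// (@lnM _ (2 * rho)) ?posrE ?mulr_gt0// (@lnM _ s)//.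
  by ring.
apply: ln_ge0; rewrite ler_pdivlMr// mul1r (le_trans _ rA)//.
by rewrite ler_piMr ?mulr_ge0 ?(ltW r0)// mulr_ile1// ltW.
Qed.

Let arcsine_pot_const A rho x : 0 < rho -> 2 * rho <= A -> `|x| <= rho ->
  (pot A (arcsine (rho ^+ 2)) x = (ln (A / (2 * rho)))%:E + (pi^-1)%:E * G 0 (2 * pi))%E.
Proof.
move=> r0 rA xr; have A0 : 0 < A by lra.
have p0 : 0 < pi :> R by exact: pi_gt0.
have xr1 : -1 <= x / rho <= 1.
  by move: xr; rewrite ler_norml ler_pdivlMr// ler_pdivrMr// mulN1r mul1r.
pose al := acos (x / rho).
have alI : 0 <= al <= pi by rewrite acos_ge0// acos_lepi.
have xE : x = rho * cos al by rewrite acosK//; field; lra.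
rewrite pot_arcsine_angle// xE.
pose c := ln (A / (2 * rho)).
have c0 : 0 <= c by apply: ln_ge0; rewrite ler_pdivlMr// ?mul1r// mulr_gt0.
have mg (b : R) : measurable_fun setT (fun t : R => (g0 (t + b))%:E).
  apply: (measurableT_comp mg0); exact: measurable_funD.
have m1 : measurable_fun setT (fun t : R => (lk A (rho * cos al) (rho * cos t) / pi)%:E).
  apply: ((measurable_EFinP _ _).2 _); apply: measurable_funM => //.
  apply: (measurableT_comp (measurable_lk2 A _)); apply: measurable_funM => //.
  by apply: continuous_measurable_fun; exact: continuous_cos.
transitivity (\int[mu]_(t in `]0%R, pi[) ((c / pi)%:E + (pi^-1)%:E * ((g0 (t - al))%:E + (g0 (t + al))%:E)))%E.
  apply: (@integral_off_point _ _ al) => //; first exact: measurable_funTS.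
  move=> t; rewrite /= in_itv/= => tpi tal; rewrite lk_cos//.
  transitivity ((c / pi + pi^-1 * (g0 (t - al) + g0 (t + al)))%:E : \bar R) => //.
  by congr EFin; rewrite -/c; field; lra.
have ge2 t : (0 <= (g0 (t - al))%:E + (g0 (t + al))%:E)%E.
  by rewrite adde_ge0// lee_fin.
have mg2 : measurable_fun setT (fun t : R => (g0 (t - al))%:E + (g0 (t + al))%:E)%E.
  by apply: emeasurable_funD; exact: mg.
rewrite ge0_integralD//=; first last.
- apply: measurable_funTS; apply: emeasurable_funM => //.
- by move=> t _; rewrite mule_ge0// lee_fin invr_ge0 ltW.
- by move=> t _; rewrite lee_fin divr_ge0// ltW.
congr (_ + _)%E.
  rewrite (@integral_cst _ _ _ mu `]0%R, pi[%classic (measurable_itv _) (c / pi)%:E)/=.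
  rewrite lebesgue_measure_itv/= lte_fin p0 -EFinD -EFinM; congr EFin.
  by rewrite /c; field; lra.
rewrite ge0_integralZl_EFin//; first last.
- by rewrite invr_ge0 ltW.
- exact: (measurable_funTS mg2).
congr (_ * _)%E; rewrite ge0_integralD//=; first last.
- exact: (measurable_funTS (mg al)).
- by move=> t _; rewrite lee_fin.
- exact: (measurable_funTS (mg (- al))).
- by move=> t _; rewrite lee_fin.
rewrite -G_shift -(G_shift 0 pi al) add0r -(G_fold alI) add0r.
by congr (_ + _)%E; congr G; lra.
Qed.

Let arcsine_supp rho y : 0 < rho -> arcsine (rho ^+ 2) y != 0 -> `|y| < rho.
Proof.
by move=> r0; rewrite ltNge; apply: contraNN => /arcsine_out -> //; rewrite ltW.
Qed.

Lemma lk_le A x x' y : 0 < `|x' - y| -> `|x' - y| <= `|x - y| -> lk A x y <= lk A x' y.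
Proof.
move=> d0 dd; have d1 := lt_le_trans d0 dd.
have [A0|A0] := leP A 0.
  by rewrite (@lk_eq0 _ A x)// ?lk_ge0// (le_trans A0).
rewrite /lk ge_max le_max lexx/= le_max ler_ln ?posrE ?divr_gt0//.
by rewrite ler_pM2l// lef_pV2// dd orbT.
Qed.

Lemma arcsine_potential A rho : 0 < rho -> 2 * rho <= A -> exists kap : R,
  [/\ 0 <= kap,
      forall x, `|x| <= rho -> pot A (arcsine (rho ^+ 2)) x = kap%:E,
      forall x, (pot A (arcsine (rho ^+ 2)) x <= kap%:E)%E &
      forall x, rho <= x -> x + rho <= A ->
        (pot A (arcsine (rho ^+ 2)) x + (ln (1 + (x - rho) / (2 * rho)))%:E <= kap%:E)%E].
Proof.
move=> r0 rA; have A0 : 0 < A by lra.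
have na := nnm_arcsine (rho ^+ 2); have [ma a0] := na.
pose w := arcsine (rho ^+ 2).
pose K := pot A w 0.
have Kc x : `|x| <= rho -> pot A w x = K.
  by move=> xr; rewrite /K !arcsine_pot_const// normr0 ltW.
have K0 : (0 <= K)%E by exact: pot_ge0.
have Kfin : (K < +oo)%E.
  pose D : set R := [set` `[- rho, rho]].
  have nD : nnm (\1_D : R -> R) by apply: nnm_indic; exact: measurable_itv.
  have DE x : ((\1_D x)%:E * pot A w x = (\1_D x)%:E * K)%E.
    rewrite indicE; case: (boolP (x \in D)) => xD; last by rewrite !mul0e.
    by rewrite Kc//; move: xD; rewrite /D inE/= in_itv/= ler_norml.
  have : (kform A (\1_D) w <= (2 * A)%:E)%E.
    rewrite kform_sym//; have := @kform_le_pot _ A w (\1_D) (2 * A) na nD.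
    rewrite arcsine_mass// mule1; apply; first lra.
    move=> x _; have -> : 2 * A = 2 * A * 1 by rewrite mulr1.
    by apply: pot_bounded => // y; rewrite indicE; case: (_ \in _).
  have -> : (kform A (\1_D) w = \int[mu]_x ((\1_D x)%:E * K))%E.
    by apply: eq_integral => x _; exact: DE.
  have mD : measurable_fun setT (fun x : R => (\1_D x : R)%:E).
    by apply: ((measurable_EFinP _ _).2 _); case: nD.
  rewrite ge0_integralZr//.
  rewrite integral_indic ?setIT /=; [|by []|exact: measurable_itv].
  rewrite lebesgue_measure_itv/= lte_fin.
  have -> : - rho < rho by lra.
  rewrite -EFinD opprK.
  move=> h; rewrite ltey; apply/eqP => Ky; move: h.
  by rewrite Ky mulry gtr0_sg ?mul1e//; lra.
exists (fine K).
have KE : (fine K)%:E = K by rewrite fineK// ge0_fin_numE.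
have mono x x' : (forall y, `|y| < rho -> 0 < `|x' - y| <= `|x - y|) ->
    (pot A w x <= pot A w x')%E.
  move=> h; apply: le_integral_nnm; [exact/nnmM/na/nnm_lk|exact/nnmM/na/nnm_lk|].
  move=> y; have [->|wy] := eqVneq (w y) 0; first by rewrite !mulr0.
  have /andP[h1 h2] := h y (arcsine_supp r0 wy).
  by rewrite ler_wpM2r ?arcsine_ge0// lk_le.
have Kle x : (pot A w x <= K)%E.
  have [xr|xr] := leP `|x| rho; first by rewrite Kc.
  have [x0|x0] := ltP x 0.
    rewrite -(Kc (- rho)) ?normrN ?ger0_norm ?(ltW r0)//; apply: mono => y.
    rewrite ltr_norml => /andP[y1 y2]; move: xr; rewrite ltr0_norm// => xr.
    by rewrite !ltr0_norm; lra.
  rewrite -(Kc rho) ?ger0_norm ?(ltW r0)//; apply: mono => y.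
  rewrite ltr_norml => /andP[y1 y2]; move: xr; rewrite ger0_norm// => xr.
  by rewrite !gtr0_norm; lra.
split; rewrite ?KE//.
  by rewrite -lee_fin KE.
move=> x rx xA; rewrite -(Kc rho) ?ger0_norm ?(ltW r0)//.
set d := ln _.
have d0 : 0 <= d by apply: ln_ge0; rewrite lerDl divr_ge0//; lra.
have -> : d%:E = (\int[mu]_y (d * w y)%:E)%E.
  by rewrite ge0_integral_nnmZ// arcsine_mass// mule1.
rewrite -ge0_integral_nnmD; first last.
- exact/nnmM/na/nnm_cst.
- exact/nnmM/na/nnm_lk.
apply: le_integral_nnm.
- apply: nnmD; first exact/nnmM/na/nnm_lk.
  exact/nnmM/na/nnm_cst.
- exact/nnmM/na/nnm_lk.
move=> y; rewrite -?/(w y); have [->|wy] := eqVneq (w y) 0; first by rewrite !mulr0 addr0.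
have := arcsine_supp r0 wy; rewrite ltr_norml => /andP[y1 y2].
rewrite -mulrDl ler_wpM2r ?arcsine_ge0// /lk.
have e1 : 0 < rho - y by lra.
have e2 : 0 < x - y by lra.
have e3 : 0 < 1 + (x - rho) / (2 * rho) by rewrite ltr_pwDl// divr_ge0//; lra.
rewrite !gtr0_norm// !max_r; last 2 first.
  by apply: ln_ge0; rewrite ler_pdivlMr// mul1r; lra.
  by apply: ln_ge0; rewrite ler_pdivlMr// mul1r; lra.
rewrite /d -lnM ?posrE ?divr_gt0// ler_ln ?posrE ?mulr_gt0 ?divr_gt0//.
have -> : A / (rho - y) = A / (x - y) * (1 + (x - rho) / (rho - y)) by field; lra.
rewrite ler_pM2l ?divr_gt0// lerD2l ler_wpM2l; [by []|lra|].
by rewrite lef_pV2 ?posrE; lra.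
- by rewrite invr_gt0.
- by rewrite invr_gt0.
Qed.

End arcsine_potential.


Section constrained_equilibrium.
Context {R : realType}.
Local Notation mu := (@lebesgue_measure R).
Implicit Types (f g : R -> R) (a b c r x y A rho q h w v : R).

Lemma pot_shift A f c x : nnm f -> pot A (fun y => f (y - c)) x = pot A f (x - c).
Proof.
move=> nf; have [mf f0] := nf.
have mc : measurable_fun setT (fun y : R => y - c) by exact: measurable_funB.
have H := @ge0_integral_shift _ (fun y => (lk A x y * f (y - c))%:E) c setT measurableT.
rewrite /pot H.
- have -> : [set x0 : R | [set: R] (x0 + c)] = setT by apply/seteqP; split.
  apply: eq_integral => y _; congr EFin; rewrite addrK /lk; congr (Num.max _ (ln (_ / `|_|)) * _).
  ring.
- apply: ((measurable_EFinP _ _).2 _); apply: measurable_funM; first exact: measurable_lk2.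
  exact: (measurableT_comp mf mc).
- by move=> y; rewrite lee_fin mulr_ge0// lk_ge0.
Qed.

Lemma integral_shiftT f c : nnm f -> (\int[mu]_y (f (y - c))%:E = \int[mu]_y (f y)%:E)%E.
Proof.
move=> nf; have [mf f0] := nf.
have mc : measurable_fun setT (fun y : R => y - c) by exact: measurable_funB.
have -> := @ge0_integral_shift _ (fun y => (f (y - c))%:E) c setT measurableT.
- have -> : [set x0 : R | [set: R] (x0 + c)] = setT by apply/seteqP; split.
  by apply: eq_integral => y _; rewrite addrK.
- by apply: ((measurable_EFinP _ _).2 _); exact: (measurableT_comp mf mc).
- by move=> y; rewrite lee_fin.
Qed.

Lemma nnm_shift f c : nnm f -> nnm (fun y => f (y - c)).
Proof.
move=> [mf f0]; split => //; apply: (measurableT_comp mf); exact: measurable_funB.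
Qed.

Definition saturated h w y : R :=
  fine (\int[mu]_v (\1_(`[- w, w]) v * arcsine (h ^+ 2 - y ^+ 2) v)%:E).

Section profile.
Variables (h w : R).
Hypotheses (w0 : 0 <= w) (wh : w < h).

Let D : set R := [set` `[- w, w]].
Let psi := saturated h w.

Let nD : nnm (\1_D : R -> R).
Proof. by apply: nnm_indic; exact: measurable_itv. Qed.

Let D_le1 v : (\1_D v : R) <= 1.
Proof. by rewrite indicE; case: (_ \in _). Qed.

Let kernel_nnm y : nnm (fun v => \1_D v * arcsine (h ^+ 2 - y ^+ 2) v).
Proof. by apply: nnmM => //; exact: nnm_arcsine. Qed.

Let kernel_le y : (\int[mu]_v (\1_D v * arcsine (h ^+ 2 - y ^+ 2) v)%:E <= 1)%E.
Proof.
have [q0|q0] := leP (h ^+ 2 - y ^+ 2) 0.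
  rewrite integral0_eq// => v _; rewrite arcsine_eq0 ?mulr0//.
  by rewrite (le_trans q0)// sqr_ge0.
have r0 : 0 < Num.sqrt (h ^+ 2 - y ^+ 2) by rewrite sqrtr_gt0.
rewrite -(arcsine_mass r0) sqr_sqrtr ?(ltW q0)//; apply: le_integral_nnm => //.
  exact: nnm_arcsine.
by move=> v; rewrite ler_piMl// arcsine_ge0.
Qed.

Lemma saturatedE y :
  ((psi y)%:E = \int[mu]_v (\1_D v * arcsine (h ^+ 2 - y ^+ 2) v)%:E)%E.
Proof.
rewrite /psi /saturated fineK// ge0_fin_numE; first exact: le_lt_trans (kernel_le y) (ltry _).
by apply: integral_ge0 => v _; rewrite lee_fin; case: (kernel_nnm y).
Qed.

Let measurable_arcsine_sq :
  measurable_fun setT (fun z : R * R => arcsine (h ^+ 2 - z.1 ^+ 2) z.2).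
Proof.
have H : measurable_fun setT (fun z : R * R => (h ^+ 2 - z.1 ^+ 2, z.2)).
  apply: measurable_fun_pair => //; apply: measurable_funB => //.
  exact: (measurableT_comp (@exprn_measurable R setT 2)).
exact: (measurableT_comp measurable_arcsine2 H).
Qed.

Let mker2 : measurable_fun setT (fun z : R * R => \1_D z.2 * arcsine (h ^+ 2 - z.1 ^+ 2) z.2).
Proof.
apply: measurable_funM.
  by apply: (measurableT_comp (proj1 nD)).
exact: measurable_arcsine_sq.
Qed.

Lemma nnm_saturated : nnm psi.
Proof.
split; last first.
  move=> y; rewrite -lee_fin saturatedE; apply: integral_ge0 => v _.
  by rewrite lee_fin; case: (kernel_nnm y).
have mE : measurable_fun setT (fun y : R => (psi y)%:E).
  have -> : (fun y => (psi y)%:E) = (fun y => \int[mu]_v (\1_D v * arcsine (h ^+ 2 - y ^+ 2) v)%:E)%E.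
    by apply/funext => y; rewrite saturatedE.
  apply: (@measurable_partial_integral _ (fun y v => \1_D v * arcsine (h ^+ 2 - y ^+ 2) v)) => //.
  by move=> y v; case: (kernel_nnm y).
exact: ((measurable_EFinP _ _).1 mE).
Qed.

Lemma saturated_le1 y : psi y <= 1.
Proof. by rewrite -lee_fin saturatedE kernel_le. Qed.

Lemma saturated_out y : h <= `|y| -> psi y = 0.
Proof.
move=> hy; have : ((psi y)%:E = 0)%E; last by case.
rewrite saturatedE integral0_eq// => v _; rewrite arcsine_eq0 ?mulr0//.
apply: (@le_trans _ _ 0); last exact: sqr_ge0.
rewrite subr_le0 -(real_normK (num_real y)) lerXn2r ?nnegrE//; exact: le_trans w0 (ltW wh).
Qed.

Lemma saturated_eq1 y : h ^+ 2 - w ^+ 2 <= y ^+ 2 -> `|y| < h -> psi y = 1.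
Proof.
move=> hy yh; have : ((psi y)%:E = 1)%E; last by case.
have q0 : 0 < h ^+ 2 - y ^+ 2.
  by rewrite subr_gt0 -(real_normK (num_real y)) ltrXn2r// nnegrE.
have r0 : 0 < Num.sqrt (h ^+ 2 - y ^+ 2) by rewrite sqrtr_gt0.
rewrite saturatedE -(arcsine_mass r0) sqr_sqrtr ?(ltW q0)//; apply: eq_integral => v _.
congr EFin; rewrite indicE; case: (boolP (v \in D)) => vD; first by rewrite mul1r.
rewrite mul0r arcsine_eq0//.
have : w < `|v|.
  by move: vD; rewrite notin_setE /D/= in_itv/= -ler_norml => /negP; rewrite -ltNge.
move=> wv; have : w ^+ 2 <= `|v| ^+ 2 by rewrite lerXn2r ?nnegrE// ltW.
by rewrite real_normK ?num_real//; lra.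
Qed.

Lemma saturated_lt1 y : y ^+ 2 < h ^+ 2 - w ^+ 2 -> psi y < 1.
Proof.
move=> hy; pose q := h ^+ 2 - y ^+ 2.
have q0 : 0 < q by rewrite /q; have := sqr_ge0 w; lra.
pose rho := Num.sqrt q.
have r0 : 0 < rho by rewrite sqrtr_gt0.
have wr : w < rho.
  by rewrite -(ger0_norm w0) -sqrtr_sqr ltr_sqrt//; rewrite /q; lra.
have na := nnm_arcsine q.
pose D' : set R := [set` `]w, rho[].
have gt0 : (0 < \int[mu]_(v in D') (arcsine q v)%:E)%E.
  apply: ge0_integral_gt0.
  - exact: measurable_itv.
  - by apply: measurable_funTS; apply: ((measurable_EFinP _ _).2 _); case: na.
  - move=> v; rewrite /D'/= in_itv/= => /andP[v1 v2]; rewrite lte_fin invr_gt0.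
    rewrite mulr_gt0 ?pi_gt0// sqrtr_gt0 subr_gt0.
    by rewrite -(sqr_sqrtr (ltW q0)) ltrXn2r// ?nnegrE ?(ltW r0)// (le_trans w0)// ltW.
  - by rewrite lebesgue_measure_itv/= lte_fin wr -EFinD lte_fin subr_gt0.
have le1 : ((psi y)%:E + \int[mu]_(v in D') (arcsine q v)%:E <= 1)%E.
  rewrite saturatedE -(arcsine_mass r0) sqr_sqrtr ?(ltW q0)//.
  have -> : (\int[mu]_(v in D') (arcsine q v)%:E = \int[mu]_v (\1_D' v * arcsine q v)%:E)%E.
    rewrite integral_mkcond; apply: eq_integral => v _; rewrite patchE indicE.
    by case: ifP => _; rewrite ?mul1r ?mul0r.
  have nD' : nnm (\1_D' : R -> R) by apply: nnm_indic; exact: measurable_itv.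
  rewrite -ge0_integral_nnmD//; last exact: nnmM.
  apply: le_integral_nnm => //; first by apply: nnmD => //; exact: nnmM.
  move=> v; rewrite -mulrDl ler_piMl ?arcsine_ge0// !indicE.
  case: (boolP (v \in D)) => vD; case: (boolP (v \in D')) => vD' //=; rewrite ?addr0 ?add0r//.
  move: vD vD'; rewrite /D /D' !inE/= !in_itv/= => /andP[_ h1] /andP[h2 _]; lra.
rewrite -lte_fin; apply: (lt_le_trans _ le1).
by rewrite lteDl.
Qed.

Let sym y v : arcsine (h ^+ 2 - y ^+ 2) v = arcsine (h ^+ 2 - v ^+ 2) y.
Proof. by rewrite /arcsine; congr (_ * Num.sqrt _)^-1; ring. Qed.

Let rho v := Num.sqrt (h ^+ 2 - v ^+ 2).

Let rho_gt0 v : v \in D -> 0 < rho v /\ rho v ^+ 2 = h ^+ 2 - v ^+ 2 /\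
  2 * rho v <= 2 * h /\ h ^+ 2 - w ^+ 2 <= rho v ^+ 2.
Proof.
rewrite /D inE/= in_itv/= -ler_norml => vw.
have h0 : 0 <= h by exact: le_trans w0 (ltW wh).
have vh : `|v| ^+ 2 < h ^+ 2 by rewrite ltrXn2r ?nnegrE ?normr_ge0 ?(le_lt_trans vw).
have vw2 : `|v| ^+ 2 <= w ^+ 2 by rewrite lerXn2r ?nnegrE.
move: vh vw2; rewrite real_normK ?num_real// => vh vw2.
have q0 : 0 < h ^+ 2 - v ^+ 2 by lra.
rewrite /rho sqrtr_gt0 sqr_sqrtr ?(ltW q0)//; split => //; split => //; split; last by lra.
rewrite ler_pM2l// -[leRHS]ger0_norm; last lra.
by rewrite -[leRHS]sqrtr_sqr ler_sqrt; [have := sqr_ge0 v; lra|exact: sqr_ge0].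
Qed.

Lemma saturated_mass : (\int[mu]_y (psi y)%:E = (2 * w)%:E)%E.
Proof.
transitivity (\int[mu]_y \int[mu]_v (\1_D v * arcsine (h ^+ 2 - y ^+ 2) v)%:E)%E.
  by apply: eq_integral => y _; rewrite saturatedE.
rewrite (@tonelli _ (fun y v => \1_D v * arcsine (h ^+ 2 - y ^+ 2) v))//; last first.
  by move=> y v; case: (kernel_nnm y).
transitivity (\int[mu]_v (\1_D v)%:E)%E.
  apply: eq_integral => v _; rewrite indicE.
  case: (boolP (v \in D)) => vD; last by rewrite integral0_eq// => y _; rewrite mul0r.
  have [r0 [r2 _]] := rho_gt0 vD.
  under eq_integral do rewrite mul1r sym.
  by rewrite -r2 arcsine_mass.
rewrite integral_indic ?setIT /=; [|by []|exact: measurable_itv].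
rewrite lebesgue_measure_itv/= lte_fin; case: ifPn => h1.
  by rewrite -EFinD; congr EFin; lra.
have -> : w = 0 by apply/eqP; rewrite eq_le w0 andbT; move: h1; rewrite -leNgt; lra.
by rewrite mulr0.
Qed.

Let pot_saturatedE x : (pot (2 * h) psi x =
  \int[mu]_v ((\1_D v)%:E * pot (2 * h) (arcsine (h ^+ 2 - v ^+ 2)) x))%E.
Proof.
transitivity (\int[mu]_y \int[mu]_v (lk (2 * h) x y * (\1_D v * arcsine (h ^+ 2 - y ^+ 2) v))%:E)%E.
  apply: eq_integral => y _; rewrite EFinM saturatedE -ge0_integralZl_EFin ?lk_ge0//.
  - by move=> v _; rewrite lee_fin; case: (kernel_nnm y).
  - by apply: ((measurable_EFinP _ _).2 _); case: (kernel_nnm y).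
rewrite (@tonelli _ (fun y v => lk (2 * h) x y * (\1_D v * arcsine (h ^+ 2 - y ^+ 2) v))); first last.
- by move=> y v; rewrite mulr_ge0 ?lk_ge0//; case: (kernel_nnm y).
- apply: measurable_funM => //.
  exact: (measurableT_comp (measurable_lk2 _ x)).
apply: eq_integral => v _; rewrite -ge0_integral_nnmZ; first last.
- by apply: nnmM; [exact: nnm_lk|exact: nnm_arcsine].
- by case: nD.
by apply: eq_integral => y _; rewrite mulrCA sym.
Qed.

Let mpot x : measurable_fun setT
  (fun v : R => (\1_D v)%:E * pot (2 * h) (arcsine (h ^+ 2 - v ^+ 2)) x)%E.
Proof.
apply: emeasurable_funM.
  by apply: ((measurable_EFinP _ _).2 _); case: nD.
apply: (@measurable_partial_integral _ (fun v y => lk (2 * h) x y * arcsine (h ^+ 2 - v ^+ 2) y)).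
  apply: measurable_funM; first exact: (measurableT_comp (measurable_lk2 _ x)).
  exact: measurable_arcsine_sq.
by move=> v y; rewrite mulr_ge0 ?lk_ge0 ?arcsine_ge0.
Qed.

Lemma pot_saturated_const x : x ^+ 2 <= h ^+ 2 - w ^+ 2 ->
  pot (2 * h) psi x = pot (2 * h) psi 0.
Proof.
move=> xr; rewrite !pot_saturatedE; apply: eq_integral => v _; rewrite indicE.
case: (boolP (v \in D)) => vD; last by rewrite !mul0e.
have [r0 [r2 [rh rw]]] := rho_gt0 vD.
have [kap [_ kc _ _]] := arcsine_potential r0 rh.
rewrite -r2 !kc//; first by rewrite normr0 ltW.
rewrite -(@ler_pXn2r _ 2) ?nnegrE ?(ltW r0)// real_normK ?num_real//; lra.
Qed.

Lemma pot_saturated_le x : (pot (2 * h) psi x <= pot (2 * h) psi 0)%E.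
Proof.
rewrite !pot_saturatedE; apply: ge0_le_integral => //.
- by move=> v _; rewrite mule_ge0 ?lee_fin ?indicE// pot_ge0//; exact: nnm_arcsine.
- exact: mpot.
- exact: mpot.
move=> v _; rewrite indicE.
case: (boolP (v \in D)) => vD; last by rewrite !mul0e.
have [r0 [r2 [rh rw]]] := rho_gt0 vD.
have [kap [_ kc kle _]] := arcsine_potential r0 rh.
by rewrite !mul1e -r2 [leRHS]kc// normr0 ltW.
Qed.

End profile.
End constrained_equilibrium.


Section tame_densities.
Context {R : realType}.
Local Notation mu := (@lebesgue_measure R).
Variable A : R.
Hypothesis A0 : 0 < A.
Implicit Types (f g p : R -> R) (a b c x y : R).

Definition tame f : Prop :=
  [/\ nnm f, (\int[mu]_x (f x)%:E < +oo)%E &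
      exists c, forall x, (pot A f x <= c%:E)%E].

Definition mass f : R := fine (\int[mu]_x (f x)%:E)%E.

Definition kr f g : R := fine (kform A f g).

Lemma tame_nnm f : tame f -> nnm f. Proof. by case. Qed.

Lemma nnm_mass_ge0 f : nnm f -> (0 <= \int[mu]_x (f x)%:E)%E.
Proof. by move=> [_ f0]; apply: integral_ge0 => x _; rewrite lee_fin. Qed.

Lemma tame_massE f : tame f -> (\int[mu]_x (f x)%:E = (mass f)%:E)%E.
Proof. by move=> [nf mf _]; rewrite /mass fineK// ge0_fin_numE// nnm_mass_ge0. Qed.

Lemma mass_ge0 f : nnm f -> 0 <= mass f.
Proof. by move=> nf; rewrite fine_ge0// nnm_mass_ge0. Qed.

Lemma tame_pot f : tame f -> exists c, 0 <= c /\ forall x, (pot A f x <= c%:E)%E.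
Proof.
move=> [nf _ [c fc]]; exists c; split => //.
by rewrite -lee_fin (le_trans (pot_ge0 A 0 nf)).
Qed.

Lemma krE f g : tame f -> tame g -> (kform A f g = (kr f g)%:E)%E.
Proof.
move=> cf cg; have [nf mf _] := cf; have [ng _ _] := cg.
have [c [c0 gc]] := tame_pot cg.
rewrite /kr fineK// ge0_fin_numE; last exact: kform_ge0.
have := kform_le_pot nf ng c0 (fun x _ => gc x) => /le_lt_trans; apply.
by rewrite tame_massE// -EFinM ltry.
Qed.

Lemma tame_bounded f b : nnm f -> (forall y, f y <= b) ->
  (\int[mu]_x (f x)%:E < +oo)%E -> tame f.
Proof.
move=> nf fb mf; split => //; exists (2 * A * b) => x.
exact: pot_bounded.
Qed.

Lemma tameD f g : tame f -> tame g -> tame (fun x => f x + g x).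
Proof.
move=> [nf mf [c fc]] [ng mg [d gd]]; split; first exact: nnmD.
  by rewrite ge0_integral_nnmD// lte_add_pinfty.
by exists (c + d) => x; rewrite potD// EFinD leeD.
Qed.

Lemma tameZ a f : 0 <= a -> tame f -> tame (fun x => a * f x).
Proof.
move=> a0 cf; have [nf mf [c fc]] := cf; split.
- exact/nnmM/nf/nnm_cst.
- by rewrite ge0_integral_nnmZ// tame_massE// -EFinM ltry.
- by exists (a * c) => x; rewrite potZ// EFinM lee_wpmul2l.
Qed.

Lemma tame0 : tame (fun=> 0).
Proof.
split; first exact: nnm0.
  by rewrite integral0 ltry.
by exists 0 => x; rewrite /pot integral0_eq// => y _; rewrite mulr0.
Qed.

Lemma tame_sum (I : Type) (s : seq I) (F : I -> R -> R) :
  (forall i, tame (F i)) -> tame (fun x => \sum_(i <- s) F i x).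
Proof.
move=> cF; elim: s => [|i s ih].
  by under eq_fun do rewrite big_nil; exact: tame0.
by under eq_fun do rewrite big_cons; exact: tameD.
Qed.

Lemma massD f g : tame f -> tame g -> mass (fun x => f x + g x) = mass f + mass g.
Proof.
move=> cf cg; have [nf _ _] := cf; have [ng _ _] := cg.
by apply: EFin_inj; rewrite -tame_massE ?ge0_integral_nnmD ?tame_massE//; exact: tameD.
Qed.

Lemma massZ a f : 0 <= a -> tame f -> mass (fun x => a * f x) = a * mass f.
Proof.
move=> a0 cf; have [nf _ _] := cf.
by apply: EFin_inj; rewrite -tame_massE ?ge0_integral_nnmZ ?tame_massE//; exact: tameZ.
Qed.

Lemma mass_sum (I : Type) (s : seq I) (F : I -> R -> R) : (forall i, tame (F i)) ->
  mass (fun x => \sum_(i <- s) F i x) = \sum_(i <- s) mass (F i).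
Proof.
move=> cF; elim: s => [|i s ih].
  by under eq_fun do rewrite big_nil; rewrite big_nil /mass integral0.
under eq_fun do rewrite big_cons; rewrite big_cons -ih.
by apply: massD => //; exact: tame_sum.
Qed.

Lemma kr_ge0 f g : nnm f -> nnm g -> 0 <= kr f g.
Proof. by move=> nf ng; rewrite fine_ge0// kform_ge0. Qed.

Lemma kr_sym f g : nnm f -> nnm g -> kr f g = kr g f.
Proof. by move=> nf ng; rewrite /kr kform_sym. Qed.

Lemma krDr f g h : tame f -> tame g -> tame h ->
  kr f (fun x => g x + h x) = kr f g + kr f h.
Proof.
move=> cf cg ch; apply: EFin_inj; rewrite -krE//; last exact: tameD.
by rewrite kformDr ?krE//; exact: tame_nnm.
Qed.

Lemma krDl f g h : tame f -> tame g -> tame h ->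
  kr (fun x => g x + h x) f = kr g f + kr h f.
Proof.
move=> cf cg ch; apply: EFin_inj; rewrite -krE//; last exact: tameD.
by rewrite kformDl ?krE//; exact: tame_nnm.
Qed.

Lemma krZr a f g : 0 <= a -> tame f -> tame g -> kr f (fun x => a * g x) = a * kr f g.
Proof.
move=> a0 cf cg; apply: EFin_inj; rewrite -krE//; last exact: tameZ.
by rewrite kformZr ?krE//; exact: tame_nnm.
Qed.

Lemma krZl a f g : 0 <= a -> tame f -> tame g -> kr (fun x => a * g x) f = a * kr g f.
Proof.
move=> a0 cf cg; apply: EFin_inj; rewrite -krE//; last exact: tameZ.
by rewrite kformZl ?krE//; exact: tame_nnm.
Qed.

Lemma kr_suml (I : Type) (s : seq I) (F : I -> R -> R) f : tame f ->
  (forall i, tame (F i)) ->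
  kr (fun x => \sum_(i <- s) F i x) f = \sum_(i <- s) kr (F i) f.
Proof.
move=> cf cF; elim: s => [|i s ih].
  under eq_fun do rewrite big_nil; rewrite big_nil /kr /kform integral0_eq// => x _.
  by rewrite mul0e.
under eq_fun do rewrite big_cons; rewrite big_cons -ih.
by apply: krDl => //; exact: tame_sum.
Qed.

Lemma kr_sumr (I : Type) (s : seq I) (F : I -> R -> R) f : tame f ->
  (forall i, tame (F i)) ->
  kr f (fun x => \sum_(i <- s) F i x) = \sum_(i <- s) kr f (F i).
Proof.
move=> cf cF; rewrite kr_sym ?kr_suml//; try exact: tame_nnm.
  by apply: eq_bigr => i _; apply: kr_sym; exact: tame_nnm.
by apply: tame_nnm; exact: tame_sum.
Qed.

Lemma kr_le_pot f g c : tame f -> tame g -> 0 <= c ->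
  (forall x, f x != 0 -> (pot A g x <= c%:E)%E) -> kr f g <= c * mass f.
Proof.
move=> cf cg c0 gc; rewrite -lee_fin -krE// EFinM -tame_massE//.
by apply: kform_le_pot => //; exact: tame_nnm.
Qed.

Lemma kr_ge_pot f g c : tame f -> tame g -> 0 <= c ->
  (forall x, f x != 0 -> (c%:E <= pot A g x)%E) -> c * mass f <= kr f g.
Proof.
move=> cf cg c0 gc; rewrite -lee_fin -krE// EFinM -tame_massE//.
by apply: kform_ge_pot => //; exact: tame_nnm.
Qed.

Lemma kr_posdef f g : tame f -> tame g -> 2 * kr f g <= kr f f + kr g g.
Proof.
move=> cf cg; have [nf _ _] := cf; have [ng _ _] := cg.
rewrite mulr2n mulrDl mul1r -lee_fin !EFinD -!krE//.
exact: kform_posdef.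
Qed.

(* a density T whose potential separates f from p *)
Lemma kr_separation f p T c : tame f -> tame p -> tame T -> 0 < c ->
  kr f T = c -> kr p T <= c -> kr T T <= c ->
  (c - kr p T) ^+ 2 / c <= kr f f + kr p p - 2 * kr f p.
Proof.
move=> cf cp cT c0 fT pT TT.
have [nf _ _] := cf; have [np _ _] := cp; have [nT _ _] := cT.
set e := c - kr p T.
have e0 : 0 <= e / c by rewrite divr_ge0 ?(ltW c0)// subr_ge0.
have ceT : tame (fun x => e / c * T x) by exact: tameZ.
have := @kr_posdef f (fun x => p x + e / c * T x) cf (tameD cp ceT).
rewrite krDr// krZr// fT !krDr ?krDl ?krZr ?krZl//; try exact: tameD.
rewrite (kr_sym nT np) => H.
have h1 : e / c * (e / c * kr T T) <= e / c * (e / c * c).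
  by do 2 rewrite ler_wpM2l//.
have h2 : e ^+ 2 / c = 2 * (e / c) * c - 2 * (e / c) * kr p T - e / c * (e / c * c).
  by rewrite /e; field; lra.
rewrite h2; lra.
Qed.

Lemma excess_energy_sub th (D p f psi : R -> R) : tame p -> tame f -> tame psi ->
  0 < th -> D = (fun x => 2 * th * p x + psi x) -> kr psi f <= kr psi p ->
  th * (kr f f + kr p p - 2 * kr f p) <=
  (th * kr f f - kr D f) - (th * kr p p - kr D p).
Proof.
move=> cp cf cpsi th0 -> h.
have th2 : 0 <= 2 * th by lra.
have ctp : tame (fun x => 2 * th * p x) by exact: tameZ.
rewrite !krDl// !krZl// (@kr_sym f p); try exact: tame_nnm.
lra.
Qed.

Lemma excess_energy_add th (D p f psi : R -> R) : tame D -> tame p -> tame f -> tame psi ->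
  0 < th -> (fun x => 2 * th * p x) = (fun x => D x + psi x) -> kr psi p <= kr psi f ->
  th * (kr f f + kr p p - 2 * kr f p) <=
  (th * kr f f - kr D f) - (th * kr p p - kr D p).
Proof.
move=> cD cp cf cpsi th0 E h.
have th2 : 0 <= 2 * th by lra.
have e1 : 2 * th * kr p f = kr D f + kr psi f by rewrite -krZl// E krDl.
have e2 : 2 * th * kr p p = kr D p + kr psi p by rewrite -krZl// E krDl.
rewrite (@kr_sym f p); try exact: tame_nnm.
lra.
Qed.

End tame_densities.


Section minimizer.
Context {R : realType}.
Local Notation mu := (@lebesgue_measure R).
Implicit Types (f g p : R -> R) (a b c x y s t theta M A : R).

Definition capped theta s f : Prop :=
  [/\ nnm f, forall y, f y <= theta^-1, forall y, f y != 0 -> 0 < y < s &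
      (\int[mu]_y (f y)%:E = 1)%E].

Definition box A : R -> R := \1_(`]0, A[).

Lemma nnm_box A : nnm (box A).
Proof. by apply: nnm_indic; exact: measurable_itv. Qed.

Lemma box_in A y : 0 < y < A -> box A y = 1.
Proof. by move=> h; rewrite /box indicE mem_set//= in_itv. Qed.

Lemma box_out A y : ~~ (0 < y < A) -> box A y = 0.
Proof. by move=> h; rewrite /box indicE memNset//= in_itv/=; exact/negP. Qed.

Lemma box_mass A : 0 < A -> (\int[mu]_y (box A y)%:E = A%:E)%E.
Proof.
move=> A0; rewrite integral_indic ?setIT /=; [|by []|exact: measurable_itv].
by rewrite lebesgue_measure_itv/= lte_fin A0 -EFinD subr0.
Qed.

Lemma tame_box A : 0 < A -> tame A (box A).
Proof.
move=> A0; apply: (@tame_bounded _ _ A0 _ 1); first exact: nnm_box.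
  by move=> y; rewrite /box indicE; case: (_ \in _).
by rewrite box_mass// ltry.
Qed.

Lemma capped_tame theta s A f : 0 < A -> capped theta s f -> tame A f.
Proof.
by move=> A0 [nf fb _ mf]; apply: (tame_bounded A0 nf fb); rewrite mf ltry.
Qed.

Lemma capped_mass theta s f : capped theta s f -> mass f = 1.
Proof. by move=> [_ _ _ mf]; rewrite /mass mf. Qed.

Lemma capped_widen theta s t f : s <= t -> capped theta s f -> capped theta t f.
Proof.
move=> st [nf fb fs mf]; split => // y /fs /andP[y0 ys].
by rewrite y0 (lt_le_trans ys).
Qed.

Lemma minimizer M theta : 0 < M -> 0 < theta ->
  let A := M + theta in let r := Num.sqrt (M * theta) in
  exists p, [/\ capped theta A p,
    forall f, capped theta A f ->
      theta * (kr A f f + kr A p p - 2 * kr A f p) <=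
      (theta * kr A f f - kr A (box A) f) - (theta * kr A p p - kr A (box A) p),
    M < theta -> forall y, 0 < y < A -> 0 < p y &
    theta <= M -> (forall y, `|y - A / 2| < r -> 0 < p y) /\
                  (forall y, r <= `|y - A / 2| -> p y = 0)].
Proof.
move=> M0 th0 A r.
have A0 : 0 < A by rewrite /A; lra.
pose h := A / 2.
have Ah : A = 2 * h by rewrite /h; field.
have Mth : 0 < M * theta by rewrite mulr_gt0.
have r2 : r ^+ 2 = M * theta by rewrite sqr_sqrtr// ltW.
have r0 : 0 < r by rewrite sqrtr_gt0.
pose w := `|M - theta| / 2.
have w0 : 0 <= w by rewrite divr_ge0.
have wh : w < h.
  rewrite /w /h /A ltr_pM2r// ltr_norml; apply/andP; split; lra.
have hw : h ^+ 2 - w ^+ 2 = r ^+ 2.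
  by rewrite /w [X in _ - X]exprMn real_normK ?num_real// r2 /h /A; field.
pose psi y := saturated h w (y - h).
have ns : nnm (saturated h w) by exact: nnm_saturated.
have npsi : nnm psi by exact: nnm_shift.
have psi1 y : psi y <= 1 by exact: saturated_le1.
have mpsi : (\int[mu]_y (psi y)%:E = (2 * w)%:E)%E.
  by rewrite integral_shiftT// saturated_mass.
have cpsi : tame A psi by apply: (tame_bounded A0 npsi psi1); rewrite mpsi ltry.
have potE x : pot A psi x = pot (2 * h) (saturated h w) (x - h) by rewrite pot_shift// Ah.
pose kap := fine (pot (2 * h) (saturated h w) 0).
have kapE : (kap%:E = pot (2 * h) (saturated h w) 0)%E.
  rewrite /kap fineK// ge0_fin_numE; last exact: pot_ge0.
  have h0 : 0 < 2 * h by rewrite -Ah.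
  exact: le_lt_trans (pot_bounded 0 h0 ns (fun y => saturated_le1 h w y)) (ltry _).
have kap0 : 0 <= kap by rewrite -lee_fin kapE pot_ge0.
have sq_r x : (x ^+ 2 <= r ^+ 2) = (`|x| <= r).
  by rewrite -(real_normK (num_real x)) ler_pXn2r// ?nnegrE// ltW.
have pot_in x : `|x - h| <= r -> pot A psi x = kap%:E.
  by move=> xr; rewrite potE kapE pot_saturated_const// hw sq_r.
have pot_le x : (pot A psi x <= kap%:E)%E by rewrite potE kapE pot_saturated_le.
have in_h y : (0 < y < A) = (`|y - h| < h).
  by rewrite ltr_norml Ah; apply/idP/idP => /andP[h1 h2]; apply/andP; split; lra.
have psi_out y : ~~ (0 < y < A) -> psi y = 0.
  by rewrite in_h -leNgt => yh; rewrite /psi saturated_out.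
have psi_sat y : 0 < y < A -> r <= `|y - h| -> psi y = 1.
  rewrite in_h => yh yr; rewrite /psi saturated_eq1// hw.
  by rewrite -(real_normK (num_real (y - h))) ler_pXn2r// nnegrE// ltW.
have psi_lt y : `|y - h| < r -> psi y < 1.
  move=> yr; apply: saturated_lt1 => //.
  by rewrite hw -(real_normK (num_real (y - h))) ltr_pXn2r// nnegrE// ltW.
have rh : r <= h.
  rewrite -(@ler_pXn2r _ 2) ?nnegrE ?(ltW r0) ?divr_ge0 ?(ltW A0)//.
  by rewrite -hw lerBlDr lerDl sqr_ge0.
have th2 : 0 < 2 * theta by lra.
have thi : 0 < theta^-1 by rewrite invr_gt0.
have half : (2 * theta)^-1 <= theta^-1 by rewrite lef_pV2 ?posrE//; lra.
have [nb [mb b0]] := (nnm_box A, nnm_box A).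
have cb := tame_box A0.
have [Mth_lt|Mth_ge] := ltP M theta.
- pose p y := (2 * theta)^-1 * (box A y + psi y).
  have p_in y : 0 < y < A -> p y = (2 * theta)^-1 * (1 + psi y) by move=> yA; rewrite /p box_in.
  have p_out y : ~~ (0 < y < A) -> p y = 0 by move=> yA; rewrite /p box_out// psi_out// addr0 mulr0.
  have capp : capped theta A p.
    split.
    + by apply: nnmM; [apply: nnm_cst; rewrite invr_ge0 ltW|exact: nnmD].
    + move=> y; have [yA|yA] := boolP (0 < y < A); last by rewrite p_out// ltW.
      rewrite p_in// (_ : theta^-1 = (2 * theta)^-1 * (1 + 1)); last by field; lra.
      by rewrite ler_pM2l ?invr_gt0// lerD2l.
    + by move=> y; apply: contraNT => yA; rewrite p_out.
    + rewrite ge0_integral_nnmZ ?invr_ge0 ?(ltW th2)//; last exact: nnmD.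
      rewrite ge0_integral_nnmD// box_mass// mpsi -EFinD -EFinM; congr EFin.
      by rewrite /w ltr0_norm /A; [field; lra|lra].
  exists p; split => //.
  + move=> f cf; have [nf fb fs mf] := cf.
    have chf := capped_tame A0 cf; have chp := capped_tame A0 capp.
    have np : nnm p by case: capp.
    apply: (@excess_energy_add _ A theta (box A) p f psi) => //.
      by apply/funext => y; rewrite /p mulrA divff ?mul1r// gt_eqF.
    rewrite !(@kr_sym _ A psi)// -lee_fin -!krE//.
    rewrite -(@leeD2rE _ kap%:E)//.
    have -> : (kform A p psi + kap%:E = \int[mu]_x ((p x)%:E * pot A psi x + (kap * f x)%:E))%E.
      rewrite ge0_integralD//.
      * by rewrite ge0_integral_nnmZ// mf mule1.
      * by move=> x _; exact: kform_integrand_ge0.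
      * exact: measurable_kform_integrand.
      * by move=> x _; rewrite lee_fin mulr_ge0//; case: nf.
      * by apply: ((measurable_EFinP _ _).2 _); apply: measurable_funM => //; case: nf.
    have -> : (kform A f psi + kap%:E = \int[mu]_x ((f x)%:E * pot A psi x + (kap * p x)%:E))%E.
      rewrite ge0_integralD//.
      * by rewrite ge0_integral_nnmZ//; case: capp => _ _ _ ->; rewrite mule1.
      * by move=> x _; exact: kform_integrand_ge0.
      * exact: measurable_kform_integrand.
      * by move=> x _; rewrite lee_fin mulr_ge0//; case: np.
      * by apply: ((measurable_EFinP _ _).2 _); apply: measurable_funM => //; case: np.
    apply: ge0_le_integral => //.
    * move=> x _; rewrite adde_ge0 ?kform_integrand_ge0// lee_fin mulr_ge0//; by case: nf.
    * apply: emeasurable_funD; first exact: measurable_kform_integrand.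
      by apply: ((measurable_EFinP _ _).2 _); apply: measurable_funM => //; case: nf.
    * apply: emeasurable_funD; first exact: measurable_kform_integrand.
      by apply: ((measurable_EFinP _ _).2 _); apply: measurable_funM => //; case: np.
    * move=> x _; have [xr|xr] := leP `|x - h| r.
        by rewrite pot_in// -!EFinM -!EFinD lee_fin; lra.
      have pf : f x <= p x.
        have [xA|xA] := boolP (0 < x < A).
          rewrite p_in// psi_sat// ?(ltW xr)//.
          by apply: le_trans (fb x) _; rewrite le_eqVlt; apply/orP; left; apply/eqP; field; lra.
        rewrite p_out//; have [->//|/fs] := eqVneq (f x) 0; by rewrite (negbTE xA).
      have := pot_le x; have := pot_ge0 A x npsi.
      case: (pot A psi x) => [u| |]// u0 uk; move: u0 uk; rewrite !lee_fin => u0 uk.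
      by nra.
  + move=> _ y yA; rewrite p_in// mulr_gt0 ?invr_gt0//.
    by have [_ ps0] := npsi; have := ps0 y; lra.
- pose p y := (2 * theta)^-1 * (box A y - psi y).
  have p_in y : 0 < y < A -> p y = (2 * theta)^-1 * (1 - psi y) by move=> yA; rewrite /p box_in.
  have p_out y : ~~ (0 < y < A) -> p y = 0 by move=> yA; rewrite /p box_out// psi_out// subr0 mulr0.
  have pE : box A = (fun y => 2 * theta * p y + psi y).
    by apply/funext => y; rewrite /p mulrA divff ?mul1r ?subrK// gt_eqF.
  have np : nnm p.
    split; first by apply: measurable_funM => //; apply: measurable_funB; [case: nb|case: npsi].
    move=> y; have [yA|yA] := boolP (0 < y < A); last by rewrite p_out.
    by rewrite p_in// mulr_ge0 ?invr_ge0 ?(ltW th2)// subr_ge0.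
  have p_sat y : r <= `|y - h| -> p y = 0.
    move=> yr; have [yA|yA] := boolP (0 < y < A); last by rewrite p_out.
    by rewrite p_in// psi_sat// subrr mulr0.
  have capp : capped theta A p.
    split => //.
    + move=> y; have [yA|yA] := boolP (0 < y < A); last by rewrite p_out// ltW.
      rewrite p_in//; apply: le_trans half; rewrite ler_piMr ?invr_ge0 ?(ltW th2)//.
      by have [_ ps0] := npsi; have := ps0 y; lra.
    + by move=> y; apply: contraNT => yA; rewrite p_out.
    + have := box_mass A0; rewrite pE ge0_integral_nnmD//; last first.
        by apply: nnmM => //; apply: nnm_cst; rewrite ltW.
      rewrite ge0_integral_nnmZ ?(ltW th2)// mpsi.
      have : (\int[mu]_x (p x)%:E < +oo)%E.
        apply: (@le_lt_trans _ _ (\int[mu]_x (((2 * theta)^-1 * box A x)%:E))%E).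
          apply: le_integral_nnm => //.
            by apply: nnmM => //; apply: nnm_cst; rewrite invr_ge0 ltW.
          move=> x; rewrite /p ler_wpM2l ?invr_ge0 ?(ltW th2)//.
          by have [_ ps0] := npsi; have := ps0 x; lra.
        by rewrite ge0_integral_nnmZ ?invr_ge0 ?(ltW th2)// box_mass// -EFinM ltry.
      have := nnm_mass_ge0 np.
      case: (\int[mu]_x (p x)%:E)%E => [u| |]// _ _.
      rewrite -EFinM -EFinD => -[]; rewrite /w ger0_norm; last lra.
      move=> e; congr EFin; apply: (mulfI (gt_eqF th2)) || idtac.
      apply: (@mulfI _ (2 * theta)); first by rewrite gt_eqF.
      by rewrite /A in e *; lra.
  exists p; split => //.
  + move=> f cf; have [nf fb fs mf] := cf.
    have chf := capped_tame A0 cf; have chp := capped_tame A0 capp.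
    apply: (@excess_energy_sub _ A theta (box A) p f psi) => //.
    rewrite !(@kr_sym _ A psi)//.
    apply: (@le_trans _ _ kap).
      have := kr_le_pot chf cpsi kap0 (fun x _ => pot_le x).
      by rewrite (capped_mass cf) mulr1.
    have := @kr_ge_pot _ A p psi kap chp cpsi kap0; rewrite (capped_mass capp) mulr1; apply.
    move=> x px; rewrite pot_in//; rewrite leNgt; apply/negP => xr.
    by move/eqP: px; apply; apply: p_sat; exact: ltW.
  + move=> _; split; last exact: p_sat.
    move=> y yr; rewrite p_in; last by rewrite in_h (lt_le_trans yr).
    by rewrite mulr_gt0 ?invr_gt0// subr_gt0 psi_lt.
Qed.

End minimizer.


Section gap.
Context {R : realType}.
Local Notation mu := (@lebesgue_measure R).
Implicit Types (f g p : R -> R) (a b c x y s t theta M A : R).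

Lemma kr_gap theta A t a b p : 0 < theta -> 0 < t -> t <= a -> a < b -> b <= A ->
  capped theta A p -> (forall y, a < y < b -> 0 < p y) ->
  exists2 d, 0 < d &
    forall f, capped theta t f -> d <= kr A f f + kr A p p - 2 * kr A f p.
Proof.
move=> th0 t0 ta ab bA capp ppos; have A0 : 0 < A by lra.
have tp := capped_tame A0 capp; have [np _ _] := tp.
pose rho := t / 2.
have r0 : 0 < rho by rewrite /rho; lra.
have r2 : 2 * rho = t by rewrite /rho; field.
have rA : 2 * rho <= A by lra.
have [kap [kap0 kc kle kst]] := arcsine_potential r0 rA.
pose tau y := arcsine (rho ^+ 2) (y - rho).
have na : nnm (arcsine (rho ^+ 2)) by exact: nnm_arcsine.
have nt : nnm tau by exact: nnm_shift.
have mt : (\int[mu]_y (tau y)%:E = 1)%E by rewrite integral_shiftT// arcsine_mass.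
have potE x : pot A tau x = pot A (arcsine (rho ^+ 2)) (x - rho) by rewrite pot_shift.
have tt : tame A tau.
  split => //; first by rewrite mt ltry.
  by exists kap => x; rewrite potE.
have mt1 : mass tau = 1 by rewrite /mass mt.
have kTT : kr A tau tau <= kap.
  have := @kr_le_pot _ A tau tau kap tt tt kap0; rewrite mt1 mulr1; apply.
  by move=> x _; rewrite potE.
have kfT f : capped theta t f -> kr A f tau = kap.
  move=> cf; have tf := capped_tame A0 cf; have mf := capped_mass cf.
  have pE x : f x != 0 -> pot A tau x = kap%:E.
    case: cf => _ _ fs _ /fs /andP[x0 xt]; rewrite potE kc// ler_norml.
    by apply/andP; split; lra.
  apply/eqP; rewrite eq_le; apply/andP; split.
    by have := @kr_le_pot _ A f tau kap tf tt kap0; rewrite mf mulr1; apply => x /pE ->.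
  by have := @kr_ge_pot _ A f tau kap tf tt kap0; rewrite mf mulr1; apply => x /pE ->.
(* the part of p beyond t feels a strictly smaller potential *)
pose L x : R := if t < x then ln (1 + (x - t) / t) else 0.
have L0 x : 0 <= L x.
  rewrite /L; case: ifP => // tx; apply: ln_ge0; rewrite lerDl divr_ge0//; lra.
have mL : measurable_fun setT L.
  apply: measurable_fun_ifT => //; first by apply: measurable_fun_ltr.
  apply: (measurableT_comp (@measurable_ln R)); apply: measurable_funD => //.
  by apply: measurable_funM => //; apply: measurable_funB.
have npL : nnm (fun x => p x * L x) by apply: nnmM.
have potL x : p x != 0 -> (pot A tau x + (L x)%:E <= kap%:E)%E.
  case: capp => _ _ ps _ /ps /andP[x0 xA]; rewrite /L; case: ifP => tx; last by rewrite adde0 potE.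
  rewrite potE; have := kst (x - rho); rewrite r2.
  have -> : x - rho - rho = x - t by lra.
  by apply; lra.
have I_gt0 : (0 < \int[mu]_x (p x * L x)%:E)%E.
  pose D : set R := [set` `]a, b[].
  have nD : nnm (\1_D : R -> R) by apply: nnm_indic; exact: measurable_itv.
  apply: (@lt_le_trans _ _ (\int[mu]_(x in D) (p x * L x)%:E)%E).
    apply: ge0_integral_gt0.
    - exact: measurable_itv.
    - by apply: measurable_funTS; apply: ((measurable_EFinP _ _).2 _); case: npL.
    - move=> x; rewrite /D/= in_itv/= => xab; rewrite lte_fin mulr_gt0 ?ppos//.
      have [ax xb] := andP xab; have tx : t < x by apply: le_lt_trans ta ax.
      by rewrite /L tx; apply: ln_gt0; rewrite ltrDl divr_gt0// subr_gt0.
    - by rewrite lebesgue_measure_itv/= lte_fin ab -EFinD lte_fin subr_gt0.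
  apply: ge0_subset_integral => //.
  - exact: measurable_itv.
  - by apply: ((measurable_EFinP _ _).2 _); case: npL.
  - by move=> x _; rewrite lee_fin; case: npL.
have sum_le : (kform A p tau + \int[mu]_x (p x * L x)%:E <= kap%:E)%E.
  have -> : (kap%:E = \int[mu]_x (kap * p x)%:E)%E.
    by rewrite ge0_integral_nnmZ//; case: capp => _ _ _ ->; rewrite mule1.
  rewrite -ge0_integralD//; first last.
  - by apply: ((measurable_EFinP _ _).2 _); case: npL.
  - by move=> x _; rewrite lee_fin; case: npL.
  - exact: measurable_kform_integrand.
  - by move=> x _; exact: kform_integrand_ge0.
  apply: ge0_le_integral => //.
  - by move=> x _; rewrite adde_ge0 ?kform_integrand_ge0// lee_fin; case: npL.
  - apply: emeasurable_funD; first exact: measurable_kform_integrand.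
    by apply: ((measurable_EFinP _ _).2 _); case: npL.
  - by apply: ((measurable_EFinP _ _).2 _); apply: measurable_funM => //; case: np.
  - move=> x _; have [->|px] := eqVneq (p x) 0; first by rewrite !mul0e mul0r mulr0 adde0.
    rewrite EFinM -ge0_muleDr ?lee_fin ?L0 ?pot_ge0// mulrC EFinM.
    by apply: lee_wpmul2l; [rewrite lee_fin; case: np|exact: potL].
have e0 : 0 < kap - kr A p tau.
  rewrite subr_gt0 -lte_fin -krE//; apply: lt_le_trans sum_le.
  by rewrite lteDl// krE.
have kp0 : 0 <= kr A p tau by exact: kr_ge0.
have kapgt0 : 0 < kap by lra.
exists ((kap - kr A p tau) ^+ 2 / kap); first by rewrite divr_gt0// exprn_gt0.
move=> f cf; apply: kr_separation => //.
- exact: capped_tame cf.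
- exact: kfT.
- by rewrite -subr_ge0 ltW.
Qed.

End gap.

Section energy_functional.
Context {R : realType}.
Local Notation mu := (@lebesgue_measure R).
Variables (M theta : R).
Hypotheses (M0 : 0 < M) (th0 : 0 < theta).
Let A : R := M + theta.
Implicit Types (f g p phi : R -> R) (a b c x y s t : R).

Let A0 : 0 < A. Proof. by rewrite /A addr_gt0. Qed.

Lemma integrable_nnm (D : set R) f : measurable D -> nnm f ->
  (\int[mu]_x (f x)%:E < +oo)%E -> mu.-integrable D (EFin \o f).
Proof.
move=> mD [mf f0] fi; apply: (@integrableS _ _ _ mu setT) => //.
apply/integrableP; split; first exact: ((measurable_EFinP _ _).2 mf).
apply: le_lt_trans fi; rewrite le_eqVlt; apply/orP; left; apply/eqP.
by apply: eq_integral => x _; rewrite /= ger0_norm.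
Qed.

Lemma nnm_integral_supp (D : set R) f : (forall y, f y != 0 -> D y) ->
  (\int[mu]_(y in D) (f y)%:E = \int[mu]_y (f y)%:E)%E.
Proof.
move=> fD; rewrite integral_mkcond; apply: eq_integral => y _; rewrite patchE.
case: ifPn => // yD; have [->//|/fD] := eqVneq (f y) 0.
by move=> Dy; move: yD; rewrite notin_setE.
Qed.

Lemma Rintegral_affine (D : set R) c f u m k : measurable D -> nnm f -> nnm u ->
  (forall y, f y != 0 -> D y) ->
  (\int[mu]_y (f y)%:E = m%:E)%E -> (\int[mu]_y (u y * f y)%:E = k%:E)%E ->
  mu.-integrable D (EFin \o (fun y => (c - u y) * f y)) /\
  (\int[mu]_(y in D) ((c - u y) * f y) = c * m - k)%R.
Proof.
move=> mD nf nu fD fm uk.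
have if_ : mu.-integrable D (EFin \o f) by apply: integrable_nnm => //; rewrite fm ltry.
have iuf : mu.-integrable D (EFin \o (fun y => u y * f y)).
  by apply: integrable_nnm => //; [exact: nnmM|rewrite uk ltry].
have icf : mu.-integrable D (EFin \o (fun y => c * f y)).
  exact: (@integrableZl _ _ _ mu D mD c (EFin \o f) if_).
have ufD y : u y * f y != 0 -> D y by rewrite mulf_eq0 negb_or => /andP[_ /fD].
have -> : (fun y => (c - u y) * f y) = (fun y => c * f y - u y * f y).
  by apply/funext => y; rewrite mulrBl.
split; first exact: (@integrableB _ _ _ mu D mD _ _ icf iuf).
have -> := @RintegralB _ _ _ mu D (fun y => c * f y) (fun y => u y * f y) mD icf iuf.
have -> := @RintegralZl _ _ _ mu D f c mD if_; rewrite /Rintegral.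
by rewrite (nnm_integral_supp fD) fm (nnm_integral_supp ufD) uk.
Qed.

Lemma ae_imp (P Q : R -> Prop) : (forall x, P x -> Q x) ->
  {ae mu, forall x, P x} -> {ae mu, forall x, Q x}.
Proof.
by move=> PQ [N [mN N0 sub]]; exists N; split => // x /= nQ; apply: sub => /= /PQ.
Qed.

Lemma ae_and (P Q : R -> Prop) : {ae mu, forall x, P x} -> {ae mu, forall x, Q x} ->
  {ae mu, forall x, P x /\ Q x}.
Proof.
move=> [N [mN N0 sub]] [N' [mN' N0' sub']]; exists (N `|` N'); split.
- exact: measurableU.
- by apply: null_set_setU.
- move=> x /= /not_andP[h|h]; [left; exact: sub|right; exact: sub'].
Qed.

Lemma ae_neq c : {ae mu, forall x : R, x != c}.
Proof.
exists [set c]; split; [exact: measurable_set1|exact: lebesgue_measure_set1|].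
by move=> x /= /negP; rewrite negbK => /eqP.
Qed.

Lemma potential_pot x : 0 <= x <= A ->
  (pot A (box A) x = (A * ln A + A - potential M theta x)%:E)%E.
Proof.
move=> xA.
have pI (D : set R) : (pot A (\1_D) x = \int[mu]_(y in D) (lk A x y)%:E)%E.
  rewrite [RHS]integral_mkcond; apply: eq_integral => y _.
  by rewrite patchE indicE; case: ifP => _; rewrite ?mulr1 ?mulr0.
have mlk (D : set R) : measurable_fun D (fun y : R => (lk A x y)%:E).
  by apply: measurable_funTS; exact: measurable_elk.
rewrite /box pI -(@integral_itv_bndoo _ 0 A _ true false)// -pI pot_itv//; [|lra|lra].
by congr EFin; rewrite subr0 /logarea /potential -/A; ring.
Qed.

Let V := potential M theta.
Let c0 : R := - theta * ln A + (A * ln A + A).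

Lemma inner_integral s phi f x : s <= A -> measurable_fun `[0, s] phi ->
  capped theta s f -> {ae mu, forall y, y \in `[0, s] -> phi y = f y} ->
  x \in `[0, s] ->
  (\int[mu]_(y in `[0, s]) (ln `|x - y| * phi x * phi y))%R =
  phi x * (ln A - fine (pot A f x)).
Proof.
move=> sA mphi cf aef xs; have tf := capped_tame A0 cf.
have [nf fb fs mf] := cf; have [mfu f0] := nf.
have mln : measurable_fun setT (fun y : R => ln `|x - y|).
  apply: (measurableT_comp (@measurable_ln R)).
  apply: (measurableT_comp (@normr_measurable R setT)).
  exact: measurable_funB.
have fD y : f y != 0 -> `[0, s]%classic y.
  by move=> /fs /andP[y0 ys]; rewrite /= in_itv/= !ltW.
have -> : (\int[mu]_(y in `[0, s]) (ln `|x - y| * phi x * phi y))%R =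
    (\int[mu]_(y in `[0, s]) (phi x * (ln `|x - y| * f y)))%R.
  rewrite /Rintegral; congr fine; apply: ae_eq_integral => //.
  - apply: ((measurable_EFinP _ _).2 _); apply: measurable_funM => //.
    by apply: measurable_funM => //; exact: measurable_funTS.
  - apply: ((measurable_EFinP _ _).2 _); apply: measurable_funTS.
    by apply: measurable_funM => //; exact: measurable_funM.
  - by apply: ae_imp aef => y h ys; rewrite h ?inE//; congr EFin; ring.
have [c [c0' fc]] := tame_pot tf.
have pfin : (\int[mu]_y (lk A x y * f y)%:E = (fine (pot A f x))%:E)%E.
  by rewrite fineK// ge0_fin_numE ?pot_ge0// (le_lt_trans (fc x))// ltry.
have [int1 aff] := @Rintegral_affine `[0, s]%classic (ln A) f (lk A x) 1
  (fine (pot A f x)) (measurable_itv _) nf (nnm_lk A x) fD mf pfin.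
have -> : (\int[mu]_(y in `[0, s]) (phi x * (ln `|x - y| * f y)))%R =
   (\int[mu]_(y in `[0, s]) (phi x * ((ln A - lk A x y) * f y)))%R.
  rewrite /Rintegral; congr fine; apply: (@integral_off_point _ _ x) => //.
    apply: ((measurable_EFinP _ _).2 _); apply: measurable_funTS.
    by apply: measurable_funM => //; exact: measurable_funM.
  move=> y; rewrite /= in_itv/= => /andP[y0 ys] yx; congr (_ * (_ * _))%:E.
  move: xs; rewrite in_itv/= => /andP[x0 xs].
  have d0 : 0 < `|x - y| by rewrite normr_gt0 subr_eq0 eq_sym.
  have dA : `|x - y| <= A by rewrite ler_norml; apply/andP; split; lra.
  rewrite /lk max_r ?ln_div ?posrE//; first by lra.
  by rewrite subr_ge0 ler_ln ?posrE.
have -> := @RintegralZl _ _ _ mu `[0, s]%classic _ (phi x) (measurable_itv _) int1.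
by rewrite aff mulr1.
Qed.

Lemma energyE s phi f : s <= A -> measurable_fun `[0, s] phi ->
  capped theta s f -> {ae mu, forall y, y \in `[0, s] -> phi y = f y} ->
  energy theta s V phi = c0 + (theta * kr A f f - kr A (box A) f).
Proof.
move=> sA mphi cf aef; have tf := capped_tame A0 cf.
have [nf fb fs mf] := cf; have [mfu f0] := nf.
have tb := tame_box A0.
have fD y : f y != 0 -> `[0, s]%classic y.
  by move=> /fs /andP[y0 ys]; rewrite /= in_itv/= !ltW.
have pfin g x : tame A g -> (pot A g x)%E = (fine (pot A g x))%:E.
  move=> tg; have [c [_ gc]] := tame_pot tg.
  have p0 := pot_ge0 A x (tame_nnm tg); have plt := le_lt_trans (gc x) (ltry c).
  by rewrite fineK // ge0_fin_numE.
have nnfine g : tame A g -> nnm (fun x => fine (pot A g x)).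
  move=> tg; have ng := tame_nnm tg; split; last by move=> x; rewrite fine_ge0// pot_ge0.
  by apply: measurableT_comp => //; exact: measurable_pot.
have aff c g : tame A g -> (\int[mu]_(x in `[0, s]) ((c - fine (pot A g x)) * f x))%R =
    c - kr A f g.
  move=> tg; have kfg : (\int[mu]_x (fine (pot A g x) * f x)%:E = (kr A f g)%:E)%E.
    rewrite -krE//; apply: eq_integral => x _.
    by rewrite mulrC EFinM -pfin.
  have [_ ->] := @Rintegral_affine `[0, s]%classic c f _ 1 _ (measurable_itv _) nf (nnfine g tg) fD mf kfg.
  by rewrite mulr1.
have mu_f g : tame A g -> measurable_fun `[0, s]%classic (fun x => fine (pot A g x)).
  by move=> tg; apply: measurable_funTS; case: (nnfine g tg).
have e1 : (\int[mu]_(x in `[0, s]) \int[mu]_(y in `[0, s]) (ln `|x - y| * phi x * phi y))%R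
    = ln A - kr A f f.
  rewrite -aff//.
  transitivity (\int[mu]_(x in `[0, s]) (phi x * (ln A - fine (pot A f x))))%R.
    by apply: eq_Rintegral => x xs; apply: inner_integral => //; move: xs; rewrite inE.
  rewrite /Rintegral; congr fine; apply: ae_eq_integral => //.
  - apply: ((measurable_EFinP _ _).2 _); apply: measurable_funM => //.
    by apply: measurable_funB => //; exact: mu_f.
  - apply: ((measurable_EFinP _ _).2 _); apply: measurable_funM; last exact: measurable_funTS.
    by apply: measurable_funB => //; exact: mu_f.
  - by apply: ae_imp aef => y h ys; rewrite h ?inE// mulrC.
have e2 : (\int[mu]_(x in `[0, s]) (V x * phi x))%R = A * ln A + A - kr A f (box A).
  rewrite -aff//.
  transitivity (\int[mu]_(x in `[0, s]) ((A * ln A + A - fine (pot A (box A) x)) * phi x))%R.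
    apply: eq_Rintegral => x; rewrite inE/= in_itv/= => /andP[x0 xs].
    by rewrite potential_pot ?x0 ?(le_trans xs)//= /V; congr (_ * _); lra.
  rewrite /Rintegral; congr fine; apply: ae_eq_integral => //.
  - apply: ((measurable_EFinP _ _).2 _); apply: measurable_funM => //.
    by apply: measurable_funB => //; exact: mu_f.
  - apply: ((measurable_EFinP _ _).2 _); apply: measurable_funM; last exact: measurable_funTS.
    by apply: measurable_funB => //; exact: mu_f.
  - by apply: ae_imp aef => y h ys; rewrite h ?inE.
rewrite /energy e1 e2 (@kr_sym _ A f (box A))//; last exact: nnm_box.
by rewrite /c0; ring.
Qed.

Lemma capped_admissible s f : s <= A -> capped theta s f ->
  admissible theta s f.
Proof.
move=> sA cf; have [nf fb fs mf] := cf; have [mfu f0] := nf.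
have fD y : f y != 0 -> `[0, s]%classic y.
  by move=> /fs /andP[y0 ys]; rewrite /= in_itv/= !ltW.
split.
- by apply: integrable_nnm => //; rewrite mf ltry.
- exists set0; split => // x /= h; apply: h => _; by rewrite f0 fb.
- by rewrite /Rintegral (nnm_integral_supp fD) mf.
Qed.

Lemma admissible_capped s phi : admissible theta s phi ->
  exists f, [/\ capped theta s f, measurable_fun `[0, s] phi &
    {ae mu, forall y, y \in `[0, s] -> phi y = f y}].
Proof.
move=> [iphi aephi mphi].
have mph : measurable_fun `[0, s] phi.
  by apply: ((measurable_EFinP _ _).1 _); case/integrableP : iphi.
pose D : set R := [set` `[0, s]].
pose g x := Num.max 0 (Num.min theta^-1 ((phi \_ D) x)).
pose f x := g x * \1_(`]0, s[) x.
have mg : measurable_fun setT g.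
  apply: measurable_maxr => //; apply: measurable_minr => //.
  exact: ((measurable_restrictT _ (measurable_itv _)).1 mph).
have g0 x : 0 <= g x by rewrite /g le_max lexx.
have thi : 0 < theta^-1 by rewrite invr_gt0.
have gb x : g x <= theta^-1 by rewrite /g ge_max ge_min lexx (ltW thi).
have nf : nnm f.
  apply: nnmM; first by split.
  by apply: nnm_indic; exact: measurable_itv.
have aef : {ae mu, forall y, y \in `[0, s] -> phi y = f y}.
  apply: ae_imp (ae_and aephi (ae_and (ae_neq 0) (ae_neq s))) => y [h [y0 ys]] yI.
  have /andP[h1 h2] := h yI.
  rewrite /f indicE mem_set.
    by rewrite mulr1 /g patchE mem_set// min_r// max_r.
  move: yI; rewrite /= !in_itv/= => /andP[h3 h4].
  by rewrite !lt_neqAle eq_sym y0 h3 ys h4.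
exists f; split => //; split => //.
- move=> y; rewrite /f indicE; case: (_ \in _); by rewrite ?mulr1 ?mulr0// ltW.
- move=> y; rewrite /f indicE; case: (boolP (y \in _)) => yI; last by rewrite mulr0 eqxx.
  by move: yI; rewrite inE/= in_itv.
- have fD y : f y != 0 -> D y.
    rewrite /f indicE; case: (boolP (y \in _)) => yI; last by rewrite mulr0 eqxx.
    by move: yI; rewrite inE/= /D/= !in_itv/= => /andP[h1 h2] _; rewrite !ltW.
  rewrite -(nnm_integral_supp fD).
  have : (\int[mu]_(y in D) phi y = \int[mu]_(y in D) f y)%R.
    rewrite /Rintegral; congr fine; apply: ae_eq_integral => //.
    - exact: measurable_itv.
    - exact: ((measurable_EFinP _ _).2 mph).
    - by apply: ((measurable_EFinP _ _).2 _); apply: measurable_funTS; case: nf.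
    - by apply: ae_imp aef => y h ys; rewrite h.
  rewrite mphi /Rintegral.
  have := @integral_ge0 _ _ _ mu D (fun y => (f y)%:E) (fun y _ => _).
  case: (\int[mu]_(y in D) (f y)%:E)%E => [u| |] _ /= h; [by rewrite h| |].
    by move/eqP: h; rewrite oner_eq0.
  by move/eqP: h; rewrite oner_eq0.
Qed.

Let EE f : R := c0 + (theta * kr A f f - kr A (box A) f).

Let EE_lb s f : s <= A -> capped theta s f -> c0 - 2 * A <= EE f.
Proof.
move=> sA cf; have tf := capped_tame A0 cf; rewrite /EE lerD2l.
have h1 : 0 <= kr A f f by apply: kr_ge0; exact: tame_nnm tf.
have h2 : kr A f (box A) <= 2 * A.
  have A20 : 0 <= 2 * A by have := A0; lra.
  have := kr_le_pot tf (tame_box A0) A20; rewrite (capped_mass cf) mulr1; apply.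
  move=> x _; rewrite -[2 * A]mulr1; apply: (pot_bounded x A0 (nnm_box A)) => y.
  by rewrite /box indicE; case: (_ \in _).
rewrite (@kr_sym _ A (box A) f (nnm_box A) (tame_nnm tf)).
by have := mulr_ge0 (ltW th0) h1; lra.
Qed.

Lemma F_le s f : s <= A -> capped theta s f -> F theta s V <= EE f.
Proof.
move=> sA cf; apply: ge_inf.
  exists (c0 - 2 * A) => _ [phi /admissible_capped[g [cg mph aeg]] <-].
  by rewrite (energyE sA mph cg aeg); exact: EE_lb cg.
exists f; first exact: capped_admissible.
apply: energyE => //; first by apply: measurable_funTS; case: cf => -[].
by exists set0; split => // x /= h; apply: h.
Qed.

Lemma F_ge s B : theta <= s -> s <= A ->
  (forall f, capped theta s f -> B <= EE f) -> B <= F theta s V.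
Proof.
move=> ths sA BE; apply: lb_le_inf.
  have s0 : 0 < s by exact: lt_le_trans th0 ths.
  have cf : capped theta s (fun x => s^-1 * box s x).
    split.
    - by apply: nnmM; [apply: nnm_cst; rewrite invr_ge0 ltW|exact: nnm_box].
    - move=> y; apply: (@le_trans _ _ (s^-1 * 1)).
        rewrite ler_wpM2l ?invr_ge0 ?(ltW s0)// /box indicE; by case: (_ \in _).
      by rewrite mulr1 lef_pV2.
    - move=> y; apply: contraNT => h; by rewrite box_out// mulr0.
    - rewrite ge0_integral_nnmZ ?invr_ge0 ?(ltW s0)//; last exact: nnm_box.
      by rewrite box_mass// -EFinM mulVf// gt_eqF.
  by exists (energy theta s V (fun x => s^-1 * box s x)); exists (fun x => s^-1 * box s x) => //;
    exact: capped_admissible.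
move=> _ [phi /admissible_capped[g [cg mph aeg]] <-].
by rewrite (energyE sA mph cg aeg); exact: BE.
Qed.

End energy_functional.


Section rate_comparison.
Context {R : realType}.
Implicit Types (f g p : R -> R) (a b c x y s t theta M A : R).

Lemma F_compare M theta : 0 < M -> 0 < theta ->
  let FV s := F theta s (potential M theta) in
  let edge := (M + theta) / 2 + Num.sqrt (M * theta) in
  (M < theta -> forall t, theta <= t < M + theta -> FV (M + theta) < FV t) /\
  (theta <= M ->
    (forall t, theta <= t < edge -> FV (M + theta) < FV t) /\
    (forall t, edge <= t <= M + theta -> FV t = FV (M + theta))).
Proof.
move=> M0 th0 FV edge.
have [p [capp minp psmall plarge]] := minimizer M0 th0.
set A := M + theta in capp minp psmall plarge *.
set r := Num.sqrt (M * theta) in plarge edge *.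
have A0 : 0 < A by rewrite /A addr_gt0.
have tp := capped_tame A0 capp.
pose E f := - theta * ln A + (A * ln A + A) + (theta * kr A f f - kr A (box A) f).
have Egap f : capped theta A f -> theta * (kr A f f + kr A p p - 2 * kr A f p) <= E f - E p.
  by move=> cf; have := minp _ cf; rewrite /E; lra.
have FA : FV A = E p.
  apply/eqP; rewrite eq_le (F_le M0 th0 (lexx _) capp)/=.
  apply: (F_ge M0 th0) => //; first by rewrite /A lerDr ltW.
  move=> f cf; rewrite -subr_ge0; apply: le_trans (Egap f cf).
  rewrite mulr_ge0 ?(ltW th0)// subr_ge0.
  by apply: (kr_posdef A0) => //; exact: capped_tame cf.
have strict t a b : theta <= t -> t <= a -> a < b -> b <= A ->
    (forall y, a < y < b -> 0 < p y) -> FV A < FV t.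
  move=> tht ta ab bA pos; have t0 : 0 < t by exact: lt_le_trans th0 tht.
  have tA : t <= A by lra.
  have [d d0 dgap] := kr_gap th0 t0 ta ab bA capp pos.
  apply: (@lt_le_trans _ _ (E p + theta * d)); first by rewrite FA ltrDl mulr_gt0.
  apply: (F_ge M0 th0) => // f cf.
  have := Egap f (capped_widen tA cf); have := dgap f cf.
  rewrite -(ler_pM2l th0) => h1 h2; have := le_trans h1 h2.
  by rewrite lerBrDl.
split=> [Mth t /andP[tht tA]|thM].
  by apply: (strict t t A) => // y /andP[y1 y2]; apply: psmall => //; apply/andP; split; lra.
have [ppos pzero] := plarge thM.
have r2 : r ^+ 2 = M * theta by rewrite sqr_sqrtr// mulr_ge0 ?ltW.
have r0 : 0 < r by rewrite sqrtr_gt0 mulr_gt0.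
have rA : r <= A / 2.
  have A2 : 0 <= A / 2 by lra.
  rewrite -(@ler_pXn2r _ 2) ?nnegrE ?(ltW r0)// r2 /A.
  by have := sqr_ge0 (M - theta); nra.
split=> t /andP[t1 t2].
  have t2' : t < A / 2 + r := t2.
  apply: (strict t (Num.max t (A / 2 - r)) (A / 2 + r)) => //.
  - by rewrite le_max lexx.
  - by rewrite gt_max; apply/andP; split; lra.
  - lra.
  - move=> y; rewrite gt_max => /andP[/andP[y1 y2] y3]; apply: ppos.
    by rewrite ltr_norml; apply/andP; split; lra.
have t1' : A / 2 + r <= t := t1.
have capt : capped theta t p.
  have [np pb ps mp] := capp; split => // y py; have /andP[y0 yA] := ps y py.
  rewrite y0/=; have : ~~ (r <= `|y - A / 2|) by apply: contra py => /pzero ->.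
  by rewrite -ltNge ltr_norml => /andP[_ h]; lra.
apply/eqP; rewrite eq_le FA (F_le M0 th0 t2 capt)/= -FA.
apply: (F_ge M0 th0) => //; first by rewrite /A in rA t1' *; lra.
by move=> f cf; apply: (F_le M0 th0 (lexx _)); exact: capped_widen cf.
Qed.

End rate_comparison.


HB.lock Definition lnGamma (R : realType) (x : R) : R := ln (Gamma x).

Section gamma_function.
Context {R : realType}.
Local Notation mu := (@lebesgue_measure R).
Implicit Types (a b c d l m p q r x y z u v s t theta : R).

Definition igamma x u : R := u `^ (x - 1) * expR (- u).

Definition egamma x : \bar R := (\int[mu]_(u in `]0%R, +oo[) (igamma x u)%:E)%E.

Lemma GammaE x : Gamma x = fine (egamma x). Proof. by []. Qed.

Lemma igamma_ge0 x u : 0 <= igamma x u.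
Proof. by rewrite mulr_ge0 ?powR_ge0 ?expR_ge0. Qed.

Lemma measurable_igamma x : measurable_fun setT (igamma x).
Proof.
apply: measurable_funM; first exact: measurable_powR.
by apply: (measurableT_comp (@measurable_expR R)).
Qed.

Lemma igammaE x u : 0 < u -> igamma x u = expR ((x - 1) * ln u - u).
Proof. by move=> u0; rewrite /igamma /powR gt_eqF// -expRD. Qed.

Lemma powR_cvg0 x : 0 < x -> v `^ x @[v --> (0:R)^'+] --> (0 : R).
Proof.
move=> x0; apply/cvgrPdist_lt => e e0; near=> v.
have v0 : 0 < v by near: v; exact: nbhs_right_gt.
have ve : v < e `^ x^-1 by near: v; apply: nbhs_right_lt; exact: powR_gt0.
rewrite sub0r normrN ger0_norm ?powR_ge0//.
rewrite -[ltRHS](powRr1 (ltW e0)) -(mulVf (lt0r_neq0 x0)) powRrM.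
by apply: gt0_ltr_powR => //; rewrite nnegrE ?powR_ge0// ltW.
Unshelve. all: by end_near. Qed.

Lemma continuous_powRl x v : 0 < v -> {for v, continuous (fun v => v `^ x)}.
Proof.
move=> v0; have H := is_derive1_powR x v0.
by apply: differentiable_continuous; apply/derivable1_diffP; case: H.
Qed.

Lemma integral_powR x u : 0 < x -> 0 < u ->
  (\int[mu]_(v in `]0%R, u[) (x * v `^ (x - 1))%:E = (u `^ x)%:E)%E.
Proof.
move=> x0 u0; rewrite (@integral_itv_FTC _ _ (fun v => v `^ x))//.
- by rewrite powR0 ?subr0// gt_eqF.
- by move=> v _; rewrite mulr_ge0 ?powR_ge0// ltW.
- move=> v; rewrite in_itv/= => /andP[v0 _].
  by apply: cvgM; [exact: cvg_cst|exact: continuous_powRl].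
- move=> v; rewrite in_itv/= => /andP[v0 _]; exact: is_derive1_powR.
- apply/(continuous_within_itvP _ u0); split.
  + by move=> v; rewrite in_itv/= => /andP[v0 _]; exact: continuous_powRl.
  + by rewrite powR0 ?gt_eqF//; exact: powR_cvg0.
  + by apply: cvg_at_left_filter; exact: continuous_powRl.
Qed.

Lemma integral_expR_tail b a : 0 < b ->
  (\int[mu]_(u in `]a, +oo[) (expR (- (b * u)))%:E = (expR (- (b * a)) / b)%:E)%E.
Proof.
move=> b0.
have dF (u : R) : is_derive u (1:R) (fun u => - (expR (- (b * u)) / b)) (expR (- (b * u))).
  apply: is_derive_eq; rewrite /GRing.scale/=; field; lra.
have cf (u : R) : {for u, continuous (fun u => expR (- (b * u)))}.
  apply: continuous_comp; last exact: continuous_expR.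
  by apply: cvgN; apply: cvgM; [exact: cvg_cst|exact: cvg_id].
rewrite (@integral_itv_obnd_cbnd _ a +oo%O); last first.
  apply: ((measurable_EFinP _ _).2 _); apply: measurable_funTS.
  exact: continuous_measurable_fun.
rewrite (@ge0_continuous_FTC2y _ _ (fun u => - (expR (- (b * u)) / b)) a 0).
- by rewrite sub0e -EFinN opprK.
- by move=> u _; exact: expR_ge0.
- by apply: continuous_subspaceT.
- rewrite -oppr0; apply: cvgN; rewrite -(mul0r b^-1); apply: cvgM; last exact: cvg_cst.
  rewrite (_ : (fun u => expR (- (b * u))) = (fun z => expR (- z)) \o (fun z => b * z))//.
  apply: (@cvg_comp _ _ _ _ _ _ (pinfty_nbhs R)); last exact: cvgr_expR.
  exact: gt0_cvgMry.
- by move=> u _; case: (dF u).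
- have cF : {for a, continuous (fun u => - (expR (- (b * u)) / b))}.
    by apply: cvgN; apply: cvgM; [exact: cf|exact: cvg_cst].
  exact: cvg_at_right_filter.
- by move=> u _; rewrite derive1E derive_val.
Qed.

Lemma egammaS x : 0 < x -> (egamma (x + 1) = x%:E * egamma x)%E.
Proof.
move=> x0.
pose f u v : R := if (0 < v) && (v < u) then x * v `^ (x - 1) * expR (- u) else 0.
have f0 u v : 0 <= f u v.
  rewrite /f; case: ifP => // _; by rewrite !mulr_ge0 ?powR_ge0 ?expR_ge0// ltW.
have mf : measurable_fun setT (fun z : R * R => f z.1 z.2).
  apply: measurable_fun_ifT => //.
    apply: measurable_and; first by apply: measurable_fun_ltr.
    by apply: measurable_fun_ltr.
  apply: measurable_funM.
    by apply: measurable_funM => //; exact: (measurableT_comp (measurable_powR (x - 1))).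
  apply: (measurableT_comp (@measurable_expR R)); exact: measurableT_comp.
have := tonelli mf f0.
have -> : (\int[mu]_u \int[mu]_v (f u v)%:E = egamma (x + 1))%E.
  rewrite /egamma [RHS]integral_mkcond; apply: eq_integral => u _; rewrite patchE.
  case: ifPn; rewrite ?notin_setE ?inE/= in_itv/= andbT => u0; last first.
    rewrite integral0_eq// => v _; rewrite /f; case: ifP => // /andP[v0 vu].
    by case: u0; exact: lt_trans vu.
  rewrite /igamma addrK mulrC EFinM -(integral_powR x0 u0).
  rewrite -ge0_integralZl_EFin ?expR_ge0//; first last.
  - apply: ((measurable_EFinP _ _).2 _); apply: measurable_funTS.
    by apply: measurable_funM => //; exact: measurable_powR.
  - by move=> v _; rewrite lee_fin mulr_ge0 ?powR_ge0// ltW.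
  rewrite [RHS]integral_mkcond; apply: eq_integral => v _; rewrite patchE.
  rewrite mem_setE in_itv/= /f; case: ifP => // _.
  by rewrite -EFinM mulrC.
have -> : (\int[mu]_v \int[mu]_u (f u v)%:E = x%:E * egamma x)%E.
  rewrite /egamma -ge0_integralZl_EFin ?ltW//; first last.
  - by apply: ((measurable_EFinP _ _).2 _); apply: measurable_funTS; exact: measurable_igamma.
  - by move=> v _; rewrite lee_fin igamma_ge0.
  rewrite [RHS]integral_mkcond; apply: eq_integral => v _; rewrite patchE.
  case: ifPn; rewrite ?notin_setE ?inE/= in_itv/= andbT => v0; last first.
    by rewrite integral0_eq// => u _; rewrite /f (negbTE (introN idP v0)).
  have -> : (x%:E * (igamma x v)%:E = (x * v `^ (x - 1))%:E * (expR (- (1 * v)) / 1)%:E)%E.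
    by rewrite -!EFinM /igamma mul1r divr1 mulrA.
  rewrite -(integral_expR_tail v ltr01).
  have xv : 0 <= x * v `^ (x - 1) by rewrite mulr_ge0 ?powR_ge0// ltW.
  rewrite -ge0_integralZl_EFin//; first last.
  - apply: ((measurable_EFinP _ _).2 _); apply: measurable_funTS.
    by apply: (measurableT_comp (@measurable_expR R)); apply: measurable_funN; exact: measurable_funM.
  rewrite [RHS]integral_mkcond; apply: eq_integral => u _; rewrite patchE.
  rewrite mem_setE in_itv/= andbT /f v0/=; case: ifP => // _.
  by rewrite -EFinM mul1r.
by [].
Qed.

Lemma egamma_lb x : 0 <= x -> ((expR (x * ln x - x - 1))%:E <= egamma (x + 1))%E.
Proof.
move=> x0.
pose D : set R := [set` `]x, x + 1[].
apply: (@le_trans _ _ (\int[mu]_(u in D) (cst (expR (x * ln x - x - 1))%:E u))%E).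
  rewrite integral_cst; last exact: measurable_itv.
  rewrite /= lebesgue_measure_itv/= lte_fin ltrDl ltr01 -EFinD.
  by rewrite (_ : x + 1 - x = 1) ?mule1//; lra.
apply: (@le_trans _ _ (\int[mu]_(u in D) (igamma (x + 1) u)%:E)%E).
  apply: ge0_le_integral => //.
  - exact: measurable_itv.
  - by move=> u _; rewrite lee_fin expR_ge0.
  - by apply: ((measurable_EFinP _ _).2 _); apply: measurable_funTS; exact: measurable_igamma.
  - move=> u; rewrite /D/= in_itv/= => /andP[xu ux].
    have u0 : 0 < u by lra.
    rewrite lee_fin igammaE// ler_expR addrK.
    have : x * ln x <= x * ln u.
      have [->|xn0] := eqVneq x 0; first by rewrite !mul0r.
      have xp : 0 < x by rewrite lt_def xn0.
      by rewrite ler_wpM2l// ler_ln ?posrE// ltW.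
    lra.
apply: ge0_subset_integral => //.
- exact: measurable_itv.
- by apply: ((measurable_EFinP _ _).2 _); apply: measurable_funTS; exact: measurable_igamma.
- by move=> u _; rewrite lee_fin igamma_ge0.
- by move=> u; rewrite /D/= !in_itv/= andbT => /andP[xu ux]; exact: le_lt_trans xu.
Qed.

Lemma ln_le_tangent c u : 0 < c -> 0 < u -> ln u <= ln c + u / c - 1.
Proof.
move=> c0 u0; have -> : u = c * (1 + (u / c - 1)) by field; lra.
rewrite lnM ?posrE//; last by rewrite subrKC divr_gt0.
rewrite -!addrA lerD2l (le_trans (le_ln1Dx _))//.
  by rewrite ltrBDl subrr divr_gt0.
by rewrite subrKC mulrAC divff ?mul1r// gt_eqF.
Qed.

Lemma egamma_ub x : 0 <= x ->
  (egamma (x + 1) <= (expR (x * ln (x + 1) - x + ln (x + 1)))%:E)%E.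
Proof.
move=> x0; pose c := x + 1; have c0 : 0 < c by rewrite /c; lra.
have ci : 0 < c^-1 by rewrite invr_gt0.
pose B := expR (x * ln c - x).
have mexp : measurable_fun setT (fun u : R => expR (- (c^-1 * u))).
  by apply: (measurableT_comp (@measurable_expR R)); apply: measurable_funN; exact: measurable_funM.
apply: (@le_trans _ _ (\int[mu]_(u in `]0%R, +oo[) (B%:E * (expR (- (c^-1 * u)))%:E))%E).
  apply: ge0_le_integral => //.
  - by move=> u _; rewrite lee_fin igamma_ge0.
  - by apply: ((measurable_EFinP _ _).2 _); apply: measurable_funTS; exact: measurable_igamma.
  - by apply: ((measurable_EFinP _ _).2 _); apply: measurable_funTS; exact: measurable_funM.
  - move=> u; rewrite /= in_itv/= andbT => u0.
    rewrite -EFinM lee_fin igammaE// /B -expRD ler_expR addrK.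
    have h := ln_le_tangent c0 u0.
    have h2 : x * ln u <= x * (ln c + u / c - 1) by rewrite ler_wpM2l.
    apply: (@le_trans _ _ (x * (ln c + u / c - 1) - u)); first by lra.
    rewrite le_eqVlt; apply/orP; left; apply/eqP.
    rewrite /c; field; rewrite -/c; lra.
rewrite ge0_integralZl_EFin ?expR_ge0//.
- rewrite integral_expR_tail// mulr0 oppr0 expR0 invrK mul1r -EFinM /B lee_fin.
  by rewrite [leRHS]expRD lnK// posrE.
- by apply: ((measurable_EFinP _ _).2 _); exact: measurable_funTS.
Qed.

Lemma Gamma_EFin x : 0 < x -> egamma x = (Gamma x)%:E.
Proof.
move=> x0; rewrite GammaE fineK//.
have e0 : (0 <= egamma x)%E by apply: integral_ge0 => u _; rewrite lee_fin igamma_ge0.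
have := egamma_ub (ltW x0); rewrite egammaS//.
case: (egamma x) e0 => // _; by rewrite gt0_muley// lte_fin.
Qed.

Lemma GammaS x : 0 < x -> Gamma (x + 1) = x * Gamma x.
Proof.
move=> x0; apply: EFin_inj; rewrite EFinM -!Gamma_EFin//; last lra.
exact: egammaS.
Qed.

Lemma Gamma_gt0 x : 0 < x -> 0 < Gamma x.
Proof.
move=> x0; have := egamma_lb (ltW x0); rewrite Gamma_EFin; last lra.
rewrite lee_fin GammaS// => h.
have : 0 < x * Gamma x by apply: lt_le_trans h; exact: expR_gt0.
by rewrite pmulr_rgt0.
Qed.

Lemma lnGammaS x : 0 < x -> lnGamma (x + 1) = ln x + lnGamma x.
Proof. by move=> x0; rewrite lnGamma.unlock GammaS// lnM ?posrE// Gamma_gt0. Qed.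

Lemma expR_lnGamma x : 0 < x -> expR (lnGamma x) = Gamma x.
Proof. by move=> x0; rewrite lnGamma.unlock lnK// posrE Gamma_gt0. Qed.

Lemma stirling_lb x : 0 <= x -> x * ln x - x - 1 <= lnGamma (x + 1).
Proof.
move=> x0; have x1 : 0 < x + 1 by lra.
have := egamma_lb x0; rewrite Gamma_EFin// lee_fin -expR_lnGamma//.
by rewrite ler_expR.
Qed.

Lemma stirling_ub x : 0 <= x -> lnGamma (x + 1) <= x * ln x - x + 1 + ln (x + 1).
Proof.
move=> x0; have x1 : 0 < x + 1 by lra.
have := egamma_ub x0; rewrite Gamma_EFin// lee_fin -expR_lnGamma//.
rewrite ler_expR => h; apply: (le_trans h).
have [->|xn0] := eqVneq x 0; first by rewrite !mul0r; lra.
have xp : 0 < x by rewrite lt_def xn0.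
have h2 : x * ln (x + 1) <= x * (ln x + (x + 1) / x - 1).
  by rewrite ler_wpM2l//; exact: ln_le_tangent.
have h3 : x * (ln x + (x + 1) / x - 1) = x * ln x + 1 by field.
lra.
Qed.

Lemma expR_convex l m p q : 0 <= l -> 0 <= m -> l + m = 1 ->
  expR (l * p + m * q) <= l * expR p + m * expR q.
Proof.
move=> l0 m0 lm; set w := l * p + _.
have tangent z : expR w * (1 + (z - w)) <= expR z.
  have -> : expR z = expR w * expR (z - w) by rewrite -expRD subrKC.
  by rewrite ler_wpM2l ?expR_ge0// expR_ge1Dx.
have h1 : l * (expR w * (1 + (p - w))) <= l * expR p by rewrite ler_wpM2l.
have h2 : m * (expR w * (1 + (q - w))) <= m * expR q by rewrite ler_wpM2l.
apply: le_trans (lerD h1 h2).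
have -> : m = 1 - l by lra.
rewrite le_eqVlt; apply/orP; left; apply/eqP; rewrite /w.
have -> : m = 1 - l by lra.
ring.
Qed.

Lemma lnGamma_convex l m a b : 0 < a -> 0 < b -> 0 <= l -> 0 <= m -> l + m = 1 ->
  lnGamma (l * a + m * b) <= l * lnGamma a + m * lnGamma b.
Proof.
move=> a0 b0 l0 m0 lm.
set c := l * a + _; set k := l * _ + _.
have c0 : 0 < c.
  have [lm1|lm1] := ltP 0 l.
    by rewrite /c ltr_pwDl ?mulr_gt0// mulr_ge0// ltW.
  have mp : 0 < m by lra.
  by rewrite /c ltr_wpDl ?mulr_gt0// mulr_ge0// ltW.
rewrite -ler_expR expR_lnGamma// -lee_fin -Gamma_EFin//.
have Ia := Gamma_EFin a0; have Ib := Gamma_EFin b0.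
have name (e : R) : exists e' : R, e' = e by exists e.
have [k' kE] := name k.
have [A' AE] := name (l * expR (k' - lnGamma a)).
have [B' BE] := name (m * expR (k' - lnGamma b)).
rewrite -kE; have {kE} kE : k' = l * lnGamma a + m * lnGamma b by [].
have A'0 : 0 <= A' by rewrite AE mulr_ge0 ?expR_ge0.
have B'0 : 0 <= B' by rewrite BE mulr_ge0 ?expR_ge0.
clear k.
have mi x : measurable_fun (`]0%R, +oo[ : set R) (fun u => (igamma x u)%:E).
  by apply: ((measurable_EFinP _ _).2 _); apply: measurable_funTS; exact: measurable_igamma.
apply: (@le_trans _ _ (\int[mu]_(u in `]0%R, +oo[)
   (A'%:E * (igamma a u)%:E + B'%:E * (igamma b u)%:E))%E).
  apply: ge0_le_integral => //.
  - by move=> u _; rewrite lee_fin igamma_ge0.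
  - exact: mi.
  - by apply: emeasurable_funD; apply: measurable_funeM; exact: mi.
  - move=> u; rewrite /= in_itv/= andbT => u0.
    suff h : igamma c u <= A' * igamma a u + B' * igamma b u.
      by rewrite -lee_fin in h.
    have E x n : n * expR (k' - lnGamma x) * igamma x u =
        n * expR (k' - lnGamma x + ((x - 1) * ln u - u)).
      by rewrite (igammaE x u0) -mulrA -expRD.
    apply: le_trans (_ : _ <= l * _ + m * _) _; first last.
      by apply: lerD; [rewrite AE (E a l)|rewrite BE (E b m)]; exact: lexx.
    apply: le_trans (expR_convex _ _ l0 m0 lm); rewrite (igammaE c u0) ler_expR.
    rewrite le_eqVlt; apply/orP; left; apply/eqP; rewrite kE /c.
    have -> : m = 1 - l by rewrite -lm addrC addKr.
    move: (lnGamma a) (lnGamma b) (ln u) => La Lb U; ring.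
have i0 x n u : 0 <= n -> (0 <= n%:E * (igamma x u)%:E)%E.
  by move=> n0; rewrite -EFinM lee_fin mulr_ge0// igamma_ge0.
rewrite ge0_integralD//; first last.
- by apply: measurable_funeM; exact: mi.
- by move=> u _; exact: i0.
- by apply: measurable_funeM; exact: mi.
- by move=> u _; exact: i0.
rewrite ge0_integralZl_EFin//; first last.
- exact: mi.
- by move=> u _; rewrite lee_fin igamma_ge0.
rewrite ge0_integralZl_EFin//; first last.
- exact: mi.
- by move=> u _; rewrite lee_fin igamma_ge0.
rewrite -/(egamma a) -/(egamma b) Ia Ib -EFinM -EFinM -EFinD lee_fin.
have E x n : 0 < x -> n * expR (k' - lnGamma x) * Gamma x = n * expR k'.
  by move=> x0; rewrite -(expR_lnGamma x0) -mulrA -expRD subrK.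
apply: (@le_trans _ _ (l * expR k' + m * expR k')).
  by apply: lerD; [rewrite AE (E a l a0)|rewrite BE (E b m b0)]; exact: lexx.
by rewrite -mulrDl lm mul1r; exact: lexx.
Qed.

Lemma lnGamma_slope p q r : 0 < p -> p < q -> q < r ->
  (lnGamma q - lnGamma p) * (r - q) <= (lnGamma r - lnGamma q) * (q - p).
Proof.
move=> p0 pq qr; have r0 : 0 < r by lra.
have rp : 0 < r - p by lra.
pose l := (r - q) / (r - p); pose m := (q - p) / (r - p).
have l0 : 0 <= l by rewrite /l divr_ge0//; lra.
have m0 : 0 <= m by rewrite /m divr_ge0//; lra.
have lm : l + m = 1 by rewrite /l /m; field; lra.
have := lnGamma_convex p0 r0 l0 m0 lm.
have -> : l * p + m * r = q by rewrite /l /m; field; lra.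
rewrite -(ler_pM2r rp).
have -> : (l * lnGamma p + m * lnGamma r) * (r - p) =
  (r - q) * lnGamma p + (q - p) * lnGamma r by rewrite /l /m; field; lra.
move=> h; lra.
Qed.

Lemma lnGamma_incr_ub theta x : 0 < theta -> 0 < x ->
  lnGamma (x + theta) - lnGamma x <= theta * ln (x + theta).
Proof.
move=> t0 x0; have xt : 0 < x + theta by lra.
have := @lnGamma_slope x (x + theta) (x + theta + 1) x0.
rewrite lnGammaS// => /(_ _ _)/(le_trans _); rewrite ltrDl t0 ltrDl ltr01.
have -> : x + theta + 1 - (x + theta) = 1 by ring.
have -> : x + theta - x = theta by ring.
rewrite addrK mulr1 => h; rewrite mulrC; exact: h.
Qed.

Lemma lnGamma_incr_lb theta x : 0 < theta -> 0 < x ->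
  theta * ln x <= lnGamma (x + 1 + theta) - lnGamma (x + 1).
Proof.
move=> t0 x0.
have := @lnGamma_slope x (x + 1) (x + 1 + theta) x0.
rewrite ltrDl ltr01 ltrDl t0 => /(_ isT isT).
rewrite {1}lnGammaS// addrK.
have -> : x + 1 + theta - (x + 1) = theta by ring.
have -> : x + 1 - x = 1 by ring.
by rewrite mulr1 mulrC.
Qed.

Lemma pair_interaction_gt0 theta d : 0 < theta -> theta <= d ->
  0 < pair_interaction theta d.
Proof.
move=> t0 td; rewrite /pair_interaction.
by apply: divr_gt0; apply: mulr_gt0; apply: Gamma_gt0; lra.
Qed.

Lemma ln_pair_interaction theta d : 0 < theta -> theta <= d ->
  ln (pair_interaction theta d) = lnGamma (d + theta) - lnGamma d +
     (lnGamma (d + 1) - lnGamma (d + 1 - theta)).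
Proof.
move=> t0 td; rewrite /pair_interaction.
have G1 : 0 < Gamma (d + theta) by apply: Gamma_gt0; lra.
have G2 : 0 < Gamma (d + 1) by apply: Gamma_gt0; lra.
have G3 : 0 < Gamma d by apply: Gamma_gt0; lra.
have G4 : 0 < Gamma (d + 1 - theta) by apply: Gamma_gt0; lra.
rewrite lnGamma.unlock; move: G1 G2 G3 G4.
move: (Gamma (d + theta)) (Gamma (d + 1)) (Gamma d) (Gamma (d + 1 - theta)).
move=> g1 g2 g3 g4 G1 G2 G3 G4.
rewrite ln_div ?posrE ?mulr_gt0// !lnM ?posrE//; ring.
Qed.

Lemma ln_pair_interaction_approx theta d : 0 < theta -> theta <= d ->
  `|ln (pair_interaction theta d) - 2 * theta * ln d| <= 4 * (1 + theta) ^+ 3 / d.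
Proof.
move=> t0 td; have d0 : 0 < d by lra.
have di : 0 < d^-1 by rewrite invr_gt0.
have aux z : 0 <= z -> [/\ theta * (theta * z) <= (1 + theta) ^+ 3 * z,
    theta * z <= (1 + theta) ^+ 3 * z,
    theta * ((1 + theta) * ((1 + theta) * z)) <= (1 + theta) ^+ 3 * z &
    theta * ((1 + theta) * z) <= (1 + theta) ^+ 3 * z].
  move=> z0; have t2 : 0 < theta * theta by rewrite mulr_gt0.
  have t3 : 0 < theta * theta * theta by rewrite mulr_gt0.
  have h c : c <= (1 + theta) ^+ 3 -> c * z <= (1 + theta) ^+ 3 * z by move=> ?; rewrite ler_wpM2r.
  by rewrite !mulrA; split; apply: h; lra.
have e0 : 0 < d + 1 - theta by lra.
rewrite ln_pair_interaction//.
have u1 := lnGamma_incr_ub t0 d0.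
have u2 := lnGamma_incr_ub t0 e0.
have l1 := lnGamma_incr_lb t0 d0.
have l2 := lnGamma_incr_lb t0 e0.
have E1 : d + 1 - theta + theta = d + 1 by ring.
have E2 : d + 1 - theta + 1 + theta = d + 1 + 1 by ring.
have E3 : d + 1 + theta = d + theta + 1 by ring.
have dt0 : 0 < d + theta by lra.
have d10 : 0 < d + 1 by lra.
rewrite E1 in u2; rewrite E2 !lnGammaS// in l2; rewrite E3 !lnGammaS// in l1.
rewrite !lnGammaS// in u2 *.
have t1 := ln_le_tangent d0 dt0.
have t2 := ln_le_tangent d0 d10.
have t3 := ln_le_tangent e0 d0.
have t4 := ln_le_tangent e0 d10.
have F1 : (d + theta) / d = 1 + theta / d by field; lra.
have F2 : (d + 1) / d = 1 + 1 / d by field; lra.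
have F3 : d / (d + 1 - theta) = 1 + (theta - 1) / (d + 1 - theta) by field; lra.
have F4 : (d + 1) / (d + 1 - theta) = 1 + theta / (d + 1 - theta) by field; lra.
have ei : (d + 1 - theta)^-1 <= (1 + theta) / d.
  rewrite ler_pdivlMr// mulrC ler_pdivrMr//; nra.
have ei0 : 0 < (d + 1 - theta)^-1 by rewrite invr_gt0.
rewrite F1 in t1; rewrite F2 in t2; rewrite F3 in t3; rewrite F4 in t4.
have g3 : (theta - 1) / (d + 1 - theta) <= (1 + theta) * ((1 + theta) / d).
  apply: (@le_trans _ _ ((1 + theta) / (d + 1 - theta))).
    by rewrite ler_wpM2r// ?ltW//; lra.
  by rewrite ler_wpM2l//; lra.
have g4 : theta / (d + 1 - theta) <= theta * ((1 + theta) / d).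
  by rewrite ler_wpM2l// ltW.
have T1 : theta * ln (d + theta) <= theta * (ln d + theta / d).
  by rewrite ler_wpM2l; lra.
have T2 : theta * ln (d + 1) <= theta * (ln d + 1 / d).
  by rewrite ler_wpM2l; lra.
have T3 : theta * ln d <= theta * (ln (d + 1 - theta) + (1 + theta) * ((1 + theta) / d)).
  by rewrite ler_wpM2l; lra.
have td0 : 0 < theta / d by rewrite divr_gt0.
have [S1 S2 S3 S4] := aux _ (ltW di).
rewrite ler_norml; apply/andP; split; lra.
Qed.

End gamma_function.


Section gap_sums.
Context {R : realType}.
Implicit Types (e : nat -> R).

Lemma harmonic_le n : \sum_(k < n.+1) (k.+1%:R)^-1 <= 1 + ln (n.+1%:R) :> R.
Proof.
elim: n => [|n IHn]; first by rewrite big_ord1 invr1 ln1 addr0.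
rewrite big_ord_recr/=.
have n1 : (0 : R) < n.+1%:R by rewrite ltr0n.
have n2 : (0 : R) < n.+2%:R by rewrite ltr0n.
have h := ln_le_tangent n2 n1.
have E : (n.+1%:R : R) / n.+2%:R = 1 - n.+2%:R^-1.
  have -> : (n.+1%:R : R) = n.+2%:R - 1 by rewrite -[n.+2%:R]natr1 addrK.
  by field; lra.
rewrite E in h.
set u := (_ : R)^-1 in h *; lra.
Qed.

Lemma gap_sum_le N e : (forall k, 0 <= e k) ->
  \sum_(i < N) \sum_(j < N | (i < j)%N) e (j - i)%N <= N%:R * \sum_(k < N) e k.+1.
Proof.
move=> e0; rewrite mulr_natl -[X in _ *+ X]card_ord -sumr_const; apply: ler_sum => i _.
have -> : \sum_(j < N | (i < j)%N) e (j - i)%N = \sum_(i.+1 <= j < N) e (j - i)%N.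
  by rewrite big_geq_mkord.
rewrite -{1}(add0n i.+1) big_addn.
rewrite (eq_bigr (fun k => e k.+1)); last by move=> k _; rewrite addnS -addSn addnK.
rewrite -(big_mkord xpredT (fun k => e k.+1)).
rewrite [leRHS](@big_cat_nat _ _ _ (N - i.+1)%N)/= ?leq_subr//.
by rewrite lerDl sumr_ge0.
Qed.

Lemma inv_gap_sum_le n :
  \sum_(i < n.+1) \sum_(j < n.+1 | (i < j)%N) ((j - i)%:R)^-1 <=
  n.+1%:R * (1 + ln n.+1%:R) :> R.
Proof.
apply: (le_trans (@gap_sum_le n.+1 (fun k => (k%:R)^-1) _)).
  by move=> k; rewrite invr_ge0.
by rewrite ler_wpM2l// harmonic_le.
Qed.

Lemma ln_prod_cond (I : Type) (s : seq I) (P : pred I) (f : I -> R) :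
  (forall i, P i -> 0 < f i) ->
  0 < \prod_(i <- s | P i) f i /\
  ln (\prod_(i <- s | P i) f i) = \sum_(i <- s | P i) ln (f i).
Proof.
move=> f0; elim/big_rec2: _ => [|i y1 y2 Pi [IH1 IH2]]; first by rewrite ln1.
by rewrite mulr_gt0 ?f0// lnM ?posrE ?f0// IH2.
Qed.

End gap_sums.

Section weight_asymptotics.
Context {R : realType}.
Variables (M theta : R).
Hypotheses (M0 : 0 < M) (th0 : 0 < theta).
Let A : R := M + theta.
Let A0 : 0 < A. Proof. by rewrite /A addr_gt0. Qed.
Implicit Types (x y l : R).

(* x ln x - x *)
Definition gxx x : R := x * ln x - x.

Lemma gxx_tangent x y : 0 < y -> 0 <= x -> gxx y + ln y * (x - y) <= gxx x.
Proof.
move=> y0 x0; rewrite /gxx.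
have [->|xn0] := eqVneq x 0; first by rewrite mul0r; lra.
have xp : 0 < x by rewrite lt_def xn0.
have h : x * ln y <= x * (ln x + y / x - 1).
  by rewrite ler_wpM2l//; exact: ln_le_tangent.
have h2 : x * (ln x + y / x - 1) = x * ln x + y - x by field.
lra.
Qed.

Lemma gxx_ge x : 0 <= x -> -1 <= gxx x.
Proof. by move=> x0; have := gxx_tangent ltr01 x0; rewrite /gxx ln1; lra. Qed.

Lemma site_stirling L l l' B : 0 <= l -> 0 <= l' -> 0 <= B ->
  L - B <= l + l' <= L -> 0 < L ->
  `|lnGamma (l + 1) + lnGamma (l' + 1) - (gxx l + gxx (L - l))| <=
  (5 + B) * (1 + ln (1 + L)).
Proof.
move=> l0 l'0 B0 /andP[s1 s2] L0.
have LL : 0 <= ln (1 + L) by rewrite ln_ge0; lra.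
have a1 := stirling_lb l0; have a2 := stirling_ub l0.
have b1 := stirling_lb l'0; have b2 := stirling_ub l'0.
have a3 : ln (l + 1) <= ln (1 + L) by rewrite ler_ln ?posrE; lra.
have b3 : ln (l' + 1) <= ln (1 + L) by rewrite ler_ln ?posrE; lra.
have c1 : gxx l' - 1 <= gxx (L - l).
  have [l'1|l'1] := leP 1 l'.
    have l'p : 0 < l' by lra.
    have Ll : 0 <= L - l by lra.
    have := gxx_tangent l'p Ll.
    have : 0 <= ln l' * (L - l - l') by rewrite mulr_ge0 ?ln_ge0//; lra.
    lra.
  have Ll : 0 <= L - l by lra.
  have := gxx_ge Ll.
  have [->|l'n0] := eqVneq l' 0; first by rewrite /gxx mul0r; lra.
  have l'p : 0 < l' by rewrite lt_def l'n0.
  have : l' * ln l' <= 0 by rewrite mulr_ge0_le0// ln_le0// ltW.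
  rewrite /gxx; lra.
have c2 : gxx (L - l) <= gxx l' + B * ln (1 + L).
  have [Ll|Ll] := ltP 0 (L - l); last first.
    have -> : L - l = 0 by lra.
    have -> : l' = 0 by lra.
    by rewrite lerDl mulr_ge0.
  have h1 := gxx_tangent Ll l'0.
  have h2 : ln (L - l) <= ln (1 + L) by rewrite ler_ln ?posrE; lra.
  have h3 : ln (L - l) * (L - l - l') <= B * ln (1 + L).
    apply: (@le_trans _ _ (ln (1 + L) * (L - l - l'))).
      by rewrite ler_wpM2r//; lra.
    by rewrite mulrC ler_wpM2r//; lra.
  lra.
have BLn : 0 <= B * ln (1 + L) by rewrite mulr_ge0.
rewrite /gxx in c1 c2 *; rewrite ler_norml; apply/andP; split; lra.
Qed.


Definition wpot x : R := A * ln A + A - potential M theta x.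

Definition discrete_energy n (x : 'I_n.+1 -> R) : R :=
  2 * theta * (\sum_(i < n.+1) \sum_(j < n.+1 | (i < j)%N) lk A (x i) (x j)) / n.+1%:R ^+ 2
  - (\sum_(i < n.+1) wpot (x i)) / n.+1%:R.

Definition weight_level n : R :=
  2 * theta * ln (A * n.+1%:R) * (\sum_(i < n.+1) \sum_(j < n.+1 | (i < j)%N) 1)
  - A * n.+1%:R ^+ 2 * ln (A * n.+1%:R).

Section boxed.
Variable n : nat.
Let N : R := n.+1%:R.
Let N0 : 0 < N. Proof. by rewrite ltr0n. Qed.
Let Mn := Num.truncn (M * N).
Variable lam : {ffun 'I_n.+1 -> 'I_Mn.+1}.
Hypothesis blam : boxed_partition lam.
Local Notation l := (ell theta lam).

Lemma ell_gap (i j : 'I_n.+1) : (i < j)%N -> (j - i)%:R * theta <= l i - l j.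
Proof.
move=> ij; rewrite /ell.
have /implyP/(_ (ltnW ij)) := forallP (forallP blam i) j.
rewrite -(ler_nat R) => h.
have -> : (n.+1 - i.+1 = (n.+1 - j.+1) + (j - i))%N.
  have ji := ltn_ord j; rewrite !subSS addnBA ?(ltnW ij)// subnK -1?ltnS//.
rewrite natrD; lra.
Qed.

Lemma ell_ge0 i : 0 <= l i.
Proof. by rewrite addr_ge0// mulr_ge0// ltW. Qed.

Lemma Mn_bounds : Mn%:R <= M * N < Mn%:R + 1.
Proof. by have := truncn_itv (ltW (mulr_gt0 M0 N0)); rewrite -natr1. Qed.

Lemma ell_le i : l i + theta <= Mn%:R + N * theta.
Proof.
rewrite /ell.
have h1 : ((lam i)%:R : R) <= Mn%:R by rewrite ler_nat -ltnS.
have h2 : (n.+1 - i.+1)%:R * theta <= n%:R * theta.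
  by rewrite ler_wpM2r ?(ltW th0)// ler_nat subSS leq_subr.
have -> : N = n%:R + 1 by rewrite natr1.
lra.
Qed.

Lemma ell_leA i : l i + theta <= A * N.
Proof.
by apply: (le_trans (ell_le i)); have /andP[h _] := Mn_bounds; rewrite /A mulrDl; lra.
Qed.

Lemma site_approx i :
  0 < site_weight theta n.+1 Mn (l i) /\
  `|ln (site_weight theta n.+1 Mn (l i)) -
    (N * wpot (l i / N) - A * N * ln (A * N))| <= (6 + theta) * (1 + A) * (1 + ln N).
Proof.
have l0 := ell_ge0 i; have l1 := ell_le i; have l2 := ell_leA i.
have /andP[m1 m2] := Mn_bounds.
rewrite /site_weight.
set l' := Mn%:R + N * theta - l i - theta.
have l'0 : 0 <= l' by rewrite /l'; lra.
have -> : Mn%:R + n.+1%:R * theta - l i + 1 - theta = l' + 1 by rewrite /l' -/N; ring.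
have G1 : 0 < Gamma (l i + 1) by apply: Gamma_gt0; lra.
have G2 : 0 < Gamma (l' + 1) by apply: Gamma_gt0; lra.
split; first by rewrite invr_gt0 mulr_gt0.
have B0 : 0 <= 1 + theta by rewrite addr_ge0// ltW.
have AN0 : 0 < A * N by rewrite mulr_gt0.
have h : A * N - (1 + theta) <= l i + l' <= A * N.
  have -> : A * N = M * N + N * theta by rewrite /A; ring.
  have -> : l i + l' = Mn%:R + N * theta - theta by rewrite /l'; ring.
  by apply/andP; split; [move: m2|move: m1]; move: (M * N) (Mn%:R : R) (N * theta) => a b c;
    have := th0; lra.
have H := site_stirling l0 l'0 B0 h AN0.
have E : N * wpot (l i / N) - A * N * ln (A * N) = - (gxx (l i) + gxx (A * N - l i)).
  have E1 x : 0 <= x -> x * N * ln (x * N) = N * (x * ln x) + x * N * ln N.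
    move=> x0; have [->|xn0] := eqVneq x 0; first by rewrite !mul0r mulr0 addr0.
    have xp : 0 < x by rewrite lt_def xn0.
    by rewrite lnM ?posrE//; ring.
  have [y yE] : exists y, y = l i / N by eexists.
  have lE : l i = y * N by rewrite yE mulfVK// gt_eqF.
  have y0 : 0 <= y by rewrite yE divr_ge0// ltW.
  have Ay0 : 0 <= A - y by rewrite yE subr_ge0 ler_pdivrMr//; lra.
  have E2 : A * N - y * N = (A - y) * N by ring.
  rewrite -yE lE E2 /gxx (E1 y y0) (E1 _ Ay0) /wpot /potential -/A lnM ?posrE//.
  ring.
rewrite lnV ?posrE ?mulr_gt0// lnM ?posrE// E.
have -> : - (ln (Gamma (l i + 1)) + ln (Gamma (l' + 1))) -
  - (gxx (l i) + gxx (A * N - l i)) = - (lnGamma (l i + 1) + lnGamma (l' + 1) -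
  (gxx (l i) + gxx (A * N - l i))) by rewrite lnGamma.unlock opprB opprK addrC.
rewrite normrN.
apply: (le_trans H).
have N1 : 1 <= N by rewrite ler1n.
have lN : 0 <= ln N by rewrite ln_ge0.
have h3 : ln (1 + A * N) <= A + ln N.
  have hh : ln (1 + A * N) <= ln ((1 + A) * N).
    have E2 : (1 + A) * N = N + A * N by ring.
    by rewrite E2 ler_ln ?posrE ?addr_gt0// lerD2r.
  apply: (le_trans hh); rewrite lnM ?posrE//; last by rewrite addr_gt0.
  by rewrite lerD2r le_ln1Dx// (lt_trans _ A0)// ltrN10.
rewrite -mulrA; have -> : 5 + (1 + theta) = 6 + theta by ring.
rewrite ler_wpM2l//; first by rewrite addr_ge0// ltW.
have : 0 <= A * ln N by rewrite mulr_ge0// ltW.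
lra.
Qed.

Lemma pair_approx (i j : 'I_n.+1) : (i < j)%N ->
  0 < pair_interaction theta (l i - l j) /\
  `|ln (pair_interaction theta (l i - l j)) -
    (2 * theta * ln (A * N) - 2 * theta * lk A (l i / N) (l j / N))| <=
  (4 * (1 + theta) ^+ 3 / theta) * ((j - i)%:R)^-1.
Proof.
move=> ij; have g := ell_gap ij.
have ji1 : (1 : R) <= (j - i)%:R by rewrite ler1n subn_gt0.
have ji0 : (0 : R) < (j - i)%:R by rewrite ltr0n subn_gt0.
have d1 : theta <= l i - l j.
  by apply: le_trans g; rewrite ler_peMl// ltW.
have d0 : 0 < l i - l j by exact: lt_le_trans d1.
split; first exact: pair_interaction_gt0.
have E : 2 * theta * ln (A * N) - 2 * theta * lk A (l i / N) (l j / N) =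
   2 * theta * ln (l i - l j).
  have AN0 : 0 < A * N by rewrite mulr_gt0.
  have hle : l i - l j <= A * N.
    rewrite lerBlDr; apply: (@le_trans _ _ (l i + theta)); first by rewrite lerDl ltW.
    by apply: (le_trans (ell_leA i)); rewrite lerDl ell_ge0.
  have -> : lk A (l i / N) (l j / N) = ln (A * N / (l i - l j)).
    rewrite /lk -mulrBl normrM (gtr0_norm d0) gtr0_norm ?invr_gt0//.
    rewrite invfM invrK mulrA mulrAC.
    by rewrite max_r// ln_ge0// ler_pdivlMr// mul1r.
  by rewrite ln_div ?posrE//; ring.
rewrite E; apply: (le_trans (ln_pair_interaction_approx th0 d1)).
have K0 : 0 <= 4 * (1 + theta) ^+ 3.
  by rewrite mulr_ge0// exprn_ge0// addr_ge0// ltW.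
rewrite -(mulrA _ theta^-1) ler_wpM2l//.
by rewrite -invfM lef_pV2 ?posrE ?mulr_gt0// mulrC.
Qed.

Lemma ln_weight_approx :
  0 < weight theta Mn l /\
  `|ln (weight theta Mn l) -
    (weight_level n - N ^+ 2 * discrete_energy (fun i => l i / N))| <=
  (4 * (1 + theta) ^+ 3 / theta + (6 + theta) * (1 + A)) * (N * (1 + ln N)).
Proof.
pose pr (i j : 'I_n.+1) := pair_interaction theta (l i - l j).
have row (i : 'I_n.+1) : 0 < \prod_(j < n.+1 | (i < j)%N) pr i j /\
    ln (\prod_(j < n.+1 | (i < j)%N) pr i j) = \sum_(j < n.+1 | (i < j)%N) ln (pr i j).
  by apply: ln_prod_cond => j ij; case: (pair_approx ij).
have [p1 p2] := @ln_prod_cond R _ (index_enum 'I_n.+1) xpredT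
  (fun i : 'I_n.+1 => \prod_(j < n.+1 | (i < j)%N) pr i j) (fun i _ => (row i).1).
have [s1 s2] := @ln_prod_cond R _ (index_enum 'I_n.+1) xpredT
  (fun i : 'I_n.+1 => site_weight theta n.+1 Mn (l i)) (fun i _ => (site_approx i).1).
rewrite /weight -/pr; split; first by rewrite mulr_gt0.
rewrite lnM ?posrE// p2 s2 (eq_bigr _ (fun i _ => (row i).2)).
have E : weight_level n - N ^+ 2 * discrete_energy (fun i => l i / N) =
  \sum_(i < n.+1) \sum_(j < n.+1 | (i < j)%N)
    (2 * theta * ln (A * N) - 2 * theta * lk A (l i / N) (l j / N)) +
  \sum_(i < n.+1) (N * wpot (l i / N) - A * N * ln (A * N)).
  have -> : \sum_(i < n.+1) \sum_(j < n.+1 | (i < j)%N)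
      (2 * theta * ln (A * N) - 2 * theta * lk A (l i / N) (l j / N)) =
    2 * theta * ln (A * N) * (\sum_(i < n.+1) \sum_(j < n.+1 | (i < j)%N) 1) -
    2 * theta * (\sum_(i < n.+1) \sum_(j < n.+1 | (i < j)%N) lk A (l i / N) (l j / N)).
    rewrite !mulr_sumr -sumrB; apply: eq_bigr => i _.
    rewrite !mulr_sumr -sumrB; apply: eq_bigr => j _.
    by rewrite mulr1.
  rewrite sumrB sumr_const card_ord -mulr_sumr /weight_level /discrete_energy -/N.
  rewrite -mulr_natr -/N; field; rewrite nat1r gt_eqF//.
rewrite E; set S1 := \sum_i _; set S2 := \sum_i _; set S3 := \sum_i _; set S4 := \sum_i _.
have -> : S1 + S2 - (S3 + S4) = (S1 - S3) + (S2 - S4) by ring.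
rewrite [leRHS]mulrDl; apply: (le_trans (ler_normD _ _)); apply: lerD.
  rewrite /S1 /S3 -sumrB.
  apply: (@le_trans _ _ (\sum_(i < n.+1) \sum_(j < n.+1 | (i < j)%N)
     (4 * (1 + theta) ^+ 3 / theta) * ((j - i)%:R)^-1)).
    apply: (le_trans (ler_norm_sum _ _ _)); apply: ler_sum => i _.
    rewrite -sumrB; apply: (le_trans (ler_norm_sum _ _ _)); apply: ler_sum => j ij.
    by case: (pair_approx ij).
  under eq_bigr do rewrite -mulr_sumr.
  rewrite -mulr_sumr ler_wpM2l ?inv_gap_sum_le//.
  by rewrite divr_ge0 ?mulr_ge0 ?exprn_ge0 ?addr_ge0// ltW.
rewrite /S2 /S4 -sumrB.
apply: (@le_trans _ _ (\sum_(i < n.+1) (6 + theta) * (1 + A) * (1 + ln N))).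
  apply: (le_trans (ler_norm_sum _ _ _)); apply: ler_sum => i _.
  by case: (site_approx i).
rewrite sumr_const card_ord -mulr_natr -/N le_eqVlt; apply/orP; left; apply/eqP; ring.
Qed.

End boxed.

End weight_asymptotics.


Section potential_modulus.
Context {R : realType}.
Implicit Types (a b x y z A : R).

Lemma xlnx_modulus A x y : 0 <= y -> y <= x -> x <= A ->
  `|x * ln x - y * ln y| <= A * (x - y) + 4 * (Num.sqrt x - Num.sqrt y).
Proof.
move=> y0 yx xA; have x0 : 0 <= x by exact: le_trans yx.
have A0 : 0 <= A by exact: le_trans xA.
have d0 : 0 <= x - y by rewrite subr_ge0.
have s0 : 0 <= Num.sqrt x - Num.sqrt y by rewrite subr_ge0 ler_sqrt.
have [x00|xn0] := eqVneq x 0.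
  have -> : y = 0 by lra.
  by rewrite x00 !mul0r !subrr mulr0 normr0.
have xp : 0 < x by rewrite lt_def xn0.
have lnx : ln x <= x - 1 by have := ln_le_tangent ltr01 xp; rewrite ln1 divr1; lra.
have up : x * ln x - y * ln y <= A * (x - y).
  have := gxx_tangent xp y0; rewrite /gxx.
  have : (1 + ln x) * (x - y) <= A * (x - y) by rewrite ler_wpM2r//; lra.
  lra.
have sx : 0 < Num.sqrt x by rewrite sqrtr_gt0.
have xE : x = Num.sqrt x ^+ 2 by rewrite sqr_sqrtr.
have yE : y = Num.sqrt y ^+ 2 by rewrite sqr_sqrtr.
have sy : 0 <= Num.sqrt y by exact: sqrtr_ge0.
have lb : - (4 * (Num.sqrt x - Num.sqrt y)) <= x * ln x - y * ln y.
  have h1 : (x - y) * ln x <= x * ln x - y * ln y.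
    have : y * ln y <= y * ln x.
      have [->|yn0] := eqVneq y 0; first by rewrite !mul0r.
      by rewrite ler_wpM2l// ler_ln ?posrE// lt_def yn0.
    lra.
  apply: le_trans h1.
  have h2 : - (2 / Num.sqrt x) <= ln x.
    have := ln_le_tangent sx ltr01; rewrite ln1.
    have -> : ln x = 2 * ln (Num.sqrt x) by rewrite {1}xE lnXn// mulr_natl.
    lra.
  apply: (@le_trans _ _ ((x - y) * - (2 / Num.sqrt x))); last by rewrite ler_wpM2l.
  have -> : (x - y) * - (2 / Num.sqrt x) =
    - ((Num.sqrt x - Num.sqrt y) * (2 * (1 + Num.sqrt y / Num.sqrt x))).
    by rewrite {1}xE {1}yE; field; lra.
  rewrite lerN2 [leRHS]mulrC ler_wpM2l//.
  have : Num.sqrt y / Num.sqrt x <= 1 by rewrite ler_pdivrMr// mul1r ler_sqrt.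
  lra.
have Ad : 0 <= A * (x - y) by rewrite mulr_ge0.
rewrite ler_norml; apply/andP; split; lra.
Qed.

Lemma sqrtr_sub_le x y : 0 <= y -> y <= x ->
  Num.sqrt x - Num.sqrt y <= Num.sqrt (x - y).
Proof.
move=> y0 yx; have d0 : 0 <= x - y by rewrite subr_ge0.
have x0 : 0 <= x by exact: le_trans yx.
rewrite lerBlDr -(ler_pXn2r (n := 2))// ?nnegrE ?addr_ge0 ?sqrtr_ge0//.
rewrite sqrrD !sqr_sqrtr//.
have : 0 <= Num.sqrt (x - y) * Num.sqrt y by rewrite mulr_ge0 ?sqrtr_ge0.
by rewrite mulr2n; lra.
Qed.

Lemma ln_le_root4 z : 1 <= z -> 1 + ln z <= 5 * Num.sqrt (Num.sqrt z).
Proof.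
move=> z1; have z0 : 0 < z by lra.
set w := Num.sqrt (Num.sqrt z).
have s0 : 0 < Num.sqrt z by rewrite sqrtr_gt0.
have w0 : 0 < w by rewrite sqrtr_gt0.
have w1 : 1 <= w.
  have mono a : 1 <= a -> 1 <= Num.sqrt a.
    by move=> a1; rewrite -[leLHS]sqrtr1 ler_sqrt// (le_trans _ a1).
  exact/mono/mono.
have zE : z = w ^+ 4.
  by rewrite -[4%N]/(2 * 2)%N exprM /w (sqr_sqrtr (ltW s0)) (sqr_sqrtr (ltW z0)).
have -> : ln z = 4 * ln w by rewrite {1}zE lnXn// mulr_natl.
have := ln_le_tangent ltr01 w0; rewrite ln1 divr1; lra.
Qed.

Lemma ln_sqr_le z : 1 <= z -> (1 + ln z) ^+ 2 <= 25 * Num.sqrt z.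
Proof.
move=> z1; have h := ln_le_root4 z1.
have l0 : 0 <= ln z by rewrite ln_ge0.
apply: (@le_trans _ _ ((5 * Num.sqrt (Num.sqrt z)) ^+ 2)).
  by rewrite ler_pXn2r// nnegrE ?mulr_ge0 ?sqrtr_ge0// addr_ge0.
by rewrite exprMn sqr_sqrtr ?sqrtr_ge0//; lra.
Qed.

End potential_modulus.

Section wpot_modulus.
Context {R : realType}.
Variables (M theta : R).
Hypotheses (M0 : 0 < M) (th0 : 0 < theta).
Let A : R := M + theta.
Let A0 : 0 < A. Proof. by rewrite /A addr_gt0. Qed.
Implicit Types (x y : R).
Local Notation W := (wpot M theta).

Lemma pot_boxE x : 0 <= x <= A -> pot A (box A) x = (W x)%:E.
Proof. exact: potential_pot. Qed.

Lemma wpot_ge0 x : 0 <= x <= A -> 0 <= W x.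
Proof. by move=> xA; rewrite -lee_fin -pot_boxE// pot_ge0//; exact: nnm_box. Qed.

Lemma wpot_le x : 0 <= x <= A -> W x <= 2 * A.
Proof.
move=> xA; rewrite -lee_fin -pot_boxE// -[(2 * A)%R]mulr1.
apply: pot_bounded => //; first exact: nnm_box.
by move=> y; rewrite /box indicE; case: (_ \in _).
Qed.

Definition wmod x : R := 2 * A * x + 4 * Num.sqrt x - 4 * Num.sqrt (A - x).

Lemma wpot_modulus x y : 0 <= y -> y <= x -> x <= A ->
  `|W x - W y| <= wmod x - wmod y.
Proof.
move=> y0 yx xA; have h1 := xlnx_modulus y0 yx xA.
have Ax : 0 <= A - x by lra.
have Axy : A - x <= A - y by lra.
have AyA : A - y <= A by lra.
have h2 := xlnx_modulus Ax Axy AyA.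
have -> : W x - W y = ((A - y) * ln (A - y) - (A - x) * ln (A - x)) -
   (x * ln x - y * ln y) by rewrite /wpot /potential -/A; ring.
apply: (le_trans (ler_normB _ _)); apply: (le_trans (lerD h2 h1)).
rewrite /wmod; lra.
Qed.

Lemma wmod_holder x y : 0 <= y -> y <= x -> x <= A ->
  wmod x - wmod y <= 2 * A * (x - y) + 8 * Num.sqrt (x - y).
Proof.
move=> y0 yx xA; have h1 := sqrtr_sub_le y0 yx.
have Ax : 0 <= A - x by lra.
have Axy : A - x <= A - y by lra.
have h2 := sqrtr_sub_le Ax Axy.
have E : A - y - (A - x) = x - y by ring.
rewrite E in h2; rewrite /wmod; lra.
Qed.

Lemma wpot_holder x y : 0 <= y -> y <= x -> x <= A ->
  `|W x - W y| <= 2 * A * (x - y) + 8 * Num.sqrt (x - y).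
Proof. by move=> *; apply: le_trans (wpot_modulus _ _ _) (wmod_holder _ _ _). Qed.

End wpot_modulus.


Section chunks.
Context {R : realType}.
Local Notation mu := (@lebesgue_measure R).
Implicit Types (f g : R -> R) (a b e x y A K N theta : R).

Lemma lk_ratio A a b x y e : 0 < A -> 0 < `|a - b| -> 0 < `|x - y| -> 0 <= e ->
  `|a - b| <= (1 + e) * `|x - y| -> lk A x y <= lk A a b + e.
Proof.
move=> A0; rewrite /lk; move: `|a - b| `|x - y| => D d D0 d0 e0 Dd.
have e1 : 0 < 1 + e by lra.
rewrite ge_max addr_ge0 ?le_max ?lexx//=.
apply: (@le_trans _ _ (ln (A / D) + e)); last by rewrite lerD2r le_max lexx orbT.
apply: (@le_trans _ _ (ln (A / D) + ln (1 + e))); last first.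
  by rewrite lerD2l le_ln1Dx//; lra.
rewrite -lnM ?posrE ?divr_gt0// ler_ln ?posrE ?mulr_gt0 ?divr_gt0 ?invr_gt0//.
by rewrite -mulrA ler_wpM2l ?(ltW A0)// ler_pdivlMl// ler_pdivrMr.
Qed.

Lemma kr_le_lk A f g K : 0 < A -> tame A f -> tame A g -> 0 <= K ->
  (forall x y, f x != 0 -> g y != 0 -> lk A x y <= K) ->
  kr A f g <= K * mass g * mass f.
Proof.
move=> A0 tf tg K0 h; have ng := tame_nnm tg; have nf := tame_nnm tf.
apply: kr_le_pot => //; first by rewrite mulr_ge0// mass_ge0.
move=> x fx; rewrite EFinM -(tame_massE tg) -ge0_integral_nnmZ//.
apply: le_integral_nnm; [exact: nnmM (nnm_lk A x) ng|exact: nnmM (nnm_cst K0) ng|].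
move=> y; have [->|gy] := eqVneq (g y) 0; first by rewrite !mulr0.
by rewrite ler_wpM2r ?h//; case: ng.
Qed.

Lemma kr_ge_lk A f g K : 0 < A -> tame A f -> tame A g -> 0 <= K ->
  (forall x y, f x != 0 -> g y != 0 -> K <= lk A x y) ->
  K * mass g * mass f <= kr A f g.
Proof.
move=> A0 tf tg K0 h; have ng := tame_nnm tg; have nf := tame_nnm tf.
apply: kr_ge_pot => //; first by rewrite mulr_ge0// mass_ge0.
move=> x fx; rewrite EFinM -(tame_massE tg) -ge0_integral_nnmZ//.
apply: le_integral_nnm; [exact: nnmM (nnm_cst K0) ng|exact: nnmM (nnm_lk A x) ng|].
move=> y; have [->|gy] := eqVneq (g y) 0; first by rewrite !mulr0.
by rewrite ler_wpM2r ?h//; case: ng.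
Qed.

Definition chunk theta N f : Prop :=
  [/\ nnm f, forall y, f y <= theta^-1 & (\int[mu]_y (f y)%:E = (N^-1)%:E)%E].

Lemma chunk_tame A theta N f : 0 < A -> chunk theta N f -> tame A f.
Proof.
by move=> A0 [nf fb fi]; apply: (tame_bounded A0 nf fb); rewrite fi ltry.
Qed.

Lemma chunk_mass theta N f : chunk theta N f -> mass f = N^-1.
Proof. by move=> [_ _ fi]; rewrite /mass fi. Qed.

Lemma kr_chunk_le A theta N f g : 0 < A -> 1 <= N ->
  chunk theta N f -> chunk theta N g ->
  kr A f g <= N ^- 2 * (ln N + 2 * A / theta).
Proof.
move=> A0 N1 cf cg; have N0 : 0 < N by lra.
have tf := chunk_tame A0 cf; have tg := chunk_tame A0 cg.
have [ng gb gi] := cg.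
have lN : 0 <= ln N by rewrite ln_ge0.
have ti : 0 <= theta^-1 by apply: le_trans (gb 0); case: ng.
have -> : N ^- 2 * (ln N + 2 * A / theta) = N^-1 * (ln N + 2 * A / theta) * mass f.
  by rewrite (chunk_mass cf) -exprVn; ring.
apply: kr_le_pot => //.
  by rewrite mulr_ge0 ?invr_ge0 ?(ltW N0)// addr_ge0// !mulr_ge0// ltW.
move=> x _; apply: (le_trans (pot_bounded_mass x A0 lN ng gb)).
rewrite gi -EFinM -EFinD lee_fin expRN lnK ?posrE//.
rewrite le_eqVlt; apply/orP; left; apply/eqP; ring.
Qed.

Lemma sum_disjoint_le (I : finType) (F : I -> R) b : 0 <= b ->
  (forall i, F i <= b) -> (forall i j, F i != 0 -> F j != 0 -> i = j) ->
  \sum_i F i <= b.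
Proof.
move=> b0 Fb Fd; case: (pickP (fun i => F i != 0)) => [i Fi|F0].
  rewrite (bigD1 i)//= big1 ?addr0// => j ji.
  by apply/eqP; apply: contraNT ji => Fj; apply/eqP; exact: Fd.
by rewrite big1// => i _; have /negbFE/eqP := F0 i.
Qed.

Lemma sum_sym_split n (s : 'I_n -> 'I_n -> R) : (forall i j, s i j = s j i) ->
  \sum_(i < n) \sum_(j < n) s i j =
  \sum_(i < n) s i i + 2 * (\sum_(i < n) \sum_(j < n | (i < j)%N) s i j).
Proof.
move=> ss; have E (i : 'I_n) : \sum_(j < n) s i j =
  s i i + \sum_(j < n | (i < j)%N) s i j + \sum_(j < n | (j < i)%N) s i j.
  rewrite (bigD1 i)//= -addrA; congr (_ + _).
  rewrite (bigID (fun j : 'I_n => (i < j)%N))/=; congr (_ + _); apply: eq_bigl => j.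
    by rewrite andb_idl// => ij; rewrite -val_eqE gtn_eqF.
  by rewrite -leqNgt ltn_neqAle -val_eqE.
under eq_bigr do rewrite E; rewrite !big_split/= -addrA; congr (_ + _).
rewrite mulr2n mulrDl !mul1r; congr (_ + _).
rewrite (exchange_big_dep xpredT)//=; apply: eq_bigr => i _; exact: eq_bigr.
Qed.

Lemma sum_lift_le n (s : 'I_n.+1 -> 'I_n.+1 -> R) : (forall i j, 0 <= s i j) ->
  \sum_(i < n) \sum_(j < n | (i < j)%N) s (lift ord0 i) (lift ord0 j) <=
  \sum_(i < n.+1) \sum_(j < n.+1 | (i < j)%N) s i j.
Proof.
move=> s0; rewrite [leRHS]big_ord_recl/= -[leLHS]add0r lerD ?sumr_ge0//.
apply: ler_sum => i _; rewrite [leRHS]big_mkcond big_ord_recl/= add0r -big_mkcond/=.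
rewrite le_eqVlt; apply/orP; left; apply/eqP; apply: eq_bigl => j.
by rewrite /bump/= !add1n.
Qed.

End chunks.


Lemma absorb_in_square (R : realType) (p q L : R) : 0 <= p -> 0 <= q -> 1 <= L ->
  p * (L - 1) + 2 * q + 2 * (p * (L + 1) + 2 * q) * L <= (9 * p + 6 * q) * L ^+ 2.
Proof.
move=> p0 q0 L1; have L0 : 0 <= L by lra.
have q1 : p * 1 <= p * L by rewrite ler_wpM2l.
have q2 : p * L <= p * L * L by rewrite ler_peMr// mulr_ge0.
have q3 : q * 1 <= q * L by rewrite ler_wpM2l.
have q4 : q * L <= q * L * L by rewrite ler_peMr// mulr_ge0.
rewrite expr2; lra.
Qed.

Section thickening.
Context {R : realType}.
Local Notation mu := (@lebesgue_measure R).
Variables (M theta t : R).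
Hypotheses (M0 : 0 < M) (th0 : 0 < theta).
Let A : R := M + theta.
Hypotheses (tht : theta <= t) (tA : t <= A).
Let A0 : 0 < A. Proof. by rewrite /A addr_gt0. Qed.
Let ti0 : 0 < theta^-1. Proof. by rewrite invr_gt0. Qed.
Let t0 : 0 < t. Proof. exact: lt_le_trans tht. Qed.
Variable n : nat.
Let N : R := n.+1%:R.
Let N0 : 0 < N. Proof. by rewrite ltr0n. Qed.
Let N1 : 1 <= N. Proof. by rewrite ler1n. Qed.
Let h : R := theta / N.
Let h0 : 0 < h. Proof. by rewrite divr_gt0. Qed.
Variable x : 'I_n.+1 -> R.
Hypotheses (x0 : forall i, 0 <= x i) (xt : x ord0 <= t).
Hypothesis gap : forall i j : 'I_n.+1, (i < j)%N -> (j - i)%:R * h <= x i - x j.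
Implicit Types (y z a : R) (i j : 'I_n).

Let cell a : R -> R := fun y => theta^-1 * \1_(`]a, (a + h)%R[) y.

Let cell_supp a y : cell a y != 0 -> a < y < a + h.
Proof.
rewrite /cell indicE mem_setE in_itv/=; case: (a < y < a + h) => //.
by rewrite mulr0 eqxx.
Qed.

Let chunk_cell a : chunk theta N (cell a).
Proof.
have nI : nnm (\1_(`]a, (a + h)%R[) : R -> R) by apply: nnm_indic; exact: measurable_itv.
split.
- exact: nnmM (nnm_cst (ltW ti0)) nI.
- move=> y; rewrite /cell indicE; case: (_ \in _); rewrite ?mulr1// mulr0; exact: ltW.
- rewrite /cell ge0_integral_nnmZ//; last exact: ltW.
  rewrite integral_indic ?setIT /=; [|by []|exact: measurable_itv].
  rewrite lebesgue_measure_itv/= lte_fin ltrDl h0 -EFinB -EFinM.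
  by congr (_%:E); rewrite /h; field; rewrite !gt_eqF.
Qed.

Let c i := cell (x (lift ord0 i)).
Let chunk_c i : chunk theta N (c i). Proof. exact: chunk_cell. Qed.
Let tame_c i : tame A (c i). Proof. exact: chunk_tame (chunk_c i). Qed.
Let phi y := \sum_i c i y.
Let tame_phi : tame A phi. Proof. exact: tame_sum. Qed.

Let gap_lift i j : (i < j)%N ->
  (j - i)%:R * h <= x (lift ord0 i) - x (lift ord0 j).
Proof.
move=> ij; have := @gap (lift ord0 i) (lift ord0 j).
by rewrite /= /bump/= !add1n subSS ltnS; exact.
Qed.

Let c_disjoint y i j : c i y != 0 -> c j y != 0 -> i = j.
Proof.
have main (i' j' : 'I_n) : c i' y != 0 -> c j' y != 0 -> ~~ (i' < j')%N.
  move=> /cell_supp/andP[a1 a2] /cell_supp/andP[b1 b2]; apply/negP => ij.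
  have g := gap_lift ij.
  have : h <= (j' - i')%:R * h by rewrite ler_peMl ?(ltW h0)// ler1n subn_gt0.
  lra.
move=> ci cj; have h1 := main _ _ ci cj; have h2 := main _ _ cj ci.
by apply: val_inj; apply/eqP; rewrite eqn_leq leqNgt h2 leqNgt h1.
Qed.

Let phi_ge0 y : 0 <= phi y.
Proof. by case: (tame_nnm tame_phi). Qed.

Let phi_le y : phi y <= theta^-1 * box t y.
Proof.
have [yt|yt] := boolP (0 < y < t).
  rewrite box_in// mulr1; apply: sum_disjoint_le; first exact: ltW.
    by move=> i; case: (chunk_c i).
  exact: c_disjoint.
rewrite box_out// mulr0 /phi big1// => i _; apply/eqP; apply: contraNT yt.
move=> /cell_supp/andP[a1 a2].
rewrite (le_lt_trans (x0 (lift ord0 i)) a1)/=.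
have g := @gap ord0 (lift ord0 i) isT.
have : h <= (lift ord0 i - (ord0 : 'I_n.+1))%:R * h.
  by rewrite ler_peMl ?(ltW h0)// ler1n.
by move: xt; lra.
Qed.

Let phi_mass : mass phi = n%:R / N.
Proof.
rewrite /phi (mass_sum _ tame_c).
rewrite (eq_bigr (fun=> N^-1)); last by move=> i _; exact: chunk_mass (chunk_c i).
by rewrite sumr_const card_ord mulr_natl.
Qed.

Let psi y := theta^-1 * box t y - phi y.

Let psi_le y : psi y <= theta^-1 * box t y.
Proof. by rewrite lerBlDr lerDl. Qed.

Let nnm_tbox : nnm (fun y => theta^-1 * box t y).
Proof. exact: nnmM (nnm_cst (ltW ti0)) (nnm_box t). Qed.

Let tbox_le y : theta^-1 * box t y <= theta^-1.
Proof.
by rewrite ler_piMr ?(ltW ti0)// /box indicE; case: (_ \in _); rewrite ?lexx ?ler01.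
Qed.

Let tbox_int : (\int[mu]_y (theta^-1 * box t y)%:E = (theta^-1 * t)%:E)%E.
Proof.
rewrite ge0_integral_nnmZ ?(ltW ti0)//; last exact: nnm_box.
by rewrite box_mass.
Qed.

Let tame_tbox : tame A (fun y => theta^-1 * box t y).
Proof. by apply: (tame_bounded A0 nnm_tbox tbox_le); rewrite tbox_int ltry. Qed.

Let nnm_psi : nnm psi.
Proof.
split; last by move=> y; rewrite subr_ge0.
by apply: measurable_funB; [case: nnm_tbox|case: (tame_nnm tame_phi)].
Qed.

Let tame_psi : tame A psi.
Proof.
apply: (tame_bounded A0 nnm_psi (fun y => le_trans (psi_le y) (tbox_le y))).
apply: (le_lt_trans (le_integral_nnm nnm_psi nnm_tbox psi_le)).
by rewrite tbox_int ltry.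
Qed.

Let psi_mass : mass psi = t / theta - n%:R / N.
Proof.
have := massD tame_phi tame_psi; rewrite phi_mass.
have -> : (fun y => phi y + psi y) = (fun y => theta^-1 * box t y).
  by apply/funext => y; rewrite /psi addrC subrK.
have -> : mass (fun y => theta^-1 * box t y) = theta^-1 * t by rewrite /mass tbox_int.
by rewrite [t / theta]mulrC => ->; ring.
Qed.

Let psi_mass_ge : N^-1 <= mass psi.
Proof.
rewrite psi_mass.
apply: (@le_trans _ _ (1 - n%:R / N)); last first.
  by rewrite lerD2r ler_pdivlMr// mul1r.
have -> : n%:R = N - 1 :> R by rewrite /N -natr1 addrK.
by rewrite mulrBl divff ?gt_eqF// mul1r opprB addrC subrK.
Qed.

Let k := N^-1 / mass psi.
Let m0 : 0 < mass psi. Proof. by apply: lt_le_trans psi_mass_ge; rewrite invr_gt0. Qed.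
Let k0 : 0 <= k. Proof. by rewrite divr_ge0 ?invr_ge0 ?(ltW m0) ?(ltW N0). Qed.
Let k1 : k <= 1. Proof. by rewrite ler_pdivrMr// mul1r. Qed.
Let g y := k * psi y.
Let tame_g : tame A g. Proof. exact: tameZ. Qed.
Let g_mass : mass g = N^-1.
Proof. by rewrite (massZ k0 tame_psi) /k mulrVK// unitfE gt_eqF. Qed.
Let f y := phi y + g y.
Let tame_f : tame A f. Proof. exact: tameD. Qed.

Let f_le y : f y <= theta^-1 * box t y.
Proof.
have -> : theta^-1 * box t y = phi y + psi y by rewrite addrC subrK.
by rewrite lerD2l ler_piMl// subr_ge0.
Qed.

Let capped_f : capped theta t f.
Proof.
split.
- exact: tame_nnm tame_f.
- by move=> y; exact: le_trans (f_le y) (tbox_le y).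
- move=> y fy; apply: contraNT fy => yt; rewrite eq_le.
  have := f_le y; rewrite box_out// mulr0 => ->/=.
  by case: (tame_nnm tame_f).
- rewrite (tame_massE tame_f) (massD tame_phi tame_g) phi_mass g_mass.
  by rewrite -{2}(mul1r N^-1) -mulrDl natr1 divff// gt_eqF.
Qed.

Let B : R := ln N + 2 * A / theta.
Let lnN : 0 <= ln N. Proof. by rewrite ln_ge0. Qed.
Let B0 : 0 <= B.
Proof. by rewrite addr_ge0// divr_ge0 ?mulr_ge0 ?(ltW A0) ?(ltW th0). Qed.

Let kr_cc i j : (i < j)%N ->
  kr A (c i) (c j) <= N ^- 2 *
    (lk A (x (lift ord0 i)) (x (lift ord0 j)) + (2 + B) * ((j - i)%:R)^-1).
Proof.
move=> ij; have := gap_lift ij; set a := x (lift ord0 i); set b := x (lift ord0 j).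
move=> gab; have Ni : 0 <= N ^- 2 by rewrite invr_ge0 exprn_ge0// ltW.
have [d1|d2] := leqP (j - i) 1.
  have -> : (j - i)%N = 1%N by apply/eqP; rewrite eqn_leq d1 subn_gt0.
  apply: (le_trans (kr_chunk_le A0 N1 (chunk_c i) (chunk_c j))).
  by rewrite ler_wpM2l// -/B invr1 mulr1; have := lk_ge0 A a b; lra.
pose d : R := (j - i)%:R.
have dge2 : 2 <= d by rewrite /d ler_nat.
have D : d * h <= `|a - b| by apply: le_trans gab (ler_norm _).
have dh : 0 < d * h by rewrite mulr_gt0//; lra.
have K0 : 0 <= lk A a b + (d - 1)^-1.
  by rewrite addr_ge0 ?lk_ge0// invr_ge0; lra.
have main : kr A (c i) (c j) <= (lk A a b + (d - 1)^-1) * N^-1 * N^-1.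
  rewrite -{1}(chunk_mass (chunk_c j)) -(chunk_mass (chunk_c i)).
  apply: kr_le_lk => // y z /cell_supp/andP[y1 y2] /cell_supp/andP[z1 z2].
  rewrite -/a in y1 y2; rewrite -/b in z1 z2.
  have dp : 0 < d - 1 by lra.
  have hd : d * h - h = (d - 1) * h by ring.
  have hd0 : 0 < (d - 1) * h by rewrite mulr_gt0.
  have ab0 : 0 < a - b by apply: lt_le_trans gab.
  have yz : a - b - h <= y - z by lra.
  have gab' : d * h <= a - b by [].
  have yz0 : 0 < y - z by lra.
  apply: lk_ratio => //.
  - by rewrite gtr0_norm.
  - by rewrite gtr0_norm.
  - by rewrite invr_ge0 ltW.
  rewrite (gtr0_norm ab0) (gtr0_norm yz0).
  apply: (@le_trans _ _ ((1 + (d - 1)^-1) * (a - b - h))); last first.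
    by rewrite ler_wpM2l// addr_ge0// invr_ge0 ltW.
  have : (1 + (d - 1)^-1) * (d - 1) = d by field; lra.
  rewrite -subr_ge0.
  have -> : (1 + (d - 1)^-1) * (a - b - h) - (a - b) = (d - 1)^-1 * (a - b - d * h).
    by field; lra.
  by move=> _; rewrite mulr_ge0 ?invr_ge0 ?(ltW dp)// subr_ge0.
apply: (le_trans main).
have -> : (lk A a b + (d - 1)^-1) * N^-1 * N^-1 = N ^- 2 * (lk A a b + (d - 1)^-1).
  by rewrite -exprVn; ring.
rewrite ler_wpM2l// lerD2l -/d.
apply: (@le_trans _ _ (2 * d^-1)); last by rewrite ler_wpM2r ?invr_ge0 ?lerDl//; lra.
rewrite -[leLHS]mul1r ler_pdivrMr; last by lra.
by rewrite mulrAC ler_pdivlMr; lra.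
Qed.

Let kr_phiphi : kr A phi phi <= N ^- 2 *
  (2 * (\sum_(i < n.+1) \sum_(j < n.+1 | (i < j)%N) lk A (x i) (x j)) +
   N * B + 2 * (2 + B) * (N * (1 + ln N))).
Proof.
have -> : kr A phi phi = \sum_i \sum_j kr A (c i) (c j).
  rewrite {1}/phi (kr_suml _ tame_phi tame_c); apply: eq_bigr => i _.
  by rewrite /phi (kr_sumr _ (tame_c i) tame_c).
rewrite sum_sym_split; last by move=> i j; apply: kr_sym; exact: tame_nnm (tame_c _).
have Ni : 0 <= N ^- 2 by rewrite invr_ge0 exprn_ge0// ltW.
have h1 : \sum_(i < n) kr A (c i) (c i) <= N ^- 2 * (N * B).
  apply: (@le_trans _ _ (\sum_(i < n) N ^- 2 * B)).
    by apply: ler_sum => i _; exact: kr_chunk_le.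
  rewrite sumr_const card_ord -mulr_natl mulrCA ler_wpM2l// ler_wpM2r//.
  by rewrite /N ler_nat.
have h2 : \sum_(i < n) \sum_(j < n | (i < j)%N) kr A (c i) (c j) <=
   N ^- 2 * ((\sum_(i < n.+1) \sum_(j < n.+1 | (i < j)%N) lk A (x i) (x j)) +
   (2 + B) * (N * (1 + ln N))).
  pose s (i j : 'I_n.+1) := lk A (x i) (x j) + (2 + B) * ((j - i)%:R)^-1.
  have s0 (i j : 'I_n.+1) : 0 <= s i j.
    by rewrite addr_ge0 ?lk_ge0// mulr_ge0 ?invr_ge0// addr_ge0.
  apply: (@le_trans _ _ (N ^- 2 *
     \sum_(i < n) \sum_(j < n | (i < j)%N) s (lift ord0 i) (lift ord0 j))).
    rewrite mulr_sumr; apply: ler_sum => i _; rewrite mulr_sumr; apply: ler_sum => j ij.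
    by rewrite /s/= /bump/= !add1n subSS; exact: kr_cc.
  rewrite ler_wpM2l//; apply: (le_trans (sum_lift_le s0)).
  rewrite /s; under eq_bigr do rewrite big_split/= -mulr_sumr.
  by rewrite big_split/= -mulr_sumr lerD2l ler_wpM2l ?inv_gap_sum_le// addr_ge0.
apply: (le_trans (lerD h1 (ler_wpM2l (ler0n _ 2) h2))).
rewrite le_eqVlt; apply/orP; left; apply/eqP; ring.
Qed.

Let om : R := 2 * A * h + 8 * Num.sqrt h.
Let om0 : 0 <= om.
Proof.
apply: addr_ge0; last by rewrite mulr_ge0// sqrtr_ge0.
by apply: mulr_ge0; [apply: mulr_ge0 => //; exact: ltW|exact: ltW].
Qed.

Let xA (i : 'I_n.+1) : 0 <= x i <= A.
Proof.
rewrite x0/=; apply: le_trans tA; apply: le_trans xt.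
have [->//|i0] := eqVneq i ord0.
have i1 : (0 < i)%N by rewrite lt0n.
have := @gap ord0 i i1.
have : 0 <= (i - (ord0 : 'I_n.+1))%:R * h by rewrite mulr_ge0// ltW.
lra.
Qed.

Let kr_box_c i : (wpot M theta (x (lift ord0 i)) - om) * N^-1 <= kr A (box A) (c i).
Proof.
set a := x _; have Ni : 0 <= N^-1 by rewrite invr_ge0 ltW.
have nc : nnm (c i) by exact: tame_nnm (tame_c i).
have [W0|W0] := leP 0 (wpot M theta a - om); last first.
  apply: (@le_trans _ _ 0); first by rewrite mulr_le0_ge0// ltW.
  by apply: kr_ge0 => //; exact: nnm_box.
rewrite kr_sym//; last exact: nnm_box.
rewrite -(chunk_mass (chunk_c i)); apply: kr_ge_pot => //; first exact: tame_box.
move=> y cy; have cy' := cy; move: cy' => /cell_supp; rewrite -/a => /andP[y1 y2].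
have : phi y != 0.
  rewrite /phi (bigD1 i)//= gt_eqF// ltr_pwDl//.
    by rewrite lt_def cy/=; case: nc.
  by apply: sumr_ge0 => j _; case: (chunk_c j) => -[].
move=> py; have yt : 0 < y < t.
  apply: contraNT py => yt; rewrite eq_le phi_ge0 andbT.
  by have := phi_le y; rewrite box_out// mulr0.
have /andP[yp yt'] := yt.
have yA : y <= A by apply: le_trans tA; exact: ltW.
rewrite (pot_boxE M0 th0); last by rewrite (ltW yp).
rewrite lee_fin.
have a0 : 0 <= a by exact: x0.
have hm := wpot_holder a0 (ltW y1) yA.
have : 2 * (M + theta) * (y - a) + 8 * Num.sqrt (y - a) <= om.
  apply: lerD.
    rewrite ler_wpM2l// ?mulr_ge0 ?(ltW A0)//; lra.
  rewrite ler_wpM2l// ler_sqrt//; lra.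
move: hm; rewrite ler_norml => /andP[hm _]; lra.
Qed.

Let kr_box_f : (\sum_(i < n.+1) wpot M theta (x i)) / N - 2 * A / N - om <=
  kr A (box A) f.
Proof.
have tb := tame_box A0.
rewrite /f (krDr tb tame_phi tame_g).
have h1 : 0 <= kr A (box A) g by apply: kr_ge0; [exact: nnm_box|exact: tame_nnm tame_g].
have h2 : \sum_(i < n) (wpot M theta (x (lift ord0 i)) - om) * N^-1 <= kr A (box A) phi.
  by rewrite (kr_sumr _ tb tame_c); apply: ler_sum.
have h3 : \sum_(i < n) (wpot M theta (x (lift ord0 i)) - om) * N^-1 =
   (\sum_(i < n) wpot M theta (x (lift ord0 i))) / N - om * (n%:R / N).
  rewrite -mulr_suml sumrB sumr_const card_ord -mulr_natl; ring.
have h4 : om * (n%:R / N) <= om.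
  by rewrite ler_piMr// ler_pdivrMr// mul1r /N ler_nat.
have h5 : wpot M theta (x ord0) / N <= 2 * A / N.
  by rewrite ler_wpM2r ?invr_ge0 ?(ltW N0)//; exact: wpot_le.
rewrite h3 in h2; rewrite big_ord_recl mulrDl; move: h1 h2 h4 h5.
move: (kr A (box A) phi) (kr A (box A) g) (wpot _ _ _ / N) ((\sum_(i < n) _) / N) (2 * A / N).
move: (om * (n%:R / N)) => q1; move: om => q2 q3 q4 q5 q6 q7. lra.
Qed.

Let kr_ff : kr A f f <= kr A phi phi + 6 * A / theta / N.
Proof.
have bd u v : tame A u -> tame A v -> (forall y, v y <= theta^-1) -> mass u = N^-1 ->
    kr A u v <= 2 * A * theta^-1 * N^-1.
  move=> tu tv vb <-; apply: kr_le_pot => //.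
    by rewrite !mulr_ge0 ?(ltW A0) ?(ltW ti0).
  by move=> y _; apply: pot_bounded => //; exact: tame_nnm tv.
have gb y : g y <= theta^-1.
  apply: le_trans (tbox_le y); apply: le_trans (f_le y); rewrite /f lerDr.
  exact: phi_ge0.
have pb y : phi y <= theta^-1 by exact: le_trans (phi_le y) (tbox_le y).
rewrite {1}/f (krDl tame_f tame_phi tame_g) /f.
rewrite (krDr tame_phi tame_phi tame_g) (krDr tame_g tame_phi tame_g).
rewrite (kr_sym A (tame_nnm tame_phi) (tame_nnm tame_g)).
have h1 := bd g phi tame_g tame_phi pb g_mass.
have h2 := bd g g tame_g tame_g gb g_mass.
have -> : 6 * A / theta / N = 3 * (2 * A / theta / N) by ring.
move: h1 h2; move: (2 * A / theta / N) (kr A g phi) (kr A g g) (kr A phi phi).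
move=> q1 q2 q3 q4 h1 h2. lra.
Qed.

Lemma thickening : exists f, capped theta t f /\
  theta * kr A f f - kr A (box A) f <= discrete_energy M theta x +
   ((9 * theta + 6 * A) * ((1 + ln N) ^+ 2 / N) + 8 * A / N + om).
Proof.
exists f; split; first exact: capped_f.
have h1 : theta * kr A f f <= theta * (kr A phi phi + 6 * A / theta / N).
  by rewrite ler_wpM2l// ltW.
have h2 := ler_wpM2l (ltW th0) kr_phiphi.
have h3 := kr_box_f.
rewrite /discrete_energy -/N -/A.
set S := \sum_i \sum_(_ < _ | _) _ in h2 *; set S2 := \sum_i _ in h3 *.
set L := 1 + ln N.
have L1 : 1 <= L by rewrite lerDl.
have e1 : theta * (N ^- 2 * (2 * S + N * B + 2 * (2 + B) * (N * L))) =
  2 * theta * S / N ^+ 2 + (theta * B + 2 * (2 + B) * theta * L) / N.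
  by field; rewrite gt_eqF.
have e2 : theta * (kr A phi phi + 6 * A / theta / N) = theta * kr A phi phi + 6 * A / N.
  by field; rewrite !gt_eqF.
have e3 : (theta * B + 2 * (2 + B) * theta * L) / N <=
   (9 * theta + 6 * A) * (L ^+ 2 / N).
  rewrite mulrA ler_wpM2r ?invr_ge0 ?(ltW N0)//.
  have -> : theta * B = theta * (L - 1) + 2 * A.
    by rewrite /B /L; field; rewrite gt_eqF.
  have -> : 2 * (2 + B) * theta * L = 2 * (theta * (L + 1) + 2 * A) * L.
    by rewrite /B /L; field; rewrite gt_eqF.
  exact: (absorb_in_square (ltW th0) (ltW A0) L1).
rewrite e1 in h2; rewrite e2 in h1.
have r8 : 8 * A / N = 8 * (A / N) by ring.
have r6 : 6 * A / N = 6 * (A / N) by ring.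
have r2 : 2 * A / N = 2 * (A / N) by ring.
rewrite r6 in h1; rewrite r2 in h3; rewrite r8.
move: h1 h2 h3 e3.
move: (kr A phi phi) (kr A f f) (kr A (box A) f) => q1 q2 q3.
move: om (S2 / N) (A / N) => q4 q5 q6.
move: (2 * theta * S / _) => q7.
move: (_ / N) (_ * (L ^+ 2 / N)) => q8 q9 *; lra.
Qed.

End thickening.


Section quantiles.
Context {R : realType}.
Local Notation mu := (@lebesgue_measure R).
Variables (theta t A : R) (f : R -> R).
Hypotheses (th0 : 0 < theta) (t0 : 0 < t) (A0 : 0 < A) (cf : capped theta t f).
Implicit Types (a b y z : R).

Let nf : nnm f. Proof. by case: cf. Qed.
Let f0 y : 0 <= f y. Proof. by case: nf. Qed.
Let tf : tame A f. Proof. exact: capped_tame cf. Qed.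

(* the restriction of f to a set *)
Definition restrict_to (D : set R) : R -> R := fun y => f y * \1_D y.

Lemma nnm_restrict (D : set R) : measurable D -> nnm (restrict_to D).
Proof. by move=> mD; exact: nnmM nf (nnm_indic mD). Qed.

Lemma restrict_le (D : set R) y : restrict_to D y <= f y.
Proof.
rewrite /restrict_to indicE; case: (_ \in _); rewrite ?mulr1// mulr0; exact: f0.
Qed.

Lemma restrict_cap (D : set R) y : restrict_to D y <= theta^-1.
Proof. by apply: (le_trans (restrict_le D y)); case: cf. Qed.

Lemma tame_restrict (D : set R) : measurable D -> tame A (restrict_to D).
Proof.
move=> mD; apply: (tame_bounded A0 (nnm_restrict mD) (restrict_cap D)).
apply: (le_lt_trans (le_integral_nnm (nnm_restrict mD) nf (restrict_le D))).
by case: cf => _ _ _ ->; rewrite ltry.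
Qed.

Definition cumul y : R := mass (restrict_to [set` `]-oo, y]]).

Definition slice a b := restrict_to [set` `]a, b]].

Lemma slice_supp a b y : slice a b y != 0 -> a < y <= b.
Proof.
rewrite /slice /restrict_to indicE mem_setE in_itv/=; case: (a < y <= b) => //.
by rewrite mulr0 eqxx.
Qed.

Lemma tame_slice a b : tame A (slice a b).
Proof. by apply: tame_restrict; exact: measurable_itv. Qed.

Lemma mass_slice a b : a <= b -> mass (slice a b) = cumul b - cumul a.
Proof.
move=> ab; apply/eqP; rewrite eq_sym subr_eq addrC; apply/eqP.
have ta : tame A (restrict_to [set` `]-oo, a]]) by apply: tame_restrict; exact: measurable_itv.
rewrite /cumul -(massD ta (tame_slice a b)); congr mass.
apply/funext => y; rewrite /slice /restrict_to -mulrDr; congr (_ * _).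
rewrite !indicE !mem_setE !in_itv/=.
have [ya|ya] := leP y a; first by rewrite (le_trans ya ab)/= addr0.
by rewrite /= add0r.
Qed.

Lemma mass_slice_le a b : a <= b -> mass (slice a b) <= (b - a) / theta.
Proof.
move=> ab; rewrite -lee_fin -(tame_massE (tame_slice a b)).
have nI : nnm (\1_(`]a, b]) : R -> R) by apply: nnm_indic; exact: measurable_itv.
have ti : 0 <= theta^-1 by rewrite invr_ge0 ltW.
have nIt : nnm (fun y => theta^-1 * \1_(`]a, b]) y) := nnmM (nnm_cst ti) nI.
apply: (@le_trans _ _ (\int[mu]_y (theta^-1 * \1_(`]a, b]) y)%:E)%E).
  apply: le_integral_nnm => //; first exact: tame_nnm (tame_slice a b).
  move=> y; rewrite /slice /restrict_to ler_wpM2r//.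
  by case: cf.
rewrite ge0_integral_nnmZ// integral_indic ?setIT /=; [|by []|exact: measurable_itv].
rewrite lebesgue_measure_itv/= lte_fin; case: ifP => _.
  by rewrite -EFinD -EFinM lee_fin mulrC.
by rewrite mule0 lee_fin divr_ge0 ?subr_ge0// ltW.
Qed.

Lemma cumul_le a b : a <= b -> cumul a <= cumul b.
Proof.
move=> ab; rewrite -subr_ge0 -mass_slice// mass_ge0//.
exact: tame_nnm (tame_slice a b).
Qed.

Lemma cumul_lip a b : a <= b -> cumul b - cumul a <= (b - a) / theta.
Proof. by move=> ab; rewrite -mass_slice//; exact: mass_slice_le. Qed.

Lemma cumul0 : cumul 0 = 0.
Proof.
have := tame_massE (tame_restrict (measurable_itv `]-oo, (0 : R)])).
rewrite integral0_eq; first by case.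
move=> y _; rewrite /restrict_to indicE mem_setE in_itv/=.
case: (leP y 0) => y0; last by rewrite mulr0.
have [->|fy] := eqVneq (f y) 0; first by rewrite mul0r.
by case: cf => _ _ /(_ _ fy)/andP[]; rewrite ltNge y0.
Qed.

Lemma cumul1 : cumul t = 1.
Proof.
rewrite /cumul -(capped_mass cf); congr mass; apply/funext => y.
rewrite /restrict_to indicE mem_setE in_itv/=.
have [->|fy] := eqVneq (f y) 0; first by rewrite mul0r.
by case: cf => _ _ /(_ _ fy)/andP[_ /ltW ->]; rewrite mulr1.
Qed.

Lemma continuous_cumul : continuous cumul.
Proof.
move=> y; apply/cvgrPdist_lt => e e0; near=> z.
have hz : `|y - z| < e * theta.
  by near: z; apply/nbhs_ballP; exists (e * theta) => /=; rewrite ?mulr_gt0.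
have h : `|cumul y - cumul z| <= `|y - z| / theta.
  have [yz|/ltW zy] := leP y z.
    rewrite distrC (distrC y) !ger0_norm ?subr_ge0//; first exact: cumul_lip.
    exact: cumul_le.
  rewrite !ger0_norm ?subr_ge0//; first exact: cumul_lip.
  exact: cumul_le.
by apply: (le_lt_trans h); rewrite ltr_pdivrMr.
Unshelve. all: by end_near. Qed.

Lemma quantile_ex v : 0 <= v <= 1 -> exists y, 0 <= y <= t /\ cumul y = v.
Proof.
move=> /andP[v0 v1].
have [||c] := @IVT R cumul 0 t v (ltW t0).
- by apply: continuous_subspaceT => z; exact: continuous_cumul.
- rewrite cumul0 cumul1; apply/andP; split; first by rewrite ge_min v0.
  by rewrite le_max v1 orbT.
by rewrite in_itv/= => ct cv; exists c.
Qed.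

Lemma quantiles n : exists y : nat -> R, forall m,
  0 <= y m <= t /\ cumul (y m) = (n.+1 - m.+1)%:R / n.+1%:R.
Proof.
have H m : exists y, 0 <= y <= t /\ cumul y = (n.+1 - m.+1)%:R / n.+1%:R.
  apply: quantile_ex; rewrite divr_ge0//= ler_pdivrMr ?ltr0n// mul1r ler_nat.
  exact: leq_subr.
by have [y hy] := choice H; exists y.
Qed.

End quantiles.


Lemma lower_error_bound (R : realType) (th a L l : R) : 0 <= th -> 0 <= a -> 1 <= L -> l <= L ->
  2 * L + 2 * (th * l) + 2 * a <= (2 + 2 * th + 2 * a) * L ^+ 2.
Proof.
move=> p0 q0 L1 lL; have L0 : 0 <= L by lra.
have q1 : L <= L * L by rewrite ler_peMr.
have q2 : th * l <= th * L by rewrite ler_wpM2l.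
have q3 : th * L <= th * (L * L) by rewrite ler_wpM2l.
have q4 : a * 1 <= a * (L * L) by rewrite ler_wpM2l// (le_trans L1).
rewrite expr2; lra.
Qed.

Section discretization.
Context {R : realType}.
Local Notation mu := (@lebesgue_measure R).
Variables (M theta t : R).
Hypotheses (M0 : 0 < M) (th0 : 0 < theta).
Let A : R := M + theta.
Hypothesis tA : t <= A.
Let A0 : 0 < A. Proof. by rewrite /A addr_gt0. Qed.
Variable n : nat.
Let N : R := n.+1%:R.
Let N0 : 0 < N. Proof. by rewrite ltr0n. Qed.
Let N1 : 1 <= N. Proof. by rewrite ler1n. Qed.
Let h : R := theta / N.
Let h0 : 0 < h. Proof. by rewrite divr_gt0. Qed.
Let Mn := Num.truncn (M * N).
Variable f : R -> R.
Hypothesis cf : capped theta t f.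
Let tf : tame A f. Proof. exact: capped_tame cf. Qed.
Variable y : nat -> R.
Let v m : R := (n.+1 - m.+1)%:R.
Hypothesis hy : forall m, 0 <= y m <= t /\ cumul f (y m) = v m / N.

Let y0 m : 0 <= y m. Proof. by case: (hy m) => /andP[]. Qed.
Let yt m : y m <= t. Proof. by case: (hy m) => /andP[]. Qed.
Let yA m : y m <= A. Proof. exact: le_trans (yt m) tA. Qed.
Let yE m : cumul f (y m) = v m / N. Proof. by case: (hy m). Qed.

Let vB m m' : (m <= m')%N -> (m' <= n)%N -> v m - v m' = (m' - m)%:R.
Proof.
move=> mm mn; rewrite /v -natrB; last by rewrite !subSS leq_sub2l.
by congr (_%:R); rewrite !subSS -{1}(subnK mn) -addnBA// addKn.
Qed.

Let ygap m m' : (m <= m')%N -> (m' <= n)%N -> (m' - m)%:R * h <= y m - y m'.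
Proof.
move=> mm mn; have [->|mm'] := eqVneq m m'; first by rewrite subnn mul0r subrr.
have d1 : 0 < v m - v m'.
  by rewrite vB// ltr0n subn_gt0 ltn_neqAle mm' mm.
have yy : y m' <= y m.
  rewrite leNgt; apply/negP => /ltW yy.
  have := cumul_le A0 cf yy; rewrite !yE ler_pM2r ?invr_gt0//.
  by rewrite -subr_ge0 -opprB oppr_ge0 leNgt d1.
have := cumul_lip th0 A0 cf yy; rewrite !yE -mulrBl vB// ler_pdivlMr//.
by rewrite /h mulrA mulrAC.
Qed.

Let ymono m m' : (m <= m')%N -> (m' <= n)%N -> y m' <= y m.
Proof.
move=> mm mn; rewrite -subr_ge0; apply: le_trans (ygap mm mn).
by rewrite mulr_ge0// ltW.
Qed.

Let z m : R := N * y m - v m * theta.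

Let z_ge0 m : 0 <= z m.
Proof.
have := cumul_lip th0 A0 cf (y0 m); rewrite (cumul0 A0 cf) yE !subr0.
rewrite ler_pdivlMr// mulrAC ler_pdivrMr// => ?.
by rewrite /z subr_ge0 mulrC [N * _]mulrC mulrC.
Qed.

Let z_mono m m' : (m <= m')%N -> (m' <= n)%N -> z m' <= z m.
Proof.
move=> mm mn; have := ygap mm mn; rewrite -(vB mm mn) /h mulrA ler_pdivrMr//.
rewrite /z => ?; rewrite -subr_ge0.
have -> : N * y m - v m * theta - (N * y m' - v m' * theta) =
  (y m - y m') * N - (v m - v m') * theta by ring.
by rewrite subr_ge0.
Qed.

Let z_le : z 0 <= M * N.
Proof.
have := cumul_lip th0 A0 cf (yt 0); rewrite (cumul1 cf) yE ler_pdivlMr//.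
have -> : v 0 = N - 1 by rewrite /v /N subSS subn0 -natr1 addrK.
have -> : (1 - (N - 1) / N) * theta = theta / N by field; rewrite gt_eqF.
rewrite ler_pdivrMr// => h1; rewrite /z.
have -> : v 0 = N - 1 by rewrite /v /N subSS subn0 -natr1 addrK.
have h2 : t * N <= A * N by rewrite ler_wpM2r// ltW.
have E : A * N = M * N + theta * N by rewrite /A mulrDl.
rewrite E in h2; move: h1 h2; rewrite mulrBl mulrBl mul1r (mulrC N) (mulrC N).
move: (t * N) (M * N) (theta * N) (y 0 * N) => a b c d; have := th0; lra.
Qed.

Let lam : {ffun 'I_n.+1 -> 'I_Mn.+1} := [ffun i : 'I_n.+1 => inord (Num.truncn (z i))].

Let lamE (i : 'I_n.+1) : lam i = Num.truncn (z i) :> nat.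
Proof.
rewrite ffunE inordK// ltnS; apply: le_truncn; apply: le_trans z_le.
by apply: z_mono => //; rewrite -ltnS.
Qed.

Let blam : boxed_partition lam.
Proof.
apply/forallP => i; apply/forallP => j; apply/implyP => ij; rewrite !lamE.
by apply: le_truncn; apply: z_mono => //; rewrite -ltnS.
Qed.

Let l := ell theta lam.

Let l_bounds (i : 'I_n.+1) : N * y i - 1 <= l i <= N * y i.
Proof.
have := truncn_itv (z_ge0 i); rewrite -lamE -natr1 => /andP[a b].
rewrite /l /ell -/(v i); move: a b; rewrite /z.
move: (N * y i) (v i * theta) ((lam i)%:R : R) => p q r ? ?.
by apply/andP; split; lra.
Qed.

Let x (i : 'I_n.+1) := l i / N.

Let x_le (i : 'I_n.+1) : x i <= y i.
Proof. by rewrite /x ler_pdivrMr// mulrC; case/andP: (l_bounds i). Qed.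

Let x_ge (i : 'I_n.+1) : y i - N^-1 <= x i.
Proof.
rewrite /x ler_pdivlMr// mulrBl mulVf ?gt_eqF// mulrC.
by case/andP: (l_bounds i).
Qed.

Let x_ge0 i : 0 <= x i.
Proof. by rewrite divr_ge0//; exact: ell_ge0. Qed.

Let x_leA i : x i <= A. Proof. exact: le_trans (x_le i) (yA i). Qed.

Let xgap (i j : 'I_n.+1) : (i < j)%N -> (j - i)%:R * h <= x i - x j.
Proof.
move=> ij; rewrite /x -mulrBl /h mulrA ler_wpM2r ?invr_ge0 ?(ltW N0)//.
exact: ell_gap.
Qed.

Let lk_xy (i j : 'I_n.+1) : (i < j)%N ->
  lk A (x i) (x j) <= lk A (y i) (y j) + theta^-1 * ((j - i)%:R)^-1.
Proof.
move=> ij; have gx := xgap ij.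
have d0 : 0 < (j - i)%:R :> R by rewrite ltr0n subn_gt0.
have gy : (j - i)%:R * h <= y i - y j by apply: ygap; [exact: ltnW|rewrite -ltnS].
have dh : 0 < (j - i)%:R * h by rewrite mulr_gt0.
have xx : 0 < x i - x j by exact: lt_le_trans gx.
have yy : 0 < y i - y j by exact: lt_le_trans gy.
apply: lk_ratio => //.
- by rewrite gtr0_norm.
- by rewrite gtr0_norm.
- by rewrite mulr_ge0 ?invr_ge0// ltW.
rewrite (gtr0_norm xx) (gtr0_norm yy) mulrDl mul1r.
apply: (@le_trans _ _ (x i - x j + N^-1)).
  by have := x_ge i; have := x_le j; move: (x i) (x j) (y i) (y j) N^-1 => *; lra.
rewrite lerD2l.
have -> : N^-1 = (theta^-1 * ((j - i)%:R)^-1) * ((j - i)%:R * h).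
  by rewrite /h; field; rewrite !gt_eqF.
by rewrite ler_wpM2l// mulr_ge0 ?invr_ge0// ltW.
Qed.

Let c (i : 'I_n) := slice f (y i.+1) (y i).

Let chunk_c i : chunk theta N (c i).
Proof.
have ym : y i.+1 <= y i by exact: ymono (leqnSn i) (ltn_ord i).
split.
- exact: tame_nnm (tame_slice A0 cf _ _).
- by move=> w; exact: (restrict_cap cf).
- rewrite (tame_massE (tame_slice A0 cf _ _)) (mass_slice A0 cf ym) !yE -mulrBl vB//.
  by rewrite subSnn mul1r.
Qed.

Let tame_c i : tame A (c i). Proof. exact: chunk_tame (chunk_c i). Qed.
Let phi w := \sum_i c i w.
Let tame_phi : tame A phi. Proof. exact: tame_sum. Qed.

Let c_disjoint w i j : c i w != 0 -> c j w != 0 -> i = j.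
Proof.
have main (i' j' : 'I_n) : c i' w != 0 -> c j' w != 0 -> ~~ (i' < j')%N.
  move=> /slice_supp/andP[a1 a2] /slice_supp/andP[b1 b2]; apply/negP => ij.
  have : y j' <= y i'.+1 by exact: ymono ij (ltnW (ltn_ord j')).
  by rewrite leNgt (lt_le_trans a1 b2).
move=> ci cj; have h1 := main _ _ ci cj; have h2 := main _ _ cj ci.
by apply: val_inj; apply/eqP; rewrite eqn_leq leqNgt h2 leqNgt h1.
Qed.

Let phi_le w : phi w <= f w.
Proof.
apply: sum_disjoint_le; first by case: (tame_nnm tf).
  by move=> i; exact: restrict_le cf _ _.
exact: c_disjoint.
Qed.

Let u w := f w - phi w.

Let nnm_u : nnm u.
Proof.
split; last by move=> w; rewrite subr_ge0.
by apply: measurable_funB; [case: (tame_nnm tf)|case: (tame_nnm tame_phi)].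
Qed.

Let tame_u : tame A u.
Proof.
have uf w : u w <= f w.
  by rewrite lerBlDr lerDl; case: (tame_nnm tame_phi).
apply: (tame_bounded A0 nnm_u (b := theta^-1)).
  by move=> w; apply: (le_trans (uf w)); case: cf.
apply: (le_lt_trans (le_integral_nnm nnm_u (tame_nnm tf) uf)).
by case: cf => _ _ _ ->; rewrite ltry.
Qed.

Let fE : f = (fun w => phi w + u w).
Proof. by apply/funext => w; rewrite /u addrC subrK. Qed.

Let u_mass : mass u = N^-1.
Proof.
have := massD tame_phi tame_u; rewrite -fE (capped_mass cf).
rewrite /phi (mass_sum _ tame_c).
rewrite (eq_bigr (fun=> N^-1)); last by move=> i _; exact: chunk_mass (chunk_c i).
rewrite sumr_const card_ord -mulr_natl.
have -> : n%:R = N - 1 :> R by rewrite /N -natr1 addrK.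
by rewrite mulrBl divff ?gt_eqF// mul1r; move: N^-1 (mass u) => p q ?; lra.
Qed.

Let kr_phi_le : kr A phi phi <= kr A f f.
Proof.
have E : kr A f f = kr A phi phi + kr A phi u + (kr A u phi + kr A u u).
  rewrite {1}fE (krDl tf tame_phi tame_u) fE.
  by rewrite (krDr tame_phi tame_phi tame_u) (krDr tame_u tame_phi tame_u).
rewrite E -addrA lerDl.
have np := tame_nnm tame_phi.
by rewrite !addr_ge0// kr_ge0.
Qed.

Let kr_cc (i k : 'I_n) : (i < k)%N -> N ^- 2 * lk A (y i) (y k.+1) <= kr A (c i) (c k).
Proof.
move=> ik.
have -> : N ^- 2 * lk A (y i) (y k.+1) = lk A (y i) (y k.+1) * mass (c k) * mass (c i).
  by rewrite (chunk_mass (chunk_c k)) (chunk_mass (chunk_c i)) -exprVn; ring.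
apply: kr_ge_lk => //; first exact: lk_ge0.
move=> w z' /slice_supp/andP[w1 w2] /slice_supp/andP[z1 z2].
have yik : y k <= y i.+1 by exact: ymono ik (ltnW (ltn_ord k)).
have wz : 0 < w - z' by rewrite subr_gt0; apply: le_lt_trans w1; exact: le_trans yik.
have wzy : w - z' <= y i - y k.+1 by apply: lerB => //; exact: ltW.
have yy : 0 < y i - y k.+1 by exact: lt_le_trans wzy.
rewrite /lk (gtr0_norm wz) (gtr0_norm yy) ge_max le_max lexx/= le_max.
apply/orP; right; rewrite ler_ln ?posrE ?divr_gt0//.
by rewrite ler_wpM2l ?(ltW A0)// lef_pV2 ?posrE.
Qed.

Let sum_lk_y : N ^- 2 * (2 * \sum_(i < n) \sum_(k < n | (i < k)%N) lk A (y i) (y k.+1)) <=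
  kr A f f.
Proof.
apply: le_trans kr_phi_le.
have -> : kr A phi phi = \sum_i \sum_j kr A (c i) (c j).
  rewrite {1}/phi (kr_suml _ tame_phi tame_c); apply: eq_bigr => i _.
  by rewrite /phi (kr_sumr _ (tame_c i) tame_c).
rewrite sum_sym_split; last by move=> i j; apply: kr_sym; exact: tame_nnm (tame_c _).
have nc i : nnm (c i) by exact: tame_nnm (tame_c i).
apply: (@le_trans _ _ (2 * \sum_(i < n) \sum_(k < n | (i < k)%N) kr A (c i) (c k))).
  rewrite mulrCA ler_wpM2l// mulr_sumr; apply: ler_sum => i _.
  by rewrite mulr_sumr; apply: ler_sum => k ik; exact: kr_cc.
by rewrite lerDr; apply: sumr_ge0 => i _; exact: kr_ge0.
Qed.

Let lnN : 0 <= ln N. Proof. by rewrite ln_ge0. Qed.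

Let lk_adjacent (i : 'I_n) : lk A (y i) (y i.+1) <= ln N + A / theta.
Proof.
have g := ygap (leqnSn i) (ltn_ord i); rewrite subSnn mul1r in g.
have yy : 0 < y i - y i.+1 by exact: lt_le_trans g.
rewrite /lk (gtr0_norm yy) ge_max addr_ge0 ?divr_ge0 ?(ltW A0) ?(ltW th0)//=.
apply: (@le_trans _ _ (ln (A / h))).
  rewrite ler_ln ?posrE ?divr_gt0// ler_wpM2l ?(ltW A0)//.
  by rewrite lef_pV2 ?posrE.
have -> : A / h = N * (A / theta) by rewrite /h; field; rewrite !gt_eqF.
rewrite lnM ?posrE ?divr_gt0// lerD2l.
have Ath : 0 < A / theta by rewrite divr_gt0.
have := ln_le_tangent ltr01 Ath; rewrite ln1 divr1; move: (A / theta) => *; lra.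
Qed.

Let L := 1 + ln N.

Let sum_lk_x : \sum_(i < n.+1) \sum_(j < n.+1 | (i < j)%N) lk A (x i) (x j) <=
  \sum_(i < n) \sum_(k < n | (i < k)%N) lk A (y i) (y k.+1) +
  N * (ln N + A / theta) + theta^-1 * (N * L).
Proof.
apply: (@le_trans _ _ (\sum_(i < n.+1) \sum_(j < n.+1 | (i < j)%N)
   (lk A (y i) (y j) + theta^-1 * ((j - i)%:R)^-1))).
  by apply: ler_sum => i _; apply: ler_sum => j ij; exact: lk_xy.
under eq_bigr do rewrite big_split/= -mulr_sumr.
rewrite big_split/= -mulr_sumr; apply: lerD; last first.
  by rewrite ler_wpM2l ?invr_ge0 ?(ltW th0)//; exact: inv_gap_sum_le.
have E (i : nat) : \sum_(j < n.+1 | (i < j)%N) lk A (y i) (y j) =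
    \sum_(k < n | (i <= k)%N) lk A (y i) (y k.+1).
  by rewrite big_mkcond big_ord_recl/= add0r [RHS]big_mkcond.
rewrite (eq_bigr _ (fun (i : 'I_n.+1) _ => E i)) big_ord_recr/= [X in _ + X <= _]big1 ?addr0; last first.
  by move=> k; rewrite leqNgt ltn_ord.
have E2 (i : 'I_n) : \sum_(k < n | (i <= k)%N) lk A (y i) (y k.+1) =
   lk A (y i) (y i.+1) + \sum_(k < n | (i < k)%N) lk A (y i) (y k.+1).
  rewrite (bigD1 i)//=; congr (_ + _); apply: eq_bigl => k.
  by rewrite ltn_neqAle andbC -val_eqE eq_sym.
rewrite (eq_bigr _ (fun i _ => E2 i)) big_split/= addrC lerD2l.
apply: (@le_trans _ _ (\sum_(i < n) (ln N + A / theta))).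
  by apply: ler_sum => i _; exact: lk_adjacent.
rewrite sumr_const card_ord -mulr_natl ler_wpM2r ?addr_ge0 ?divr_ge0 ?(ltW A0) ?(ltW th0)//.
by rewrite /N ler_nat.
Qed.

Local Notation W := (wpot M theta).
Local Notation T := (wmod M theta).
Let om : R := 2 * A / N + 8 * Num.sqrt N^-1.

Let Wx_ge (i : 'I_n.+1) : W (y i) - om <= W (x i).
Proof.
have hm := wpot_holder (x_ge0 i) (x_le i) (yA i).
have d : y i - x i <= N^-1.
  by have := x_ge i; move: (x i) (y i) N^-1 => *; lra.
have : 2 * (M + theta) * (y i - x i) + 8 * Num.sqrt (y i - x i) <= om.
  apply: lerD; first by rewrite ler_wpM2l// mulr_ge0// ltW.
  by rewrite ler_wpM2l// ler_sqrt// invr_ge0 ltW.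
move: hm; rewrite ler_norml => /andP[_].
move: (2 * (M + theta) * (y i - x i) + 8 * Num.sqrt (y i - x i)) => e.
move: (W (y i)) (W (x i)) => p q; move: om => r; lra.
Qed.

Let kr_box_c (i : 'I_n) :
  kr A (box A) (c i) <= (W (y i) + (T (y i) - T (y i.+1))) / N.
Proof.
have yy : y i.+1 <= y i by exact: ymono (leqnSn i) (ltn_ord i).
have Tmono a b : 0 <= a -> a <= b -> b <= A -> 0 <= T b - T a.
  by move=> a0 ab bA; apply: le_trans (wpot_modulus a0 ab bA).
rewrite kr_sym; [|exact: nnm_box|exact: tame_nnm (tame_c i)].
rewrite -(chunk_mass (chunk_c i)); apply: kr_le_pot => //; first exact: tame_box.
  by rewrite addr_ge0// ?(wpot_ge0 M0 th0) ?y0 ?yA// Tmono.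
move=> w /slice_supp/andP[w1 w2].
have w0 : 0 <= w by apply: le_trans (ltW w1).
rewrite (pot_boxE M0 th0); last by rewrite w0/=; exact: le_trans (yA i).
rewrite lee_fin.
have := wpot_modulus w0 w2 (yA i); rewrite ler_norml => /andP[h1 _].
have h2 := Tmono _ _ (y0 i.+1) (ltW w1) (le_trans w2 (yA i)).
move: h1 h2; move: (T _) (T _) (T _) (W _) (W _) => *; lra.
Qed.

Let kr_box_f : kr A (box A) f <= (\sum_(i < n.+1) W (x i)) / N +
  (2 * A / N + (2 * A * A + 8 * Num.sqrt A) / N + om).
Proof.
have tb := tame_box A0; have nb := tame_nnm tb.
have h1 : kr A (box A) f = kr A (box A) phi + kr A (box A) u.
  by rewrite {1}fE (krDr tb tame_phi tame_u).
have h2 : kr A (box A) u <= 2 * A / N.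
  rewrite kr_sym// -u_mass; apply: kr_le_pot => //.
    by rewrite mulr_ge0// ltW.
  move=> w _; rewrite -[(2 * A)%R]mulr1; apply: pot_bounded => // w'.
  by rewrite /box indicE; case: (_ \in _).
have h3 : kr A (box A) phi <= (\sum_(i < n) (W (y i) + (T (y i) - T (y i.+1)))) / N.
  rewrite (kr_sumr _ tb tame_c) mulr_suml; apply: ler_sum => i _; exact: kr_box_c.
have h4 : \sum_(i < n) (W (y i) + (T (y i) - T (y i.+1))) =
   \sum_(i < n) W (y i) + (T (y 0%N) - T (y n)).
  rewrite big_split/=; congr (_ + _).
  rewrite -(big_mkord xpredT (fun i => T (y i) - T (y i.+1))).
  rewrite (telescope_sumr_eq (fun i => - T (y i)))//; last first.
    by move=> k _; rewrite opprK addrC.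
  by rewrite opprK addrC.
have h5 : T (y 0%N) - T (y n) <= 2 * A * A + 8 * Num.sqrt A.
  apply: (le_trans (wmod_holder (y0 n) (ymono (leq0n n) (leqnn n)) (yA 0))).
  have d : y 0%N - y n <= A by rewrite lerBlDr (le_trans (yA 0))// lerDl.
  apply: lerD; first by rewrite ler_wpM2l// mulr_ge0// ltW.
  by rewrite ler_wpM2l// ler_sqrt// ltW.
have h6 : (\sum_(i < n) W (y i)) / N <= (\sum_(i < n.+1) W (x i)) / N + om.
  have h7 : \sum_(i < n) W (y i) <= \sum_(i < n.+1) W (x i) + N * om.
    rewrite big_ord_recr/=.
    have hl : 0 <= W (x ord_max) by rewrite (wpot_ge0 M0 th0)// x_ge0/=; exact: x_leA.
    have om0 : 0 <= om.
      by apply: addr_ge0; rewrite ?mulr_ge0 ?sqrtr_ge0 ?invr_ge0 ?(ltW A0) ?(ltW N0).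
    apply: (@le_trans _ _ (\sum_(i < n) (W (x (widen_ord (leqnSn n) i)) + om))).
      apply: ler_sum => i _; rewrite -lerBlDr.
      exact: (Wx_ge (widen_ord (leqnSn n) i)).
    rewrite big_split/= -addrA lerD2l sumr_const card_ord -mulr_natl.
    apply: (@le_trans _ _ (N * om)); last by rewrite lerDr.
    by rewrite ler_wpM2r// /N ler_nat.
  have -> : om = (N * om) / N by rewrite mulrAC divff ?gt_eqF// mul1r.
  by rewrite -mulrDl ler_wpM2r// invr_ge0 ltW.
rewrite h1; rewrite h4 in h3.
apply: (le_trans (lerD h3 h2)).
rewrite mulrDl.
have h8 : (T (y 0%N) - T (y n)) / N <= (2 * A * A + 8 * Num.sqrt A) / N.
  by rewrite ler_wpM2r// invr_ge0 ltW.
move: h6 h8; move: ((\sum_(i < n) W (y i)) / N) ((\sum_(i < n.+1) W (x i)) / N).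
move: ((T (y 0%N) - T (y n)) / N) ((2 * A * A + 8 * Num.sqrt A) / N) (2 * A / N).
move: om => q1 q2 q3 q4 q5 q6 h6 h8; lra.
Qed.

Lemma discretization_at : exists lam : {ffun 'I_n.+1 -> 'I_Mn.+1},
  [/\ boxed_partition lam, ell theta lam ord0 <= t * N &
   discrete_energy M theta (fun i => ell theta lam i / N) <=
   (theta * kr A f f - kr A (box A) f) +
   ((2 + 2 * theta + 2 * A) * (L ^+ 2 / N) +
    (2 * A / N + (2 * A * A + 8 * Num.sqrt A) / N + om))].
Proof.
exists lam; split => //.
  by have := x_le ord0; rewrite /x ler_pdivrMr// => h1; apply: (le_trans h1);
    rewrite ler_wpM2r// ltW.
rewrite /discrete_energy -/N -/A.
have h1 := sum_lk_x; have h2 := ler_wpM2l (ltW th0) sum_lk_y; have h3 := kr_box_f.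
rewrite -/x.
set S := \sum_i \sum_(_ < _ | _) _ in h1 *.
set S2 := \sum_i \sum_(_ < _ | _) _ in h1 h2.
set SW := \sum_i _ in h3 *.
have e1 : 2 * theta * S / N ^+ 2 <=
   2 * theta * (S2 + N * (ln N + A / theta) + theta^-1 * (N * L)) / N ^+ 2.
  rewrite ler_wpM2r ?invr_ge0 ?exprn_ge0 ?(ltW N0)// ler_wpM2l//.
  by rewrite mulr_ge0// ltW.
have e2 : 2 * theta * (S2 + N * (ln N + A / theta) + theta^-1 * (N * L)) / N ^+ 2 =
  theta * (N ^- 2 * (2 * S2)) + (2 * L + 2 * (theta * ln N) + 2 * A) / N.
  by field; rewrite !gt_eqF.
have e3 : (2 * L + 2 * (theta * ln N) + 2 * A) / N <=
   (2 + 2 * theta + 2 * A) * (L ^+ 2 / N).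
  rewrite [leRHS]mulrA ler_wpM2r ?invr_ge0 ?(ltW N0)//.
  by apply: lower_error_bound; rewrite ?(ltW th0) ?(ltW A0)// /L ?lerDl ?lerDr.
rewrite e2 in e1.
move: e1 e3 h2 h3.
move: (2 * theta * S / _) (theta * (N ^- 2 * (2 * S2))) (theta * kr A f f).
move: ((2 * L + 2 * (theta * ln N) + 2 * A) / N) ((2 + 2 * theta + 2 * A) * (L ^+ 2 / N)).
move: (kr A (box A) f) (SW / N).
move: (2 * A / N + (2 * A * A + 8 * Num.sqrt A) / N + om).
move=> q1 q2 q3 q4 q5 q6 q7 q8 *; lra.
Qed.

End discretization.


Section free_energy.
Context {R : realType}.
Variables (M theta : R).
Hypotheses (M0 : 0 < M) (th0 : 0 < theta).
Let A : R := M + theta.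
Let A0 : 0 < A. Proof. by rewrite /A addr_gt0. Qed.
Implicit Types (s t : R).

Definition rate n : R := (Num.sqrt n.+1%:R)^-1.

Let N0 n : 0 < n.+1%:R :> R. Proof. by rewrite ltr0n. Qed.
Let N1 n : 1 <= n.+1%:R :> R. Proof. by rewrite ler1n. Qed.

Lemma rate_gt0 n : 0 < rate n.
Proof. by rewrite invr_gt0 sqrtr_gt0. Qed.

Lemma inv_le_rate n : n.+1%:R^-1 <= rate n.
Proof.
rewrite /rate lef_pV2 ?posrE ?sqrtr_gt0//.
have h : 1 <= Num.sqrt (n.+1%:R : R) by rewrite -[leLHS]sqrtr1 ler_sqrt.
by rewrite -[leRHS]sqr_sqrtr ?(ltW (N0 n))// expr2 ler_peMr// (le_trans ler01).
Qed.

Lemma sqrt_div_rate a n : Num.sqrt (a / n.+1%:R) = Num.sqrt a * rate n.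
Proof.
by rewrite mulrC sqrtrM ?invr_ge0 ?(ltW (N0 n))// sqrtrV ?(ltW (N0 n))// mulrC.
Qed.

Lemma ln_sqr_le_rate n : (1 + ln n.+1%:R) ^+ 2 / n.+1%:R <= 25 * rate n.
Proof.
rewrite ler_pdivrMr// /rate; apply: (le_trans (ln_sqr_le (N1 n))).
rewrite -mulrA ler_wpM2l// [leRHS]mulrC ler_pdivlMr ?sqrtr_gt0//.
by rewrite -expr2 sqr_sqrtr// ltW.
Qed.

Lemma ln_le_rate n : (1 + ln n.+1%:R) / n.+1%:R <= 25 * rate n.
Proof.
apply: le_trans (ln_sqr_le_rate n); rewrite ler_wpM2r ?invr_ge0//.
by rewrite expr2 ler_peMr// ?addr_ge0 ?ln_ge0// lerDl ln_ge0.
Qed.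

Lemma discretization s n f : 0 < s -> s <= A -> capped theta s f ->
  exists lam : {ffun 'I_n.+1 -> 'I_(Num.truncn (M * n.+1%:R)).+1},
  [/\ boxed_partition lam, ell theta lam ord0 <= s * n.+1%:R &
   discrete_energy M theta (fun i => ell theta lam i / n.+1%:R) <=
   (theta * kr A f f - kr A (box A) f) +
   ((2 + 2 * theta + 2 * A) * ((1 + ln n.+1%:R) ^+ 2 / n.+1%:R) +
    (2 * A / n.+1%:R + (2 * A * A + 8 * Num.sqrt A) / n.+1%:R +
     (2 * A / n.+1%:R + 8 * Num.sqrt n.+1%:R^-1)))].
Proof.
move=> s0 sA cf; have [y hy] := quantiles th0 s0 A0 cf n.
exact: (discretization_at M0 th0 sA cf hy).
Qed.

Definition restricted_sum s n : R :=
  \sum_(lam : {ffun 'I_n.+1 -> 'I_(Num.truncn (M * n.+1%:R)).+1} |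
     boxed_partition lam && (ell theta lam ord0 <= s * n.+1%:R))
   weight theta (Num.truncn (M * n.+1%:R)) (ell theta lam).

Let K : R := 4 * (1 + theta) ^+ 3 / theta + (6 + theta) * (1 + A).
Let K0 : 0 <= K.
Proof.
have h1 : 0 <= 1 + theta by rewrite addr_ge0// ltW.
have h2 : 0 <= 6 + theta by rewrite addr_ge0// ltW.
have h3 : 0 <= 1 + A by rewrite addr_ge0// ltW.
rewrite /K addr_ge0//; last by rewrite mulr_ge0.
by rewrite divr_ge0 ?(ltW th0)// mulr_ge0// exprn_ge0.
Qed.

Let c0 : R := - theta * ln A + (A * ln A + A).
Let FV s := F theta s (potential M theta).

Definition defect_constant : R :=
  25 * (11 * theta + 8 * A + 3 + K + M) +
  (8 * A + 2 * A * theta + 2 * A * A + 8 * Num.sqrt A) + 8 * Num.sqrt theta + 8.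

Lemma weight_le s n (lam : {ffun 'I_n.+1 -> 'I_(Num.truncn (M * n.+1%:R)).+1}) :
  theta <= s -> s <= A ->
  boxed_partition lam -> ell theta lam ord0 <= s * n.+1%:R ->
  ln (weight theta (Num.truncn (M * n.+1%:R)) (ell theta lam)) <=
  weight_level M theta n + n.+1%:R ^+ 2 *
   (c0 - FV s + ((9 * theta + 6 * A) * ((1 + ln n.+1%:R) ^+ 2 / n.+1%:R) + 8 * A / n.+1%:R +
     (2 * A * (theta / n.+1%:R) + 8 * Num.sqrt (theta / n.+1%:R))) +
    K * ((1 + ln n.+1%:R) / n.+1%:R)).
Proof.
move=> ths sA bl ls; have [_ H] := ln_weight_approx M0 th0 bl.
have N20 : 0 <= n.+1%:R ^+ 2 :> R by rewrite exprn_ge0.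
pose x (i : 'I_n.+1) := ell theta lam i / n.+1%:R.
have x0 i : 0 <= x i by rewrite divr_ge0// ell_ge0.
have xs : x ord0 <= s by rewrite ler_pdivrMr.
have gap (i j : 'I_n.+1) : (i < j)%N -> (j - i)%:R * (theta / n.+1%:R) <= x i - x j.
  move=> ij; rewrite /x -mulrBl mulrA ler_wpM2r ?invr_ge0//; exact: ell_gap.
have [f [cf hf]] := thickening M0 th0 ths sA x0 xs gap.
have h2 := F_le M0 th0 sA cf.
move: H; rewrite ler_norml => /andP[_ H].
set err := (X in _ - _ + X + _).
have h3 : FV s - c0 - err <= discrete_energy M theta x.
  rewrite /FV /c0 /err; move: h2 hf; rewrite -/A.
  move: (theta * kr A f f - kr A (box A) f) (discrete_energy M theta x) (F _ _ _).
  move: (- theta * ln A + (A * ln A + A)) (_ + _ + (_ + _)) => a b c d e *; lra.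
have h4 := ler_wpM2l N20 h3.
have -> : K * ((1 + ln n.+1%:R) / n.+1%:R) =
   (K * (n.+1%:R * (1 + ln n.+1%:R))) / n.+1%:R ^+ 2 by field; rewrite nat1r pnatr_eq0.
rewrite mulrDr [n.+1%:R ^+ 2 * (_ / _)]mulrC divfK ?expf_neq0 ?pnatr_eq0//.
move: H h4; rewrite -/K -/(x).
have -> : n.+1%:R ^+ 2 * (c0 - FV s + err) = - (n.+1%:R ^+ 2 * (FV s - c0 - err)) by ring.
move: (n.+1%:R ^+ 2 * (FV s - c0 - err)) (n.+1%:R ^+ 2 * discrete_energy _ _ _).
move: (K * _) (ln (weight _ _ _)) (weight_level _ _ _) => a b c d e *; lra.
Qed.

Lemma weight_gt0 n (lam : {ffun 'I_n.+1 -> 'I_(Num.truncn (M * n.+1%:R)).+1}) :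
  boxed_partition lam ->
  0 < weight theta (Num.truncn (M * n.+1%:R)) (ell theta lam).
Proof. by move=> bl; case: (ln_weight_approx M0 th0 bl). Qed.

Lemma restricted_sum_ge s n (lam : {ffun 'I_n.+1 -> 'I_(Num.truncn (M * n.+1%:R)).+1}) :
  boxed_partition lam -> ell theta lam ord0 <= s * n.+1%:R ->
  weight theta (Num.truncn (M * n.+1%:R)) (ell theta lam) <= restricted_sum s n.
Proof.
move=> bl ls; rewrite /restricted_sum (bigD1 lam)/= ?bl//.
rewrite lerDl; apply: sumr_ge0 => lam' /andP[/andP[bl' _] _].
by apply: ltW; exact: weight_gt0.
Qed.

Lemma restricted_sum_gt0 s n : theta <= s -> 0 < restricted_sum s n.
Proof.
move=> ths.
pose lam : {ffun 'I_n.+1 -> 'I_(Num.truncn (M * n.+1%:R)).+1} := [ffun=> ord0].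
have bl : boxed_partition lam.
  by apply/forallP => i; apply/forallP => j; apply/implyP => _; rewrite !ffunE.
have ls : ell theta lam ord0 <= s * n.+1%:R.
  rewrite /ell ffunE/= add0r mulrC ler_pM ?(ltW th0)//.
  by rewrite ler_nat subSS subn0.
exact: lt_le_trans (weight_gt0 bl) (restricted_sum_ge bl ls).
Qed.

Lemma ln_card_le n : ln (Num.truncn (M * n.+1%:R)).+1%:R <= (1 + M) * (1 + ln n.+1%:R) :> R.
Proof.
have /andP[h _] := truncn_itv (ltW (mulr_gt0 M0 (N0 n))).
have M1 : 0 < 1 + M by rewrite addr_gt0.
apply: (@le_trans _ _ (ln ((1 + M) * n.+1%:R))).
  rewrite ler_ln ?posrE ?mulr_gt0// mulrDl mul1r -natr1 addrC lerD//.
rewrite lnM ?posrE//.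
have l1 : ln (1 + M) <= M by rewrite le_ln1Dx// (lt_trans _ M0)// ltrN10.
have l2 : 0 <= ln (n.+1%:R : R) by rewrite ln_ge0.
have l3 : 0 <= M * ln n.+1%:R by rewrite mulr_ge0// ltW.
lra.
Qed.

Lemma ln_restricted_sum_le s n : theta <= s -> s <= A ->
  ln (restricted_sum s n) <=
  weight_level M theta n + n.+1%:R ^+ 2 * (c0 - FV s + defect_constant * rate n).
Proof.
move=> ths sA; set r := rate n; set N : R := n.+1%:R.
have r0 : 0 < r := rate_gt0 n.
pose e := c0 - FV s + ((9 * theta + 6 * A) * ((1 + ln N) ^+ 2 / N) + 8 * A / N +
     (2 * A * (theta / N) + 8 * Num.sqrt (theta / N))) + K * ((1 + ln N) / N).
pose B := weight_level M theta n + N ^+ 2 * e.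
have h1 : restricted_sum s n <= ((Num.truncn (M * N)).+1%:R ^+ n.+1) * expR B.
  apply: (@le_trans _ _ (\sum_(lam : {ffun 'I_n.+1 -> 'I_(Num.truncn (M * n.+1%:R)).+1} |
     boxed_partition lam && (ell theta lam ord0 <= s * n.+1%:R)) expR B)).
    apply: ler_sum => lam /andP[bl ls]; have w0 := weight_gt0 bl.
    rewrite -[leLHS](lnK (x := _)) ?posrE// ler_expR.
    exact: weight_le.
  rewrite sumr_const -[leLHS]mulr_natl ler_wpM2r ?expR_ge0// -natrX ler_nat.
  by apply: (leq_trans (max_card _)); rewrite card_ffun !card_ord.
have Z0 := restricted_sum_gt0 n ths.
have c1 : (0 : R) < (Num.truncn (M * N)).+1%:R by rewrite ltr0n.
have h2 : ln (restricted_sum s n) <= N * ((1 + M) * (1 + ln N)) + B.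
  apply: (@le_trans _ _ (ln ((Num.truncn (M * N)).+1%:R ^+ n.+1 * expR B))).
    by rewrite ler_ln ?posrE ?mulr_gt0 ?exprn_gt0 ?expR_gt0.
  rewrite lnM ?posrE ?exprn_gt0 ?expR_gt0// expRK lerD2r lnXn// -[leLHS]mulr_natl.
  by rewrite ler_wpM2l// ln_card_le.
apply: (le_trans h2).
have -> : N * ((1 + M) * (1 + ln N)) + B = weight_level M theta n +
    N ^+ 2 * (e + (1 + M) * ((1 + ln N) / N)).
  rewrite /B; clear h2; clearbody e; move: (weight_level _ _ _) (ln N) => w l'.
  by field; rewrite gt_eqF.
rewrite lerD2l ler_wpM2l ?exprn_ge0// /e -!addrA !lerD2l.
have q1 := ln_sqr_le_rate n; have q2 := ln_le_rate n; have q3 := inv_le_rate n.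
rewrite -/N -/r in q1 q2 q3.
have p1 : 0 <= 9 * theta + 6 * A by rewrite addr_ge0// mulr_ge0// ltW.
have p2 : 0 <= 8 * A by rewrite mulr_ge0// ltW.
have p3 : 0 <= 2 * A * theta by rewrite !mulr_ge0 ?(ltW A0) ?(ltW th0).
have p4 : 0 <= 1 + M by rewrite addr_ge0// ltW.
have r1 := ler_wpM2l p1 q1; have r2 := ler_wpM2l p2 q3.
have r3 := ler_wpM2l p3 q3; have r4 := ler_wpM2l K0 q2; have r5 := ler_wpM2l p4 q2.
have r6 : 8 * Num.sqrt (theta / N) = 8 * Num.sqrt theta * r.
  by rewrite sqrt_div_rate mulrA.
have E1 : 8 * A / N = 8 * A * N^-1 by [].
have E2 : 2 * A * (theta / N) = 2 * A * theta * N^-1 by ring.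
rewrite E2 r6.
have ge : (9 * theta + 6 * A) * (25 * r) + 8 * A * r + (2 * A * theta * r + 8 * Num.sqrt theta * r)
   + K * (25 * r) + (1 + M) * (25 * r) <= defect_constant * r.
  have -> : (9 * theta + 6 * A) * (25 * r) + 8 * A * r +
     (2 * A * theta * r + 8 * Num.sqrt theta * r) + K * (25 * r) + (1 + M) * (25 * r) =
     (25 * (9 * theta + 6 * A + 1 + K + M) + 8 * A + 2 * A * theta + 8 * Num.sqrt theta) * r.
    by ring.
  rewrite ler_wpM2r ?(ltW r0)// /defect_constant.
  have z1 : 0 <= A * A by rewrite mulr_ge0// ltW.
  have z2 := sqrtr_ge0 A; have z3 := sqrtr_ge0 theta.
  rewrite -subr_ge0; set d := (X in 0 <= X).
  have -> : d = 50 * theta + 50 * A + 58 + 2 * (A * A) + 8 * Num.sqrt A by rewrite /d; ring.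
  by rewrite !addr_ge0 ?mulr_ge0 ?(ltW th0) ?(ltW A0).
apply: le_trans ge.
move: r1 r2 r3 r4 r5; rewrite -!addrA.
move=> r1 r2 r3 r4 r5.
exact: lerD r1 (lerD r2 (lerD r3 (lerD (lexx _) (lerD r4 r5)))).
Qed.

Lemma ln_restricted_sum_ge s n : theta <= s -> s <= A ->
  weight_level M theta n + n.+1%:R ^+ 2 * (c0 - FV s - defect_constant * rate n) <=
  ln (restricted_sum s n).
Proof.
move=> ths sA; set r := rate n; set N : R := n.+1%:R.
have r0 : 0 < r := rate_gt0 n.
have s0 : 0 < s by exact: lt_le_trans ths.
have N2 : 0 < N ^+ 2 by rewrite exprn_gt0.
set lev := weight_level _ _ _.
pose e := (2 + 2 * theta + 2 * A) * ((1 + ln N) ^+ 2 / N) +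
    (2 * A / N + (2 * A * A + 8 * Num.sqrt A) / N + (2 * A / N + 8 * Num.sqrt N^-1)).
have he : e + K * ((1 + ln N) / N) <= defect_constant * r.
  have q1 := ln_sqr_le_rate n; have q2 := ln_le_rate n; have q3 := inv_le_rate n.
  rewrite -/N -/r in q1 q2 q3.
  have z2 := sqrtr_ge0 A; have z3 := sqrtr_ge0 theta.
  have z1 : 0 <= A * A by rewrite mulr_ge0// ltW.
  have z4 : 0 <= A * theta by rewrite mulr_ge0// ltW.
  have p1 : 0 <= 2 + 2 * theta + 2 * A.
    by rewrite !addr_ge0 ?mulr_ge0 ?(ltW th0) ?(ltW A0).
  have p2 : 0 <= 2 * A by rewrite mulr_ge0// ltW.
  have p3 : 0 <= 2 * A * A + 8 * Num.sqrt A.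
    by rewrite addr_ge0 ?mulr_ge0 ?(ltW A0).
  have r1 := ler_wpM2l p1 q1; have r2 := ler_wpM2l p2 q3.
  have r3 := ler_wpM2l p3 q3; have r4 := ler_wpM2l K0 q2.
  have -> : defect_constant * r = (2 + 2 * theta + 2 * A) * (25 * r) +
    (2 * A * r + (2 * A * A + 8 * Num.sqrt A) * r + (2 * A * r + 8 * r)) + K * (25 * r) +
    (25 * (9 * theta + 6 * A + 1 + M) + 4 * A + 2 * (A * theta) + 8 * Num.sqrt theta) * r.
    by rewrite /defect_constant; ring.
  have rs : 8 * Num.sqrt N^-1 = 8 * r by rewrite sqrtrV// ltW.
  rewrite /e rs; apply: (@le_trans _ _ ((2 + 2 * theta + 2 * A) * (25 * r) +
    (2 * A * r + (2 * A * A + 8 * Num.sqrt A) * r + (2 * A * r + 8 * r)) + K * (25 * r))).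
    exact: lerD (lerD r1 (lerD (lerD r2 r3) (lerD r2 (lexx _)))) r4.
  rewrite lerDl mulr_ge0 ?(ltW r0)//.
  by rewrite !addr_ge0 ?mulr_ge0 ?addr_ge0 ?mulr_ge0 ?(ltW th0) ?(ltW A0) ?(ltW M0).
pose q := (ln (restricted_sum s n) - lev) / N ^+ 2.
have qE : ln (restricted_sum s n) = lev + N ^+ 2 * q.
  by rewrite /q mulrC divfK ?gt_eqF// addrC subrK.
clearbody q.
have key : c0 - q - (e + K * ((1 + ln N) / N)) <= FV s.
  apply: (F_ge M0 th0 ths sA) => f cf; rewrite -/A -/c0.
  have [lam [bl ls hD]] := discretization n s0 sA cf.
  have [_ H] := ln_weight_approx M0 th0 bl.
  have h1 : ln (weight theta (Num.truncn (M * N)) (ell theta lam)) <= lev + N ^+ 2 * q.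
    rewrite -qE ler_ln ?posrE ?restricted_sum_gt0 ?weight_gt0//.
    exact: restricted_sum_ge.
  move: H; rewrite ler_norml => /andP[H _]; rewrite -/K -/N -/lev in H.
  rewrite -/N -/e in hD.
  set DE := discrete_energy _ _ _ in H hD.
  have h2 : - (N ^+ 2 * DE) - K * (N * (1 + ln N)) <= N ^+ 2 * q.
    clear - H h1; move: H h1; move: (N ^+ 2 * DE) (N ^+ 2 * q) (K * (N * (1 + ln N))) lev (ln (weight _ _ _)).
    by move=> a b c d g *; lra.
  have h3 : - DE - K * ((1 + ln N) / N) <= q.
    rewrite -(ler_pM2l N2); apply: le_trans h2.
    rewrite le_eqVlt; apply/orP; left; apply/eqP; clearbody DE e.
    by field; rewrite gt_eqF.
  move: h3 hD; clear h1 h2 qE; move: (K * _) (theta * kr A f f - kr A (box A) f) => a b.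
  by clearbody DE e c0 => *; lra.
rewrite qE lerD2l ler_wpM2l ?exprn_ge0//.
move: key he; clear qE; move: (K * _) (defect_constant * r) (FV s) => a b c.
by clearbody e c0 => *; lra.
Qed.

Lemma Prob_ratio t n :
  Prob theta (Num.truncn (M * n.+1%:R)) (fun l : 'I_n.+1 -> R => l ord0 <= t * n.+1%:R) =
  restricted_sum t n / restricted_sum A n.
Proof.
rewrite /Prob -mulr_suml; congr (_ / _).
rewrite /partition_function /restricted_sum; apply: eq_bigl => lam.
have [bl|//] := boolP (boxed_partition lam).
by rewrite (le_trans _ (ell_leA M0 th0 lam ord0))// lerDl ltW.
Qed.

Lemma ln_Prob_approx t n : theta <= t -> t <= A ->
  `|FV A - FV t - ln (Prob theta (Num.truncn (M * n.+1%:R))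
      (fun l : 'I_n.+1 -> R => l ord0 <= t * n.+1%:R)) / n.+1%:R ^+ 2| <=
  2 * defect_constant * rate n.
Proof.
move=> tht tA; have thA : theta <= A by rewrite lerDr ltW.
rewrite Prob_ratio ln_div ?posrE ?restricted_sum_gt0//.
have N2 : 0 < n.+1%:R ^+ 2 :> R by rewrite exprn_gt0.
have u1 := ln_restricted_sum_le n tht tA; have u2 := ln_restricted_sum_ge n tht tA.
have v1 := ln_restricted_sum_le n thA (lexx A).
have v2 := ln_restricted_sum_ge n thA (lexx A).
set q := (_ / _); set d := defect_constant * rate n.
have qE : ln (restricted_sum t n) - ln (restricted_sum A n) = n.+1%:R ^+ 2 * q.
  by rewrite /q mulrC divfK ?gt_eqF.
rewrite -mulrA -/d; rewrite -/d in u1 u2 v1 v2; clearbody q.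
have h1 : n.+1%:R ^+ 2 * q <= n.+1%:R ^+ 2 * (FV A - FV t + 2 * d).
  rewrite -qE; have -> : n.+1%:R ^+ 2 * (FV A - FV t + 2 * d) =
    n.+1%:R ^+ 2 * (c0 - FV t + d) - n.+1%:R ^+ 2 * (c0 - FV A - d) by ring.
  move: u1 v2; move: (n.+1%:R ^+ 2 * _) (n.+1%:R ^+ 2 * _) (weight_level _ _ _) => *; lra.
have h2 : n.+1%:R ^+ 2 * (FV A - FV t - 2 * d) <= n.+1%:R ^+ 2 * q.
  rewrite -qE; have -> : n.+1%:R ^+ 2 * (FV A - FV t - 2 * d) =
    n.+1%:R ^+ 2 * (c0 - FV t - d) - n.+1%:R ^+ 2 * (c0 - FV A + d) by ring.
  move: u2 v1; move: (n.+1%:R ^+ 2 * _) (n.+1%:R ^+ 2 * _) (weight_level _ _ _) => *; lra.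
rewrite ler_pM2l// in h1; rewrite ler_pM2l// in h2.
move: h1 h2; clear; move: (FV A) (FV t) d => a b d' h1 h2.
by rewrite ler_norml; apply/andP; split; lra.
Qed.

Lemma rate_cvg0 : rate n @[n --> \oo] --> (0 : R).
Proof.
apply/cvgrPdist_le => e e0; near=> n.
rewrite sub0r normrN gtr0_norm ?rate_gt0// /rate.
rewrite -[leRHS]invrK lef_pV2 ?posrE ?invr_gt0 ?sqrtr_gt0//.
rewrite -(ler_pXn2r (n := 2))// ?nnegrE ?invr_ge0 ?sqrtr_ge0 ?(ltW e0)//.
rewrite sqr_sqrtr ?(ltW (N0 n))//.
apply: (@le_trans _ _ n%:R); last by rewrite ler_nat.
near: n; exact: nbhs_infty_ger.
Unshelve. all: by end_near. Qed.

Lemma ln_Prob_cvg t : theta <= t <= A ->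
  (ln (Prob theta (Num.truncn (M * n.+1%:R))
      (fun l : 'I_n.+1 -> R => l ord0 <= t * n.+1%:R)) / n.+1%:R ^+ 2)
    @[n --> \oo] --> FV A - FV t.
Proof.
move=> /andP[tht tA]; apply/cvgrPdist_le => e e0.
have D0 : 0 < 2 * defect_constant.
  apply: mulr_gt0 => //; rewrite ltr_wpDl//.
  have z1 := K0; have z2 := ltW A0; have z3 := ltW th0; have z4 := ltW M0.
  move: z1 z2 z3 z4; move: (K) (A) (theta) (M) => k a b c k0 a0 b0 d0.
  by do ?[apply: addr_ge0 | apply: mulr_ge0]; rewrite ?sqrtr_ge0.
have eD : 0 < e / (2 * defect_constant) by exact: divr_gt0.
have /cvgrPdist_le/(_ _ eD) cv := rate_cvg0.
near=> n; apply: (le_trans (ln_Prob_approx n tht tA)).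
rewrite mulrC -ler_pdivlMr//.
have : `|0 - rate n| <= e / (2 * defect_constant) by near: n.
by rewrite sub0r normrN gtr0_norm// rate_gt0.
Unshelve. all: by end_near. Qed.

End free_energy.


Theorem proposition6p7 (R : realType) (M theta : R)
    (M_gt0 : 0 < M) (theta_gt0 : 0 < theta) :
  let FV := fun s : R => F theta s (potential M theta) in
  let edge := (M + theta) / 2 + Num.sqrt (M * theta) in
  [/\ forall t : R, theta <= t <= M + theta ->
        (let N := n.+1 in
         ln (Prob theta (Num.truncn (M * N%:R))
               (fun l : 'I_N -> R => l ord0 <= t * N%:R)) / N%:R ^+ 2)
          @[n --> \oo] --> FV (M + theta) - FV t,
      M < theta ->
        forall t : R, theta <= t < M + theta -> FV (M + theta) < FV t &
      theta <= M ->
        (forall t : R, theta <= t < edge -> FV (M + theta) < FV t) /\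
        (forall t : R, edge <= t <= M + theta -> FV t = FV (M + theta))].
Proof.
move=> FV edge; have [small large] := F_compare M_gt0 theta_gt0.
split=> // t tA; exact: ln_Prob_cvg.
Qed.
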